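(* Let $x$ and $y$ be positive rational numbers with $x^y = y^{2x}$. Then either (a) there is an integer $n$ with $n \neq 0, -1$ such that $x = \left(2 + \frac{2}{n}\right)^{n}$ and $y = \left(2 + \frac{2}{n}\right)^{1+n}$; or (b) $(x,y)$ is one of $(1,1)$, $(2,16)$, or $\left(\left(\frac{4}{5}\right)^{128}, \left(\frac{4}{5}\right)^{125}\right)$. *)

(* Defs.v *)
From Stdlib Require Export Reals QArith Qreals.

(* Main.v *)
(** Taking logarithms, [t = y / (2x)] satisfies [(t - 1) ln x = ln (2t)]. Writing [t - 1 = A / B] in
    lowest terms gives [x ^ A = (2 (A + B) / B) ^ B]. If [|A| = 1] this is family (a). Otherwise
    [2 (A + B) / B] is a [k]-th power [(p / q) ^ k] with [k = |A|], and comparing numerators and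
    denominators yields [|p ^ k - 2 q ^ k| = k] or [2k] with [k] odd.

    For [k >= 2600] the fraction [p / q] would approximate the [k]-th root of 2 too well: an
    interpolation determinant in the functions [s |-> C(s, i) (p / q) ^ s 2 ^ j] is a nonzero integer
    after clearing denominators, yet smaller than 1 in absolute value. For [5 <= k < 2600] there is,
    with five exceptions, a prime [l = 1 (mod k)] with few [k]-th power residues modulo which the
    equation has no solution. The exception [(9, 18)] is excluded modulo 27; in the others [p - q theta],
    [theta ^ k = 2], is a fixed element times a unit of [Z[theta]]. By a pigeonhole argument any
    [(k + 1) / 2] units are multiplicatively dependent, so a [k]-th power residue character of a prime
    above [l] that is trivial on enough known units is trivial on all units, and such characters
    exclude all residues of [p / q].

    For [k = 3] the same elements are [(1 + theta) (theta - 1) ^ n], and a 3-adic expansion in [n]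
    determines when one of their coordinates vanishes. *)

From Stdlib Require NArith Arith Wf_nat ZArith Znumtheory Zpow_facts Ring Lia Lra Psatz Reals.
From mathcomp Require all_boot all_order all_fingroup all_algebra all_field zify ring lra.

(** * The interpolation determinant *)

Module Interpolation.

Import all_boot all_order all_fingroup all_algebra.
Import zify ring lra.
Set Implicit Arguments. Unset Strict Implicit. Unset Printing Implicit Defensive.
Import Order.TTheory GRing.Theory Num.Theory.
Local Open Scope ring_scope.

(** A congruence settles one exponent at a time, so a uniform argument has to cover all large k. It
    starts from the point (p/q, 2), which lies almost on the curve w = X^k through (1, 1): the
    determinant collects derivatives of the monomials X^l w^j at both points, and a combination of
    them with few coefficients cannot vanish to high order at both. It is small because p/q - 1 lies
    between 1/(2k) and 1/k, so that each order of divided difference brings a factor of about 1/k.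
    The price is a power of the denominator, and with the estimates used here the gain wins from
    2600 on.

    The unit argument works with units that are only certified to be independent modulo k-th powers.
    Dual characters give this independence, pigeonhole bounds the rank from above, and for any
    further unit some power with exponent prime to k is then a product of powers of the known ones.

    The exponent 3 resists every congruence because a^3 + 2 b^3 = 3 has the solutions (1, 1) and
    (-5, 4); the second one produces ((4/5)^128, (4/5)^125). *)

Definition euler_op (R : comNzRingType) (p : {poly R}) : {poly R} := 'X * p^`().

Lemma iter_euler_dvdp (F : fieldType) (a : F) (e h : nat) (p : {poly F}) :
  ('X - a%:P) ^+ e %| p -> ('X - a%:P) ^+ (e - h) %| iter h (@euler_op F) p.
Proof.
move=> dv; elim: h => [|h IH]; first by rewrite subn0.
rewrite iterS; move: IH; set q := iter _ _ _ => IH; rewrite subnS.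
case: (e - h)%N IH => [|d] IH; first by rewrite expr0 dvd1p.
case/dvdpP: IH => r ->; rewrite /euler_op derivM dvdp_mull //= dvdp_add //.
  by rewrite exprS mulrA dvdp_mulIr.
by rewrite dvdp_mull // deriv_exp derivXsubC mul1r -mulr_natl dvdp_mull.
Qed.

(** The bound [d] depends on the column only, so each permutation contributes a product of degree at
    most the sum of [d], whose coefficient there is the product of the coefficients of its
    factors. *)
Lemma coef_det_top (R : comNzRingType) (r : nat) (A : 'M[{poly R}]_r) (d : 'I_r -> nat) :
  (forall h i, (size (A h i) <= (d i).+1)%N) ->
  (size (\det A) <= (\sum_i d i).+1)%N /\
  (\det A)`_(\sum_i d i)%N = \det (\matrix_(h, i) (A h i)`_(d i)).
Proof.
move=> szA.
have prodP (s : 'S_r) : (size (\prod_i A i (s i))%R <= (\sum_i d (s i)).+1)%N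
   /\ (\prod_i A i (s i))`_(\sum_i d (s i))%N = \prod_i (A i (s i))`_(d (s i)).
  elim: (index_enum _) => [|i L]; first by rewrite !big_nil size_poly1 coef1.
  rewrite !big_cons.
  set n := (\sum_(j <- L) d (s j))%N; set p := \prod_(j <- L) A j (s j) => -[szp <-].
  have szAi := szA i (s i); split.
    apply: leq_trans (size_polyMleq _ _) _.
    by rewrite -subn1 leq_subLR add1n -addnS -addSn leq_add.
  rewrite coefM; have lt : (d (s i) < (d (s i) + n).+1)%N by rewrite ltnS leq_addr.
  rewrite (bigD1 (Ordinal lt)) //= addKn big1 ?addr0 // => j.
  rewrite -val_eqE /= neq_ltn => /orP [lj|lj].
    by rewrite [p`__]nth_default ?mulr0 //; apply: leq_trans szp _; rewrite ltn_subRL ltn_add2r.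
  by rewrite nth_default ?mul0r //; apply: leq_trans szAi _.
have sumd (s : 'S_r) : (\sum_i d (s i) = \sum_i d i)%N.
  by rewrite [RHS](reindex_inj (@perm_inj _ s)).
split.
  apply: leq_trans (size_sum _ _ _) _; apply/bigmax_leqP => s _.
  rewrite mulr_sign; have [] := prodP s; rewrite sumd => h _.
  by case: ifP => _; rewrite ?size_polyN.
rewrite /determinant coef_sum; apply: eq_bigr => s _.
have [_] := prodP s; rewrite sumd => e.
have -> : ((-1) ^+ s : {poly R}) = ((-1) ^+ s)%:P by rewrite rmorphXn /= polyCN polyC1.
by rewrite coefCM e; congr (_ * _); apply: eq_bigr => i _; rewrite mxE.
Qed.

(** The Euler operator conjugated by X^w: it multiplies the coefficient of X^m by m + w. *)
Definition twisted_euler (R : comNzRingType) (w : nat) (p : {poly R}) : {poly R} :=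
  euler_op p + p *+ w.

Lemma coef_iter_twisted_euler (R : comNzRingType) (w h m : nat) (p : {poly R}) :
  (iter h (twisted_euler w) p)`_m = p`_m * ((m + w) ^ h)%:R.
Proof.
elim: h => [|h IH]; first by rewrite expn0 mulr1.
rewrite iterS; move: IH; set q := iter _ _ _ => IH.
have -> : (twisted_euler w q)`_m = q`_m * (m + w)%:R.
  rewrite /twisted_euler /euler_op coefD coefXM coefMn natrD mulrDr mulr_natr.
  rewrite !mulr_natr; congr (_ + _).
  by case: m {IH} => [|m] /=; rewrite ?mulr0n // coef_deriv.
by rewrite IH -mulrA -natrM expnSr.
Qed.

Lemma size_iter_twisted_euler (R : comNzRingType) (w h : nat) (p : {poly R}) :
  (size (iter h (twisted_euler w) p) <= size p)%N.
Proof.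
apply/leq_sizeP => m le_m; rewrite coef_iter_twisted_euler.
by rewrite nth_default ?mul0r.
Qed.

Lemma iter_euler_mulXn (R : comNzRingType) (w h : nat) (p : {poly R}) :
  iter h (@euler_op R) ('X^w * p) = 'X^w * iter h (twisted_euler w) p.
Proof.
elim: h => //= h ->; move: (iter h _ p) => q.
rewrite /twisted_euler /euler_op derivM derivXn mulrDr mulrDr addrC; congr (_ + _).
  by rewrite mulrCA.
case: w => [|w]; first by rewrite !mulr0n mul0r !mulr0.
by rewrite mulrnAl mulrnAr mulrA -exprS -mulrnAr.
Qed.

Lemma iter_euler_sum (R : comNzRingType) (J : finType) (h : nat)
    (a : J -> R) (f : J -> {poly R}) :
  iter h (@euler_op R) (\sum_j a j *: f j) =
  \sum_j a j *: iter h (@euler_op R) (f j).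
Proof.
elim: h => //= h ->; rewrite /euler_op linear_sum mulr_sumr.
by apply: eq_bigr => j _; rewrite linearZ scalerAr.
Qed.

(** Cramer's rule: row [i0] of the adjugate, applied to the combinations of columns, isolates
    [y i0 * \det A]. The weakest of the given divisibilities is the one for the last row, h = r -
    1. *)
Lemma dvdp_det_exp (F : fieldType) (r : nat) (A : 'M[{poly F}]_r)
    (y : 'I_r -> {poly F}) (i0 : 'I_r) (a : F) (e : nat) :
  (forall h : 'I_r, ('X - a%:P) ^+ (e - h) %| \sum_i y i * A h i) ->
  ('X - a%:P) ^+ (e - r.-1) %| y i0 * \det A.
Proof.
move=> dv.
have -> : y i0 * \det A = \sum_h (\adj A) i0 h * \sum_i y i * A h i.
  under eq_bigr => h _ do rewrite mulr_sumr.
  rewrite exchange_big /=.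
  transitivity (\sum_i y i * (\adj A *m A) i0 i); last first.
    apply: eq_bigr => i _; rewrite mxE mulr_sumr.
    by apply: eq_bigr => h _; rewrite mulrCA.
  rewrite mul_adj_mx (bigD1 i0) //= mxE eqxx mulr1n big1 ?addr0 // => i ne.
  by rewrite mxE eq_sym (negPf ne) mulr0n mulr0.
apply: (big_ind (fun p => ('X - a%:P) ^+ (e - r.-1) %| p)) => [||h _].
- by rewrite dvdp0.
- by move=> p q; apply: dvdp_add.
apply: dvdp_mull; apply: dvdp_trans (dv h); apply: dvdp_exp2l.
by apply: leq_sub2l; case: r h {A y i0 dv} => [[]//|r h]; rewrite -ltnS ltn_ord.
Qed.

Lemma muln_succ_pred (r n : nat) : (0 < n)%N -> (r * n.+1 = r * n.-1 + r + r)%N.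
Proof. by case: n => // n _; rewrite !mulnS; lia. Qed.

(* The matrix of the iterated Euler derivatives of the summands is a Wronskian
   with all powers of X factored out, which is what keeps its degree below
   [r * (n - 1)]. *)
Lemma zero_estimate (F : numFieldType) (k n mu T I : nat) (x g : F)
    (P : 'I_mu -> {poly F}) :
  (0 < n <= k)%N -> x != 0 -> x != 1 -> g != 0 ->
  (mu * n.+1 <= (T + I).+1)%N ->
  (forall j, (size (P j) <= n)%N) ->
  ('X - 1%:P) ^+ T %| \sum_(j < mu) 1 *: ('X^(j * k) * P j) ->
  ('X - x%:P) ^+ I %| \sum_(j < mu) g ^+ j *: ('X^(j * k) * P j) ->
  forall j, P j = 0.
Proof.
move=> /andP[n0 nk] x0 x1 g0 le_mu szP dv1 dvx j0; apply/eqP/negPn/negP => Pj0.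
pose J := [set j | P j != 0].
pose r := #|J|.
have j0J : j0 \in J by rewrite inE.
pose i0 : 'I_r := enum_rank_in j0J j0.
pose w (i : 'I_r) := (enum_val i * k)%N.
pose Q (i : 'I_r) := P (enum_val i).
have Q0 i : Q i != 0 by have := enum_valP i; rewrite inE.
pose A : 'M[{poly F}]_r := \matrix_(h, i) iter h (twisted_euler (w i)) (Q i).
pose d i := (size (Q i)).-1.
have szd i : size (Q i) = (d i).+1 by rewrite prednK // size_poly_gt0.
have dn i : (d i < n)%N by rewrite -szd szP.
have [szdet cfdet] : (size (\det A) <= (\sum_i d i).+1)%N /\
  (\det A)`_(\sum_i d i)%N = \det (\matrix_(h, i) (A h i)`_(d i)).
  by apply: coef_det_top => h i; rewrite mxE -szd size_iter_twisted_euler.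
(* The top coefficients form a Vandermonde matrix in the numbers d i + w i, scaled by leading
   coefficients. These numbers are distinct: since d i < n <= k, division by k recovers the index of
   the block. *)
have det0 : \det A != 0.
  suff : (\det A)`_(\sum_i d i)%N != 0 by apply: contraNneq => ->; rewrite coef0.
  pose b : 'rV[F]_r := \row_i (d i + w i)%:R.
  pose lc : 'rV[F]_r := \row_i lead_coef (Q i).
  rewrite cfdet.
  have -> : \matrix_(h, i) (A h i)`_(d i) = Vandermonde r b *m diag_mx lc.
    apply/matrixP => h i; rewrite !mxE coef_iter_twisted_euler.
    rewrite (bigD1 i) //= !mxE eqxx mulr1n big1 ?addr0; last first.
      by move=> i' ne; rewrite !mxE (negPf ne) mulr0n mulr0.
    by rewrite natrX mulrC lead_coefE.
  rewrite det_mulmx det_Vandermonde det_diag mulf_neq0 //.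
    apply/prodf_neq0 => i _; apply/prodf_neq0 => i' lt_i.
    rewrite !mxE subr_eq0 eqr_nat; apply/negP => /eqP e.
    have : enum_val i' = enum_val i.
      apply/val_inj.
      have k0 : (0 < k)%N by apply: leq_trans nk.
      have := congr1 (fun s => s %/ k)%N e; rewrite /w ![(d _ + _)%N]addnC !divnMDl //.
      by rewrite !divn_small ?addn0 ?(leq_trans (dn _)).
    by move/enum_val_inj => e'; rewrite e' ltnn in lt_i.
  by apply/prodf_neq0 => i _; rewrite mxE lead_coef_eq0.
have key (a : F) (e : nat) (h : F) : a != 0 -> h != 0 ->
  ('X - a%:P) ^+ e %| \sum_(j < mu) h ^+ j *: ('X^(j * k) * P j) ->
  ('X - a%:P) ^+ (e - r.-1) %| \det A.
  move=> a0 h0 dv.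
  have := @dvdp_det_exp _ _ A (fun i => h ^+ (enum_val i) *: 'X^(w i)) i0 a e.
  rewrite -scalerAl dvdpZr ?expf_neq0 // Gauss_dvdpr; last first.
    apply/coprimep_expl/coprimep_expr.
    by rewrite coprimep_sym coprimep_XsubC rootE hornerX.
  apply => s; have := iter_euler_dvdp s dv.
  rewrite iter_euler_sum (bigID (mem J)) /= [X in _ %| _ + X]big1 ?addr0; last first.
    move=> j; rewrite inE negbK => /eqP ->; rewrite mulr0.
    have -> : iter s (@euler_op F) 0 = 0.
      by elim: (nat_of_ord s) => //= m ->; rewrite /euler_op deriv0 mulr0.
    by rewrite scaler0.
  rewrite big_enum_val; congr (_ %| _); apply: eq_bigr => i _.
  by rewrite mxE iter_euler_mulXn scalerAl.
have D1 : ('X - 1%:P) ^+ (T - r.-1) %| \det A.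
  apply: (key 1 T 1); rewrite ?oner_neq0 //.
  by under eq_bigr => j _ do rewrite expr1n.
have Dx := key x I g x0 g0 dvx.
have := dvdp_leq det0 (_ : ('X - 1%:P) ^+ (T - r.-1) * ('X - x%:P) ^+ (I - r.-1) %| \det A).
rewrite Gauss_dvdp; last first.
  apply/coprimep_expl/coprimep_expr.
  by rewrite coprimep_XsubC rootE hornerXsubC subr_eq0.
rewrite D1 Dx => /(_ isT).
rewrite size_Mmonic ?monic_exp ?monicXsubC //; last first.
  by rewrite -size_poly_gt0 size_exp_XsubC.
rewrite !size_exp_XsubC addnS /= => le1.
have le2 : (\sum_i d i <= r * n.-1)%N.
  rewrite -[X in (_ <= X * _)%N]card_ord -sum_nat_const.
  by apply: leq_sum => i _; rewrite -ltnS prednK.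
have le3 : (r <= mu)%N by rewrite -[X in (_ <= X)%N]card_ord /r max_card.
have r0 : (0 < r)%N by apply: leq_ltn_trans (ltn_ord i0).
have le4 : (r * n.+1 <= (T + I).+1)%N by apply: leq_trans le_mu; rewrite leq_mul2r le3 orbT.
(* The degree count (T - r + 1) + (I - r + 1) <= r (n - 1) contradicts r (n + 1) <= T + I + 1. *)
have le5 : (T - r.-1 + (I - r.-1) <= r * n.-1)%N.
  by have := leq_trans le1 szdet; rewrite ltnS => h; apply: leq_trans h le2.
have e : (r * n.+1 = r * n.-1 + r + r)%N by exact: muln_succ_pred.
by clear -r0 le4 le5 e; lia.
Qed.

Lemma dvdp_nderivn (F : fieldType) (p : {poly F}) (a : F) (e : nat) :
  (forall i, (i < e)%N -> p^`N(i).[a] = 0) -> ('X - a%:P) ^+ e %| p.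
Proof.
move=> p0.
have -> : p = \sum_(i < size p) (p^`N(i).[a])%:P * ('X - a%:P) ^+ i.
  rewrite -[LHS]comp_polyXr /comp_poly -[X in _.[X]](subrK a%:P) addrC.
  rewrite nderiv_taylor ?size_map_polyC; last exact: mulrC.
  by apply: eq_bigr => i _; rewrite nderivn_map horner_map.
apply: (big_ind (fun q => ('X - a%:P) ^+ e %| q)) => [||i _].
- exact: dvdp0.
- by move=> q r; apply: dvdp_add.
case: (ltnP i e) => [/p0 ->|le_ei]; first by rewrite mul0r dvdp0.
by apply: dvdp_mull; apply: dvdp_exp2l.
Qed.

Lemma sum_ord_mul (V : nmodType) (mu n : nat) (F : nat -> V) :
  \sum_(b < mu * n) F b = \sum_(j < mu) \sum_(m < n) F (j * n + m)%N.
Proof.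
elim: mu => [|mu IH]; first by rewrite !big_ord0.
rewrite big_ord_recr /= -IH mulSnr big_split_ord /=; congr (_ + _).
Qed.

(* The column with index [j * n + l] stands for the monomial X^l w^j, whose
   value on the curve w = X^k is X^(j * k + l). *)
Definition node (k n b : nat) : nat := (b %/ n * k + b %% n)%N.

(** Rows below T are the Hasse derivatives of the monomials at X = 1. Row T + i is the one of order
    i at x = U / V with X^k replaced by 2, multiplied by x^i V^(n-1) to become an integer. *)
Definition row_entry (k n T U V r b : nat) : nat :=
  if (r < T)%N then 'C(node k n b, r)
  else ('C(node k n b, r - T) * (2 ^ (b %/ n) * (U ^ (b %% n) * V ^ (n.-1 - b %% n))))%N.

(** A vanishing combination of the columns is a family of polynomials P j to which [zero_estimate]
    applies. *)
Lemma row_entry_full (k n mu T I U V : nat) :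
  (0 < n <= k)%N -> (0 < V < U)%N -> (mu * n.+1 <= (T + I).+1)%N ->
  row_full (\matrix_(r < T + I, b < mu * n) (row_entry k n T U V r b)%:R : 'M[rat]_(T + I, mu * n)).
Proof.
move=> /andP[n0 nk] /andP[V0 VU] le_mu; set M := \matrix_(_, _) _.
rewrite /row_full -mxrank_tr; apply/inj_row_free => v vM.
have {}vM r : (r < T + I)%N -> \sum_b v 0 b * (row_entry k n T U V r b)%:R = 0.
  move=> lt; have /matrixP/(_ 0 (Ordinal lt)) := vM.
  by rewrite !mxE => h; rewrite -[RHS]h; apply: eq_bigr => b _; rewrite !mxE.
pose v' (b : nat) : rat := if insub b is Some b' then v 0 b' else 0.
have v'E (b : 'I_(mu * n)) : v' b = v 0 b by rewrite /v' valK.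
pose P (j : 'I_mu) := \poly_(m < n) v' (j * n + m)%N.
pose x : rat := U%:R / V%:R.
have Vn0 : V%:R != 0 :> rat by rewrite pnatr_eq0 -lt0n.
have Un0 : U%:R != 0 :> rat by rewrite pnatr_eq0 -lt0n (leq_ltn_trans _ VU).
have x0 : x != 0 by rewrite mulf_neq0 // invr_eq0.
have x1 : x != 1.
  apply/eqP => /(congr1 (fun y => y * V%:R)); rewrite mul1r divfK // => /eqP.
  by rewrite eqr_nat gtn_eqF.
(* The weight g^j turns the value x^(jk) of w^j on the curve into 2^j. *)
pose g : rat := 2 / x ^+ k.
have g0 : g != 0 by rewrite mulf_neq0 // invr_eq0 expf_neq0.
have GE (h : rat) : \sum_(j < mu) h ^+ j *: ('X^(j * k) * P j) =
    \sum_(b < mu * n) (h ^+ (b %/ n) * v 0 b) *: 'X^(node k n b).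
  rewrite [RHS](eq_bigr (fun b : 'I_(mu * n) => (h ^+ (b %/ n) * v' b) *: 'X^(node k n b))); last first.
    by move=> b _; rewrite v'E.
  rewrite (@sum_ord_mul _ mu n (fun b => (h ^+ (b %/ n) * v' b) *: 'X^(node k n b))).
  apply: eq_bigr => j _; rewrite /P poly_def mulr_sumr scaler_sumr.
  apply: eq_bigr => m _; rewrite /node divnMDl // modnMDl divn_small // modn_small // addn0.
  by rewrite -scalerAr -exprD scalerA.
have szP j : (size (P j) <= n)%N by apply: size_poly.
have nd (h y : rat) i : (\sum_(b < mu * n) (h ^+ (b %/ n) * v 0 b) *: 'X^(node k n b))^`N(i).[y] =
    \sum_(b < mu * n) (h ^+ (b %/ n) * v 0 b) * (y ^+ (node k n b - i) *+ 'C(node k n b, i)).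
  have -> : (\sum_(b < mu * n) (h ^+ (b %/ n) * v 0 b) *: 'X^(node k n b))^`N(i) =
     \sum_(b < mu * n) (h ^+ (b %/ n) * v 0 b) *: (('X^(node k n b))^`N(i)).
    elim/big_rec2: _ => [|b p q _ <-]; first by rewrite -(polyC0) nderivnC; case: ifP => _; rewrite ?polyC0.
    by rewrite nderivnD nderivnZ.
  rewrite horner_sum; apply: eq_bigr => b _.
  by rewrite hornerZ nderivnXn hornerMn hornerXn.
have D1 : ('X - 1%:P) ^+ T %| \sum_(j < mu) 1 *: ('X^(j * k) * P j).
  rewrite (eq_bigr (fun j : 'I_mu => 1 ^+ j *: ('X^(j * k) * P j))); last first.
    by move=> j _; rewrite expr1n.
  rewrite GE; apply: dvdp_nderivn => i ltiT; rewrite nd.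
  rewrite -[RHS](vM i (ltn_addr _ ltiT)); apply: eq_bigr => b _.
  by rewrite /row_entry ltiT !expr1n mul1r.
have Dx : ('X - x%:P) ^+ I %| \sum_(j < mu) g ^+ j *: ('X^(j * k) * P j).
  rewrite GE; apply: dvdp_nderivn => i ltiI; rewrite nd.
  have c0 : x ^+ i * V%:R ^+ n.-1 != 0 by rewrite mulf_neq0 ?expf_neq0.
  apply: (mulIf c0); rewrite mul0r.
  have ltTi : (T + i < T + I)%N by rewrite ltn_add2l.
  rewrite -[RHS](vM _ ltTi) mulr_suml; apply: eq_bigr => b _.
  rewrite /row_entry ltnNge leq_addr /= addKn natrM.
  case: (leqP i (node k n b)) => [le_i|lt_i]; last by rewrite bin_small // mulr0n !(mulr0, mul0r).
  rewrite -mulrA -[_ *+ 'C(_,_)]mulr_natr -!mulrA.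
  have -> : x ^+ (node k n b - i) * ('C(node k n b, i)%:R * (x ^+ i * V%:R ^+ n.-1)) =
     'C(node k n b, i)%:R * (x ^+ node k n b * V%:R ^+ n.-1).
    have e : x ^+ node k n b = x ^+ (node k n b - i) * x ^+ i by rewrite -exprD subnK.
    by rewrite e; ring.
  have lt_bn : (b %% n <= n.-1)%N by rewrite -ltnS prednK // ltn_mod.
  rewrite {2}/node exprD -{1}(subnK lt_bn) exprD !natrM !natrX.
  rewrite /g /x exprMn_comm; last exact: mulrC.
  have -> : (U%:R / V%:R : rat) ^+ (b %/ n * k) = ((U%:R / V%:R) ^+ k) ^+ (b %/ n).
    by rewrite -exprM mulnC.
  have -> : (U%:R / V%:R : rat) ^+ (b %% n) = U%:R ^+ (b %% n) / V%:R ^+ (b %% n).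
    by rewrite exprMn exprVn.
  have y0 : ((U%:R / V%:R) ^+ k : rat) ^+ (b %/ n) != 0 by rewrite !expf_neq0.
  have z0 : (V%:R : rat) ^+ (b %% n) != 0 by rewrite expf_neq0.
  rewrite exprVn; move: y0 z0.
  set y := (_ ^+ k) ^+ _; set z := V%:R ^+ (b %% n) => y0 z0.
  by field; rewrite y0 z0.
have P0 := zero_estimate (introT andP (conj n0 nk)) x0 x1 g0 le_mu szP D1 Dx.
apply/rowP => b; rewrite mxE -v'E.
have lt_j : (b %/ n < mu)%N by rewrite ltn_divLR.
have := congr1 (fun p : {poly rat} => p`_(b %% n)) (P0 (Ordinal lt_j)).
by rewrite coef_poly ltn_mod n0 coef0 /= -divn_eq.
Qed.

Lemma det_natmx_ge1 (n : nat) (A : 'I_n -> 'I_n -> nat) :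
  \det (\matrix_(i, j) (A i j)%:R : 'M[rat]_n) != 0 ->
  1 <= `|\det (\matrix_(i, j) (A i j)%:R : 'M[rat]_n)|.
Proof.
have -> : \matrix_(i, j) (A i j)%:R = map_mx intr (\matrix_(i, j) (A i j)%:Z) :> 'M[rat]_n.
  by apply/matrixP => i j; rewrite !mxE.
rewrite det_map_mx intr_eq0 => det0.
by rewrite -intr_norm -[1]/(1%:~R) ler_int -gtz0_ge1 normr_gt0.
Qed.

(** Nothing is known about which rows are selected, so the upper bounds have to hold for every
    injective [f]. *)
Lemma nonsingular_rows (k n mu T I U V : nat) :
  (0 < n <= k)%N -> (0 < V < U)%N -> (mu * n.+1 <= (T + I).+1)%N ->
  exists2 f : 'I_(mu * n) -> 'I_(T + I), injective f &
    1 <= `|\det (\matrix_(r, b) (row_entry k n T U V (f r) b)%:R : 'M[rat]_(mu * n))|.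
Proof.
move=> nk VU le_mu; have full := row_entry_full nk VU le_mu.
exists (fullrankfun full); first exact: fullrankfun_inj.
apply: (@det_natmx_ge1 _ (fun r b => row_entry k n T U V (fullrankfun full r) b)).
have := fullrowsub_unit full; rewrite unitmxE unitfE.
by congr (\det _ != 0); apply/matrixP => r b; rewrite !mxE.
Qed.

(** * Divided differences on the natural numbers *)

Section DividedDifferences.
Variable F : realFieldType.
Implicit Types (f : nat -> F) (A B : seq nat).

Definition node_weight A (q : nat) : F := \prod_(c <- A | c != q) (q%:R - c%:R).

(** Lagrange's form of the divided difference of [f] on distinct nodes. *)
Definition div_diff f A : F := \sum_(q <- A) f q / node_weight A q.

Fixpoint fwd_diff (b : nat) f (m : nat) : F :=
  if b is b'.+1 then fwd_diff b' f m.+1 - fwd_diff b' f m else f m.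

Lemma node_weight_neq0 A q : node_weight A q != 0.
Proof.
rewrite /node_weight; elim: A => [|c A IH]; first by rewrite big_nil oner_neq0.
rewrite big_cons; case: ifP => // ne; rewrite mulf_neq0 // subr_eq0 eqr_nat.
by rewrite eq_sym ne.
Qed.

Lemma div_diff_perm f A B : perm_eq A B -> div_diff f A = div_diff f B.
Proof.
move=> eqAB; rewrite /div_diff (perm_big _ eqAB) /=; apply: eq_bigr => q _.
by rewrite /node_weight (perm_big _ eqAB).
Qed.

Lemma div_diff_cons f A y : y \notin A ->
  div_diff f A = \sum_(q <- y :: A) f q * (q%:R - y%:R) / node_weight (y :: A) q.
Proof.
move=> yA; rewrite big_cons subrr mulr0 mul0r add0r.
apply: eq_big_seq => q qA.
have ne : y != q by apply: contraNneq yA => ->.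
have ne' : (q%:R - y%:R : F) != 0 by rewrite subr_eq0 eqr_nat eq_sym.
rewrite /node_weight big_cons ne; rewrite -/(node_weight A q).
by have := node_weight_neq0 A q => w0; field; rewrite w0 ne'.
Qed.

Lemma div_diff_rec f B p q : uniq [:: p, q & B] ->
  (q%:R - p%:R) * div_diff f [:: p, q & B] =
  div_diff f (q :: B) - div_diff f (p :: B).
Proof.
rewrite /= inE negb_or -andbA => /and4P[pq pB qB uB].
rewrite (@div_diff_cons f (q :: B) p); last by rewrite inE negb_or pq.
rewrite (@div_diff_cons f (p :: B) q); last by rewrite inE negb_or eq_sym pq.
have eqS : perm_eq [:: q, p & B] [:: p, q & B] by rewrite -(cat1s p) -(cat1s q) perm_catCA.
rewrite (perm_big _ eqS) /= -sumrB mulr_sumr; apply: eq_bigr => x _.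
have -> : node_weight [:: q, p & B] x = node_weight [:: p, q & B] x.
  by rewrite /node_weight (perm_big _ eqS).
by have := node_weight_neq0 [:: p, q & B] x => w0; field.
Qed.

(** The recursion applied to all three pairs of nodes. Since t - p and q - t add up to q - p, this
    is a convex combination when t lies between p and q. *)
Lemma div_diff_insert f B p q t : uniq [:: t, p, q & B] ->
  (q%:R - p%:R) * div_diff f [:: p, q & B] =
  (t%:R - p%:R) * div_diff f [:: t, p & B] + (q%:R - t%:R) * div_diff f [:: t, q & B].
Proof.
move=> u; have /= := u; rewrite !inE !negb_or => /and4P[/and3P[tp tq tB] /andP[pq pB] qB uB].
have e1 := @div_diff_rec f B p q; have e2 := @div_diff_rec f B t p.
have e3 := @div_diff_rec f B t q; move: e1 e2 e3.
rewrite /= !inE !negb_or tp tq tB pq pB qB uB /= => -> // e2 e3.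
by rewrite e3 // -[t%:R - p%:R]opprB mulNr e2 //; ring.
Qed.

Lemma div_diff_iota f (b m : nat) :
  b`!%:R * div_diff f (iota m b.+1) = fwd_diff b f m.
Proof.
elim: b m => [|b IH] m.
  by rewrite /= /div_diff big_seq1 /node_weight big_cons big_nil eqxx divr1 mul1r.
have e1 : iota m b.+2 = rcons (iota m b.+1) (m + b.+1)%N by rewrite -cats1 -[b.+2]addn1 iotaD.
have pe : perm_eq (iota m b.+2) [:: m, (m + b.+1)%N & iota m.+1 b].
  by rewrite e1 /= perm_cons perm_rcons.
rewrite (div_diff_perm f pe) factS natrM mulrAC.
have -> : (b.+1)%:R = (m + b.+1)%:R - m%:R :> F by rewrite natrD addrC addKr.
rewrite mulrC div_diff_rec; last by rewrite -(perm_uniq pe) iota_uniq.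
rewrite mulrBr /= -IH -IH; congr (_ - _).
congr (_ * _); apply: div_diff_perm.
rewrite -[X in perm_eq _ X](@cats0 _) -[iota m.+1 b.+1]/(iota m.+1 b.+1).
have -> : iota m.+1 b.+1 = rcons (iota m.+1 b) (m + b.+1)%N.
  by rewrite -cats1 -[b.+1]addn1 iotaD addSn -addnS addn1.
by rewrite cats0 perm_sym perm_rcons.
Qed.

(* Discrete mean value theorem: inserting a node between the extreme ones writes
   a divided difference as a convex combination of divided differences with a
   smaller span, and those on consecutive nodes are forward differences. *)
Lemma div_diff_bound f (K : F) (b w m : nat) A :
  uniq A -> size A = b.+1 -> (forall q, q \in A -> (m <= q <= m + w)%N) ->
  (forall s, (m <= s)%N -> (s + b <= m + w)%N -> `|fwd_diff b f s| <= K) ->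
  b`!%:R * `|div_diff f A| <= K.
Proof.
elim: w m A => [|w IH] m A uA szA inA bnd.
  have pe : perm_eq A (iota m b.+1).
    have b0 : b = 0%N.
      have : (size A <= size [:: m])%N.
        by apply: uniq_leq_size => // q /inA; rewrite addn0 inE -eqn_leq eq_sym.
      by rewrite szA; case: (b).
    rewrite b0 /=; apply: uniq_perm => // q; apply/idP/idP.
      by move/inA; rewrite addn0 inE -eqn_leq eq_sym.
    rewrite inE => /eqP ->; case: (A) szA inA => // a A' _ /(_ a).
    by rewrite mem_head addn0 -eqn_leq => /(_ isT)/eqP ->; rewrite mem_head.
  rewrite (div_diff_perm _ pe) -[X in X * _]ger0_norm ?ler0n // -normrM div_diff_iota.
  apply: bnd => //; have : (size A <= size [:: m])%N.
    by apply: uniq_leq_size => // q /inA; rewrite addn0 inE -eqn_leq eq_sym.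
  by rewrite szA; case: (b) => // _; rewrite !addn0.
case: (boolP (m \in A)) => [mA|mA]; last first.
  apply: (IH m.+1) => // [q qA|s les leb].
    have /andP[le1 le2] := inA q qA; rewrite addSnnS le2 andbT ltn_neqAle le1 andbT.
    by apply: contraNneq mA => ->.
  by apply: bnd; [apply: ltnW | rewrite -addSnnS].
case: (boolP ((m + w.+1)%N \in A)) => [MA|MA]; last first.
  apply: (IH m) => // [q qA|s les leb].
    have /andP[le1 le2] := inA q qA; rewrite le1 /= -ltnS -addnS ltn_neqAle le2 andbT.
    by apply: contraNneq MA => <-.
  by apply: bnd => //; rewrite addnS ltnW.
have neq : m != (m + w.+1)%N by rewrite -{1}[m]addn0 eqn_add2l.
pose B := rem (m + w.+1)%N (rem m A).
have MA' : (m + w.+1)%N \in rem m A by rewrite mem_rem_uniq // inE eq_sym neq.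
have pe : perm_eq A [:: m, (m + w.+1)%N & B].
  by rewrite (perm_trans (perm_to_rem mA)) // perm_cons perm_to_rem.
have uB : uniq [:: m, (m + w.+1)%N & B] by rewrite -(perm_uniq pe).
case: (boolP (all [in A] (iota m w.+2))) => [allA|].
  have pe' : perm_eq (iota m w.+2) A.
    apply: uniq_perm => //; first exact: iota_uniq.
    move=> q; apply/idP/idP => [|/inA]; first by move/allP: allA; apply.
    by rewrite mem_iota; lia.
  have ew : w.+1 = b by have := perm_size pe'; rewrite size_iota szA => -[].
  rewrite -(div_diff_perm _ pe') ew.
  rewrite -[X in X * _]ger0_norm ?ler0n // -normrM div_diff_iota.
  by apply: bnd => //; rewrite ew.
rewrite -has_predC => /hasP[t]; rewrite mem_iota /= => /andP[mt tM] tA.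
have tm : t != m by apply: contraNneq tA => ->.
have tM' : t != (m + w.+1)%N by apply: contraNneq tA => ->.
have lmt : (m < t)%N by rewrite ltn_neqAle eq_sym tm.
have ltM : (t < m + w.+1)%N by rewrite ltn_neqAle tM' -ltnS -addnS.
have tB : t \notin [:: m, (m + w.+1)%N & B] by rewrite -(perm_mem pe).
have uT : uniq [:: t, m, (m + w.+1)%N & B] by rewrite cons_uniq tB uB.
have := div_diff_insert f uT; rewrite -(div_diff_perm f pe).
have inB q : q \in B -> (m < q < m + w.+1)%N.
  move=> qB; have qA : q \in A by rewrite (perm_mem pe) !inE qB !orbT.
  have /andP[le1 le2] := inA q qA; move: uB => /= /and3P[].
  rewrite inE negb_or => /andP[_ mB] MB _.
  rewrite !ltn_neqAle le1 le2 !andbT; apply/andP; split.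
    by apply: contraNneq mB => ->.
  by apply: contraNneq MB => <-.
have szB : (size B).+2 = b.+1 by rewrite -szA (perm_size pe).
move: uT => /= /and4P[]; rewrite !inE !negb_or => /and3P[_ _ tB'] /andP[_ mB] MB uB'.
have b1 : b`!%:R * `|div_diff f [:: t, m & B]| <= K.
  apply: (IH m) => [|//|q|s les leb].
  - by rewrite /= inE negb_or tm tB' mB uB'.
  - rewrite !inE => /or3P[/eqP->|/eqP->|/inB /andP[h1 h2]].
    + by rewrite (ltnW lmt) -ltnS -addnS.
    + by rewrite leqnn leq_addr.
    + by rewrite (ltnW h1) -ltnS -addnS.
  - by apply: bnd => //; rewrite addnS ltnW.
have b2 : b`!%:R * `|div_diff f [:: t, (m + w.+1)%N & B]| <= K.
  apply: (IH m.+1) => [|//|q|s les leb].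
  - by rewrite /= inE negb_or tM' tB' MB uB'.
  - rewrite !inE => /or3P[/eqP->|/eqP->|/inB /andP[h1 h2]].
    + by rewrite lmt addSnnS ltnW.
    + by rewrite addSnnS leqnn andbT addnS ltnS leq_addr.
    + by rewrite h1 addSnnS ltnW.
  - by apply: bnd => //; [apply: ltnW | rewrite -addSnnS].
have c1 : (t%:R - m%:R : F) = (t - m)%:R by rewrite natrB // ltnW.
have c2 : ((m + w.+1)%:R - t%:R : F) = (m + w.+1 - t)%:R by rewrite natrB // ltnW.
have c3 : ((m + w.+1)%:R - m%:R : F) = w.+1%:R by rewrite natrD addrC addKr.
rewrite c1 c2 c3 => e.
have c4 : (w.+1%:R : F) = (t - m)%:R + (m + w.+1 - t)%:R by rewrite -natrD addnC addnBA ?subnK ?addKn // ltnW.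
have w0 : (0 : F) < w.+1%:R by rewrite ltr0n.
rewrite -(ler_pM2l w0) mulrCA -[X in _ * (X * _)]ger0_norm ?ler0n // -normrM e.
apply: le_trans (_ : b`!%:R * ((t - m)%:R * `|div_diff f [:: t, m & B]| +
   (m + w.+1 - t)%:R * `|div_diff f [:: t, (m + w.+1)%N & B]|) <= _).
  rewrite ler_wpM2l ?ler0n //; apply: le_trans (ler_normD _ _) _.
  by rewrite !normrM !normr_nat.
rewrite c4 mulrDl mulrDr; apply: lerD; rewrite mulrCA; apply: ler_wpM2l; rewrite ?ler0n //.
Qed.

(** Newton's column operations: the divided difference on the first b + 1 nodes combines the columns
    up to b, so the change of columns is triangular, and the inverses of its diagonal entries
    multiply to the Vandermonde product. *)
Lemma det_div_diff (N : nat) (s : nat -> nat) (f : 'I_N -> nat -> F) :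
  {in gtn N &, injective s} ->
  \det (\matrix_(r < N, b < N) f r (s b)) =
  \det (\matrix_(r < N, b < N) div_diff (f r) [seq s c | c <- iota 0 b.+1]) *
  \prod_(b < N) \prod_(c < b) ((s b)%:R - (s c)%:R).
Proof.
move=> injs.
pose L : 'M[F]_N := \matrix_(c, b) if (c <= b)%N
   then (node_weight [seq s c | c <- iota 0 b.+1] (s c))^-1 else 0.
have -> : \matrix_(r < N, b < N) div_diff (f r) [seq s c | c <- iota 0 b.+1] =
    (\matrix_(r < N, b < N) f r (s b)) *m L.
  apply/matrixP => r b; rewrite !mxE /div_diff big_map.
  set A := [seq s c | c <- _].
  have -> : iota 0 b.+1 = index_iota 0 b.+1 by rewrite /index_iota subn0.
  rewrite big_mkord.
  under [RHS]eq_bigr => c _ do rewrite !mxE.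
  rewrite (bigID (fun c : 'I_N => (c <= b)%N)) /= [X in _ = _ + X]big1 ?addr0; last first.
    by move=> c /negbTE ->; rewrite mulr0.
  under [RHS]eq_bigr => c h do rewrite h.
  rewrite (big_ord_widen_cond _ xpredT (fun c => f r (s c) / node_weight A (s c)) (ltn_ord b)).
  by apply: eq_big => // c; rewrite ltnS.
rewrite det_mulmx -mulrA.
suff -> : \det L * \prod_(b < N) \prod_(c < b) ((s b)%:R - (s c)%:R) = 1 by rewrite mulr1.
rewrite -det_tr det_trig; last first.
  by apply/is_trig_mxP => i j lt; rewrite !mxE leqNgt lt.
rewrite -big_split /= big1 // => b _; rewrite !mxE leqnn.
have -> : node_weight [seq s c | c <- iota 0 b.+1] (s b) = \prod_(c < b) ((s b)%:R - (s c)%:R).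
  rewrite /node_weight big_map -[iota 0 b.+1]/(iota 0 b.+1).
  have -> : iota 0 b.+1 = index_iota 0 b.+1 by rewrite /index_iota subn0.
  rewrite big_mkord big_mkcond big_ord_recr /= eqxx /= mulr1.
  apply: eq_bigr => c _; case: eqP => // /injs e.
  have := e (ltn_trans (ltn_ord c) (ltn_ord b)) (ltn_ord b).
  by move=> eb; have := ltn_ord c; rewrite eb ltnn.
rewrite mulVf //; apply/prodf_neq0 => c _; rewrite subr_eq0 eqr_nat.
apply/negP => /eqP /injs e.
have eb := e (ltn_ord b) (ltn_trans (ltn_ord c) (ltn_ord b)).
by have := ltn_ord c; rewrite -eb ltnn.
Qed.

End DividedDifferences.

Lemma ratio_exp_ge0 (K : numFieldType) (a b n : nat) : (0 : K) <= (a%:R / b%:R) ^+ n.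
Proof. by rewrite exprn_ge0 // divr_ge0. Qed.

Lemma ratio_exp_le (K : numFieldType) (a b m n : nat) :
  (0 < b <= a)%N -> (m <= n)%N -> (a%:R / b%:R) ^+ m <= (a%:R / b%:R) ^+ n :> K.
Proof. by move=> /andP[b0 ab] mn; rewrite ler_weXn2l // ler_pdivlMr ?ltr0n // mul1r ler_nat. Qed.

Lemma natr_exp_le (K : numFieldType) (a m n : nat) :
  (m <= n)%N -> a.+1%:R ^+ m <= a.+1%:R ^+ n :> K.
Proof. by move=> mn; rewrite ler_weXn2l // ler1n. Qed.

Lemma ratio_exp_ge1 (K : numFieldType) (a b n : nat) : (0 < b <= a)%N -> (1 : K) <= (a%:R / b%:R) ^+ n.
Proof. by move=> ab; rewrite -[1](expr0 (a%:R / b%:R)); apply: ratio_exp_le. Qed.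

Lemma natr_exp_ge1 (K : numFieldType) (a n : nat) : (1 : K) <= a.+1%:R ^+ n.
Proof. by rewrite exprn_ege1 // ler1n. Qed.

(** * Forward differences of the entries *)

Section EntryBounds.
Variable F : realFieldType.
Implicit Types (f g : nat -> F) (z x : F).

Lemma fwd_diff_shift f b m :
  fwd_diff b.+1 f m = fwd_diff b (fun s => f s.+1 - f s) m.
Proof. by elim: b m => //= b IH m; rewrite -IH -IH. Qed.

Lemma fwd_diff_lin a c f g h b m : (forall s, f s = a * g s + c * h s) ->
  fwd_diff b f m = a * fwd_diff b g m + c * fwd_diff b h m.
Proof.
by move=> e; elim: b m => //= b IH m; rewrite !IH !mulrBr opprD addrACA.
Qed.

Lemma eq_fwd_diff f g b m : f =1 g -> fwd_diff b f m = fwd_diff b g m.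
Proof. by move=> e; elim: b m => //= b IH m; rewrite !IH. Qed.

Lemma fwd_diff_le f K b m w : (forall s, (m <= s <= m + w)%N -> `|f s| <= K) ->
  (b <= w)%N -> `|fwd_diff b f m| <= 2 ^+ b * K.
Proof.
elim: b m w => [|b IH] m w bnd lebw; first by rewrite mul1r bnd // leqnn leq_addr.
case: w bnd lebw => // w bnd lebw /=.
apply: le_trans (ler_normB _ _) _.
have h1 : `|fwd_diff b f m.+1| <= 2 ^+ b * K.
  by apply: (IH _ w) => // s hs; apply: bnd; lia.
have h2 : `|fwd_diff b f m| <= 2 ^+ b * K.
  by apply: (IH _ w) => // s hs; apply: bnd; lia.
by rewrite exprS -mulrA mulr2n mulrDl mul1r lerD.
Qed.

Lemma bin_mul_le z s i : 0 <= z -> 'C(s, i)%:R * z ^+ i <= (1 + z) ^+ s.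
Proof.
move=> z0; case: (leqP i s) => [le_is|lt_si]; last first.
  by rewrite bin_small // mul0r exprn_ge0 // addr_ge0.
rewrite exprDn (bigD1 (Ordinal (le_is : (i < s.+1)%N))) //= expr1n mul1r mulr_natl lerDl.
by apply: sumr_ge0 => j _; rewrite expr1n mul1r mulrn_wge0 // exprn_ge0.
Qed.

(** The b-th difference of C(s, t) is C(s, t - b), and one term of the binomial expansion of (1 +
    z)^s bounds it. Every difference thus gains a factor z. *)
Lemma fwd_diff_bin_bound z t b s : 0 < z ->
  0 <= fwd_diff b (fun s => 'C(s, t)%:R : F) s <= (1 + z) ^+ s * (z ^+ b / z ^+ t).
Proof.
move=> z0; have zn0 m : z ^+ m != 0 by rewrite expf_neq0 // gt_eqF.
elim: b t => [|b IH] t.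
  rewrite /= ler0n /= expr0 mul1r ler_pdivlMr ?exprn_gt0 //.
  exact/bin_mul_le/ltW.
rewrite fwd_diff_shift; case: t => [|t].
  rewrite (@fwd_diff_lin 0 0 _ (fun=> 0) (fun=> 0)); last first.
    by move=> u; rewrite !bin0 subrr !mul0r addr0.
  rewrite !mul0r addr0 lexx /=; apply: mulr_ge0; first by rewrite exprn_ge0 // addr_ge0 // ltW.
  by rewrite divr_ge0 // exprn_ge0 // ltW.
rewrite (@eq_fwd_diff _ (fun s => 'C(s, t)%:R)); last first.
  by move=> u; rewrite binS natrD addrC addKr.
have /andP[-> h] := IH t; apply: le_trans h _.
by rewrite !exprS invfM mulrACA divff ?mul1r // gt_eqF.
Qed.

(** With x = 1 + z, differencing C(s, i + 1) x^s gives z C(s, i + 1) x^s + x C(s, i) x^s. The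
    constants 5/4 and 4 are those for which the induction closes with equality: the two bounds are
    in the ratio 4 : 1, and 4 + 1 is 4 times 5/4. *)
Lemma fwd_diff_binexp_bound z i b s : 0 < z ->
  0 <= fwd_diff b (fun s => 'C(s, i)%:R * (1 + z) ^+ s : F) s
    <= (5 / 4) ^+ b * 4 ^+ i * (1 + z) ^+ (i + 2 * s) * (z ^+ b / z ^+ i).
Proof.
move=> z0; set x := 1 + z.
have x0 : 0 < x by rewrite addr_gt0.
have x1 : 1 <= x by rewrite lerDl ltW.
elim: b i s => [|b IH] i s /=.
  rewrite mulr_ge0 ?ler0n ?exprn_ge0 ?(ltW x0) //= !expr0 !mul1r.
  rewrite ler_pdivlMr ?exprn_gt0 // mulrAC.
  have -> : x ^+ (i + 2 * s) = x ^+ i * (x ^+ s * x ^+ s).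
    by rewrite exprD mul2n -addnn exprD.
  have h1 := bin_mul_le s i (ltW z0).
  have h2 : 1 <= 4 ^+ i * x ^+ i by rewrite -exprMn exprn_ege1 // mulr_ege1 // ler1n.
  rewrite [4 ^+ i * _]mulrA; apply: le_trans (_ : x ^+ s * x ^+ s <= _).
    by rewrite ler_wpM2r // exprn_ge0 // ltW.
  by rewrite ler_peMl // mulr_ge0 // exprn_ge0 // ltW.
rewrite -/(fwd_diff b.+1 _ s) fwd_diff_shift.
have zx : z = x - 1 by rewrite /x addrC addKr.
case: i => [|i].
  rewrite (@fwd_diff_lin z 0 _ (fun s => 'C(s, 0)%:R * x ^+ s) (fun=> 0)); last first.
    by move=> u; rewrite !bin0 !mul1r mul0r addr0 exprS zx mulrBl mul1r.
  rewrite mul0r addr0; have /andP[h1 h2] := IH 0%N s.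
  rewrite mulr_ge0 ?(ltW z0) //=.
  have -> : (5 / 4 : F) ^+ b.+1 * 4 ^+ 0 * x ^+ (0 + 2 * s) * (z ^+ b.+1 / z ^+ 0) =
    5 / 4 * (z * ((5 / 4) ^+ b * 4 ^+ 0 * x ^+ (0 + 2 * s) * (z ^+ b / z ^+ 0))).
    by rewrite !exprS !expr0; ring.
  have h3 := le_trans h1 h2.
  have h4 := ler_wpM2l (ltW z0) h2; have h5 := mulr_ge0 (ltW z0) h1.
  by move: h4 h5; set y := z * _; set y' := z * _; lra.
rewrite (@fwd_diff_lin z x _ (fun s => 'C(s, i.+1)%:R * x ^+ s)
    (fun s => 'C(s, i)%:R * x ^+ s)); last first.
  by move=> u; rewrite binS natrD exprS zx; ring.
have /andP[h1 h2] := IH i.+1 s; have /andP[h3 h4] := IH i s.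
rewrite addr_ge0 ?mulr_ge0 ?(ltW z0) ?(ltW x0) //=.
have zn0 : z != 0 by rewrite gt_eqF.
have zi0 : z ^+ i != 0 by rewrite expf_neq0.
apply: le_trans (lerD (ler_wpM2l (ltW z0) h2) (ler_wpM2l (ltW x0) h4)) _.
rewrite le_eqVlt; apply/orP; left; apply/eqP.
rewrite !addSn !exprS.
by field; rewrite zi0 zn0.
Qed.

End EntryBounds.

Lemma dist_expr_le (F : realFieldType) (y a b : F) (j : nat) :
  0 <= a <= y -> 0 <= b <= y -> 1 <= y -> `|a ^+ j - b ^+ j| <= j%:R * y ^+ j * `|a - b|.
Proof.
move=> /andP[a0 ay] /andP[b0 bY] y1; rewrite subrXX normrM mulrC ler_wpM2r //.
apply: le_trans (ler_norm_sum _ _ _) _.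
rewrite -[X in X%:R]card_ord mulr_natl -sumr_const; apply: ler_sum => i _.
have y0 : 0 <= y by apply: le_trans y1.
rewrite normrM !normrX !ger0_norm //.
apply: le_trans (ler_pM _ _ (lerXn2r _ a0 y0 ay) (lerXn2r _ b0 y0 bY)) _; rewrite ?exprn_ge0 //.
rewrite -exprD subnK ?ler_weXn2l ?leq_pred //.
by case: j i => [[]//|j i]; rewrite -ltnS ltn_ord.
Qed.

(** * Size of the rows *)

Section RowBounds.
Variables (k n mu T I U V : nat).
Hypotheses (n_gt0 : (0 < n)%N) (n_le_k : (n <= k)%N) (V_gt0 : (0 < V)%N) (V_lt_U : (V < U)%N).
Hypothesis I_le : (I <= mu * k)%N.
Hypothesis z_le : (k * (U - V) <= V)%N.
Hypothesis x_le : (U ^ k <= 3 * V ^ k)%N.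
Hypothesis close : (mu * 3 ^ mu * ((2 * V ^ k - U ^ k) + (U ^ k - 2 * V ^ k)) * (8 * V) ^ (mu * n) <=
  V ^ k * (5 * (U - V)) ^ (mu * n))%N.

Local Notation N := (mu * n)%N.
Local Notation M := (mu * k)%N.
Let x : rat := U%:R / V%:R.
Let z : rat := x - 1.

(** Extends a row from the nodes to all s = jk + l, because a divided difference on the nodes is
    bounded through forward differences at all points in between. *)
Definition row_fun (r s : nat) : rat :=
  if (r < T)%N then 'C(s, r)%:R
  else V%:R ^+ n.-1 * ('C(s, r - T)%:R * (2 ^+ (s %/ k) * x ^+ (s %% k))).

Definition row_order (r : nat) : nat := if (r < T)%N then r else (r - T)%N.

Definition row_scale (r : nat) : rat :=
  if (r < T)%N then 1 else V%:R ^+ n.-1 * ((5 / 4) ^+ N * 4 ^+ (r - T)).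

Let Vr0 : (0 : rat) < V%:R. Proof. by rewrite ltr0n. Qed.
Let k_gt0 : (0 < k)%N. Proof. exact: leq_trans n_le_k. Qed.

Lemma z_gt0 : 0 < z.
Proof. by rewrite subr_gt0 /x ltr_pdivlMr // mul1r ltr_nat. Qed.

Lemma zE : z = (U - V)%:R / V%:R.
Proof. by rewrite /z /x natrB 1?ltnW // mulrBl divff // gt_eqF. Qed.

Lemma z_le_invk : z <= k%:R^-1.
Proof.
by rewrite zE ler_pdivrMr // ler_pdivlMl ?ltr0n // -natrM ler_nat.
Qed.

Lemma z_le1 : z <= 1.
Proof. by apply: le_trans z_le_invk _; rewrite invf_le1 ?ltr0n // ler1n. Qed.

Lemma xE : x = 1 + z. Proof. by rewrite /z addrC subrK. Qed.
Lemma x_ge1 : 1 <= x. Proof. by rewrite xE lerDl ltW ?z_gt0. Qed.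
Let x_gt0 : 0 < x. Proof. exact: lt_le_trans ltr01 x_ge1. Qed.

Lemma xk_le3 : x ^+ k <= 3.
Proof.
by rewrite exprMn exprVn ler_pdivrMr ?exprn_gt0 // -!natrX -natrM ler_nat.
Qed.

Lemma xM_le (a s : nat) : (s <= a * M)%N -> x ^+ s <= (3 ^+ a) ^+ mu.
Proof.
move=> le_s; apply: le_trans (_ : x ^+ (a * M) <= _); first by rewrite ler_weXn2l ?x_ge1.
have -> : (a * M = k * (a * mu))%N by lia.
by rewrite -exprM exprM lerXn2r ?nnegrE ?exprn_ge0 ?(ltW x_gt0) ?xk_le3.
Qed.

Lemma dist_xk : `|2 - x ^+ k| =
  ((2 * V ^ k - U ^ k) + (U ^ k - 2 * V ^ k))%:R / V%:R ^+ k.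
Proof.
have Vk0 : (0 : rat) < V%:R ^+ k by rewrite exprn_gt0.
have -> : 2 - x ^+ k = (2 * V%:R ^+ k - U%:R ^+ k) / V%:R ^+ k.
  by rewrite /x exprMn exprVn mulrBl mulfK // gt_eqF.
rewrite normrM [X in _ * X]gtr0_norm ?invr_gt0 //; congr (_ / _).
rewrite -!natrX -natrM; case: (leqP (2 * V ^ k) (U ^ k)) => h.
  rewrite distrC -natrB // normr_nat; congr (_%:R).
  by rewrite (eqP h) add0n.
by rewrite -natrB 1?ltnW // normr_nat; congr (_%:R); rewrite (eqP (ltnW h)) addn0.
Qed.

Lemma closeR : mu%:R * 3 ^+ mu * `|2 - x ^+ k| <= (5 / 8) ^+ N * z ^+ N.
Proof.
rewrite dist_xk zE !exprMn !exprVn.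
have V8 : (0 : rat) < (8 * V%:R) ^+ N by rewrite exprn_gt0 // mulr_gt0 ?ltr0n.
have Vk0 : (0 : rat) < V%:R ^+ k by rewrite exprn_gt0.
rewrite mulrA ler_pdivrMr //.
have -> : 5 ^+ N / 8 ^+ N * ((U - V)%:R ^+ N / V%:R ^+ N) * V%:R ^+ k =
   V%:R ^+ k * (5 * (U - V)%:R) ^+ N / (8 * V%:R) ^+ N :> rat.
  by rewrite !exprMn invfM; ring.
by rewrite ler_pdivlMr // -!natrX -!natrM -natrX -!natrM -!natrX -!natrM ler_nat.
Qed.

(** From row T on, 2^(s / k) x^(s mod k) is x^s plus an error. The differences of the first part
    decay with z; those of the error are bounded crudely by 2^b times its maximum, and the constant
    5/8 in [closeR] makes this (2 * 5/8)^N = (5/4)^N, matching the first part. The factor 27^mu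
    bounds x^(i + 2s), whose exponent is at most 3 mu k. *)
Lemma row_fun_bound (r b s : nat) : (r < T + I)%N -> (b <= N)%N -> (s + b <= M)%N ->
  `|fwd_diff b (row_fun r) s| <=
  (2 * 27 ^+ mu) * row_scale r * (z ^+ b / z ^+ row_order r).
Proof.
move=> lt_r le_b le_s; have z0 := z_gt0.
have zr0 m : 0 <= z ^+ m by rewrite exprn_ge0 // ltW.
have x0 m : 0 <= x ^+ m by rewrite exprn_ge0 // ltW.
have zq0 : 0 <= z ^+ b / z ^+ row_order r by rewrite divr_ge0.
have le_27 a : (a <= 3)%N -> (3 ^+ a) ^+ mu <= 27 ^+ mu :> rat.
  move=> le_a; have -> : 27 = 3 ^+ 3 :> rat by [].
  by rewrite lerXn2r ?nnegrE ?exprn_ge0 // ler_weXn2l // ler1n.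
have g27 : (0 : rat) <= 27 ^+ mu by rewrite exprn_ge0.
have le_2y (y : rat) : 0 <= y -> y <= 2 * y by move=> y0; lra.
rewrite /row_scale /row_order in zq0 *; case: (ltnP r T) lt_r zq0 => [ltr|ler] lt_r zq0.
  rewrite (@eq_fwd_diff _ _ (fun s => 'C(s, r)%:R)); last by move=> u; rewrite /row_fun ltr.
  have /andP[h1 h2] := fwd_diff_bin_bound r b s z0.
  rewrite ger0_norm //; apply: le_trans h2 _; rewrite mulr1 ler_wpM2r //.
  rewrite -xE; apply: le_trans (le_2y _ g27); apply: le_trans (le_27 1%N isT).
  by apply: xM_le; rewrite mul1n (leq_trans _ le_s) // leq_addr.
set i := (r - T)%N in zq0 *.
have lt_i : (i < I)%N by rewrite /i ltn_subLR.
pose f s := 'C(s, i)%:R * x ^+ s.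
pose e s : rat := 'C(s, i)%:R * x ^+ (s %% k) * (2 ^+ (s %/ k) - (x ^+ k) ^+ (s %/ k)).
rewrite (@fwd_diff_lin _ (V%:R ^+ n.-1) (V%:R ^+ n.-1) _ f e); last first.
  move=> u; have e0 : x ^+ u = (x ^+ k) ^+ (u %/ k) * x ^+ (u %% k).
    by rewrite -exprM -exprD mulnC -divn_eq.
  by rewrite /row_fun ltnNge ler /= -/i /f /e e0; ring.
have Vn0 : (0 : rat) <= V%:R ^+ n.-1 by rewrite exprn_ge0 // ltW.
have g54 m : (0 : rat) <= (5 / 4) ^+ m by exact: ratio_exp_ge0.
have g4 m : (0 : rat) <= 4 ^+ m by rewrite exprn_ge0.
have le54 : (5 / 4) ^+ b <= (5 / 4) ^+ N :> rat by exact: ratio_exp_le.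
pose D := (5 / 4) ^+ N * 4 ^+ i * 27 ^+ mu * (z ^+ b / z ^+ i) : rat.
have hf : `|fwd_diff b f s| <= D.
  have /andP[h1 h2] := fwd_diff_binexp_bound i b s z0.
  have ef : fwd_diff b f s = fwd_diff b (fun s => 'C(s, i)%:R * (1 + z) ^+ s : rat) s.
    by apply: eq_fwd_diff => u; rewrite /f -xE.
  rewrite ef ger0_norm //; apply: le_trans h2 _; rewrite -xE ler_wpM2r //.
  apply: ler_pM; rewrite ?mulr_ge0 //; first by rewrite ler_wpM2r.
  apply: le_trans (le_27 3 isT); apply: xM_le.
  have : (s <= M)%N by apply: leq_trans le_s; rewrite leq_addr.
  by move: (leq_trans (ltnW lt_i) I_le); lia.
have he : `|fwd_diff b e s| <= D.
  apply: le_trans (@fwd_diff_le _ e (x ^+ (2 * M) / z ^+ i * ((5 / 8) ^+ N * z ^+ N)) b s b _ _) _ => //.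
    move=> u /andP[_ le_u]; have leuM : (u <= M)%N by apply: leq_trans le_s.
    rewrite /e !normrM normr_nat [`|x ^+ _|]ger0_norm //.
    apply: ler_pM; rewrite ?mulr_ge0 ?ler0n //.
      rewrite ler_pdivlMr ?exprn_gt0 // mulrAC mul2n -addnn exprD.
      apply: ler_pM; rewrite ?mulr_ge0 ?ler0n //.
        apply: le_trans (bin_mul_le u i (ltW z0)) _.
        by rewrite -xE ler_weXn2l ?x_ge1.
      by rewrite ler_weXn2l ?x_ge1 // (leq_trans (leq_mod _ _)).
    apply: le_trans (closeR); apply: le_trans (@dist_expr_le _ 3 _ _ _ _ _ _) _; rewrite ?x0 ?xk_le3 //.
    rewrite ler_wpM2r // ler_pM ?ler0n ?exprn_ge0 //.
      by rewrite ler_nat -(mulnK mu k_gt0) leq_div2r // mulnC.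
    by rewrite ler_weXn2l // -(mulnK mu k_gt0) leq_div2r // mulnC.
  have e1 : 2 ^+ b * (x ^+ (2 * M) / z ^+ i * ((5 / 8) ^+ N * z ^+ N)) =
      (2 ^+ b * (5 / 8) ^+ N) * x ^+ (2 * M) * (z ^+ N / z ^+ i) by ring.
  have p0 : (0 : rat) <= 2 ^+ b * (5 / 8) ^+ N by exact: mulr_ge0 (exprn_ge0 _ (ler0n _ 2)) (ratio_exp_ge0 _ _ _ _).
  have a1 : 2 ^+ b * (5 / 8) ^+ N <= (5 / 4) ^+ N * 4 ^+ i :> rat.
    apply: le_trans (_ : 2 ^+ N * (5 / 8) ^+ N <= _).
      apply: ler_wpM2r; [exact: ratio_exp_ge0 | exact: (natr_exp_le _ 1 le_b)].
    rewrite -exprMn; have -> : 2 * (5 / 8) = 5 / 4 :> rat by [].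
    by rewrite ler_peMr // exprn_ege1.
  have a2 : x ^+ (2 * M) <= 27 ^+ mu.
    by apply: le_trans (le_27 2%N isT); apply: xM_le.
  have a3 : z ^+ N / z ^+ i <= z ^+ b / z ^+ i.
    by rewrite ler_wpM2r ?invr_ge0 // ler_wiXn2l ?z_le1 ?(ltW z0).
  have p1 := mulr_ge0 p0 (x0 (2 * M)%N).
  have p2 : 0 <= z ^+ N / z ^+ i by rewrite divr_ge0.
  by rewrite e1 /D; apply: (ler_pM p1 p2 _ a3); apply: (ler_pM p0 (x0 _) a1 a2).
apply: le_trans (ler_normD _ _) _; rewrite !normrM ger0_norm //.
apply: le_trans (lerD (ler_wpM2l Vn0 hf) (ler_wpM2l Vn0 he)) _.
by rewrite le_eqVlt; apply/orP; left; apply/eqP; rewrite /D; ring.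
Qed.

End RowBounds.

Lemma node_lt (k n b c : nat) : (0 < n <= k)%N -> (b < c)%N -> (node k n b < node k n c)%N.
Proof.
move=> /andP[n0 nk] lt; rewrite /node.
have le_div : (b %/ n <= c %/ n)%N by apply/leq_div2r/ltnW.
case: (ltngtP (b %/ n) (c %/ n)) le_div => // [lt_div _|e _].
  have h1 := ltn_pmod b n0.
  have h2 : ((b %/ n).+1 * k <= c %/ n * k)%N by rewrite leq_mul2r lt_div orbT.
  by move: h2; rewrite mulSn; lia.
move: lt; rewrite {1}(divn_eq b n) {1}(divn_eq c n) e ltn_add2l.
by rewrite ltn_add2l.
Qed.

Lemma node_divn (k n b : nat) : (0 < n <= k)%N -> (node k n b %/ k = b %/ n)%N.
Proof.
move=> /andP[n0 nk]; have k0 : (0 < k)%N by apply: leq_trans nk.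
have h := leq_trans (ltn_pmod b n0) nk.
by rewrite /node divnMDl ?(divn_small h) ?addn0 // (leq_trans n0).
Qed.

Lemma node_modn (k n b : nat) : (0 < n <= k)%N -> (node k n b %% k = b %% n)%N.
Proof.
move=> /andP[n0 nk]; have h := leq_trans (ltn_pmod b n0) nk.
by rewrite /node modnMDl (modn_small h).
Qed.

Lemma det_le (F : realFieldType) (N : nat) (A : 'M[F]_N) (a : 'I_N -> F) (c : nat -> F) :
  (forall r b : 'I_N, `|A r b| <= a r * c b) ->
  `|\det A| <= N`!%:R * ((\prod_(r < N) a r) * \prod_(b < N) c b).
Proof.
move=> le_A; rewrite /determinant; apply: le_trans (ler_norm_sum _ _ _) _.
rewrite -card_Sn mulr_natl -sumr_const; apply: ler_sum => s _.
rewrite normrM normrX normrN1 expr1n mul1r normr_prod.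
have -> : \prod_(b < N) c b = \prod_(r < N) c (s r).
  by rewrite [LHS](reindex_inj (@perm_inj _ s)).
rewrite -big_split /=; apply: ler_prod => r _.
by rewrite normr_ge0 /=.
Qed.

(** Serves to replace the unknown selection of rows by the product over all T + I rows, each weight
    being at least 1. *)
Lemma ler_prod_inj (F : realFieldType) (I J : finType) (f : I -> J) (w : J -> F) :
  injective f -> (forall j, 1 <= w j) -> \prod_i w (f i) <= \prod_j w j.
Proof.
move=> injf w1; have w0 j : 0 <= w j by apply: le_trans (w1 j).
rewrite [X in _ <= X](bigID (mem (f @: I))) /= big_imset /=; last by move=> i j _ _; apply: injf.
rewrite ler_peMr ?prodr_ge0 //; last first.
  elim/big_rec: _ => // j y _ y1; exact: mulr_ege1.
Qed.

Lemma prodr_exp_bin2 (F : comNzRingType) (z : F) (N : nat) :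
  \prod_(b < N) z ^+ b = z ^+ 'C(N, 2).
Proof. by rewrite -bin2_sum big_mkord -expr_sum. Qed.

(** Confronts 1 <= |det| with the Leibniz bound for the matrix of divided differences. The columns
    contribute z^C(N, 2) and the rows divide it by z^(C(T, 2) + C(I, 2)), so at least E factors z
    remain, each at most 1/k. *)
Lemma interpolation_inequality (k n mu T I E U V : nat) :
  (0 < n <= k)%N -> (0 < V < U)%N -> (mu * n.+1 <= (T + I).+1)%N -> (I <= mu * k)%N ->
  (E + ('C(T, 2) + 'C(I, 2)) <= 'C(mu * n, 2))%N ->
  (k * (U - V) <= V)%N -> (U ^ k <= 3 * V ^ k)%N ->
  (mu * 3 ^ mu * ((2 * V ^ k - U ^ k) + (U ^ k - 2 * V ^ k)) * (8 * V) ^ (mu * n) <=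
    V ^ k * (5 * (U - V)) ^ (mu * n))%N ->
  ((\prod_(b < mu * n) b`!) * k ^ E * 4 ^ (mu * n * I) <=
   (\prod_(b < mu * n) \prod_(c < b) (node k n b - node k n c)) * (mu * n)`! *
   (2 * 27 ^ mu) ^ (mu * n) * V ^ (n.-1 * I) * 5 ^ (mu * n * I) * 4 ^ 'C(I, 2))%N.
Proof.
move=> nk VU le_mu I_le leE z_le x_le close.
have /andP[n0 nk'] := nk; have /andP[V0 VU'] := VU.
have k0 : (0 < k)%N by apply: leq_trans nk'.
set N := (mu * n)%N.
pose x : rat := U%:R / V%:R; pose z := x - 1.
have z0 : 0 < z := z_gt0 V0 VU'.
have z1 : z <= 1 := z_le1 n0 nk' V0 VU' z_le.
have zk : z <= k%:R^-1 := z_le_invk n0 nk' V0 VU' z_le.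
have [f injf det1] := nonsingular_rows nk VU le_mu.
pose rf (r : 'I_N) := row_fun k n T U V (f r).
have V0' : (V%:R : rat) != 0 by rewrite pnatr_eq0 -lt0n.
have entry (r b : 'I_N) : (row_entry k n T U V (f r) b)%:R = rf r (node k n b).
  rewrite /rf /row_entry /row_fun node_divn // node_modn //; case: ifP => // _.
  have le_b : (b %% n <= n.-1)%N by rewrite -ltnS prednK // ltn_pmod.
  rewrite !natrM !natrX -{2}(subnK le_b) exprD exprMn exprVn.
  by field; rewrite expf_neq0.
have injn : {in gtn N &, injective (node k n)}.
  move=> b c _ _ e; case: (ltngtP b c) => // /(node_lt nk); by rewrite e ltnn.
move: det1.
have -> : \matrix_(r, b) (row_entry k n T U V (f r) b)%:R =
    \matrix_(r < N, b < N) rf r (node k n b) :> 'M[rat]_N.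
  by apply/matrixP => r b; rewrite !mxE entry.
rewrite det_div_diff //.
set A : rat := \prod_(b < N) _; set Dm := \matrix_(_, _) _ => det1.
have AE : A = (\prod_(b < N) \prod_(c < b) (node k n b - node k n c))%N%:R.
  rewrite /A natr_prod; apply: eq_bigr => b _; rewrite natr_prod; apply: eq_bigr => c _.
  by rewrite natrB // ltnW // node_lt.
have A0 : 0 <= A by rewrite AE.
pose X : rat := 2 * 27 ^+ mu.
pose w (r : nat) : rat := row_scale n mu T V r / z ^+ row_order T r.
pose a (r : 'I_N) : rat := X * w (f r).
have X1 : 1 <= X by exact: mulr_ege1 (natr_exp_ge1 _ 1 1) (natr_exp_ge1 _ 26 _).
have sc1 r : 1 <= row_scale n mu T V r.
  rewrite /row_scale; case: ifP => // _.
  apply: mulr_ege1; first by rewrite exprn_ege1 // ler1n.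
  exact: mulr_ege1 (@ratio_exp_ge1 _ 5 4 _ isT) (natr_exp_ge1 _ 3 _).
have zr0 m : 0 < z ^+ m by rewrite exprn_gt0.
have zi1 m : 1 <= (z ^+ m)^-1 by rewrite invf_ge1 ?exprn_ile1 // ltW.
pose c (b : nat) : rat := z ^+ b / b`!%:R.
have c0 b : 0 <= c b by rewrite divr_ge0 ?ler0n // ltW.
have dd (r b : 'I_N) : `|Dm r b| <= a r * c b.
  rewrite mxE.
  have bf0 : (0 : rat) < b`!%:R by rewrite ltr0n fact_gt0.
  have -> : a r * c b = (2 * 27 ^+ mu) * row_scale n mu T V (f r) *
      (z ^+ b / z ^+ row_order T (f r)) / b`!%:R by rewrite /a /w /c /X; ring.
  rewrite ler_pdivlMr // mulrC.
  apply: (@div_diff_bound _ _ _ _ (mu * k) 0).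
  - rewrite map_inj_in_uniq ?iota_uniq // => i j; rewrite !mem_iota !add0n => /andP[_ hi] /andP[_ hj].
    by apply: injn; rewrite inE /=; apply: leq_trans (ltn_ord b).
  - by rewrite size_map size_iota.
  - move=> q /mapP[i]; rewrite mem_iota /= add0n => hi ->.
    have lt_j : (i %/ n < mu)%N by rewrite ltn_divLR // (leq_ltn_trans _ (ltn_ord b)).
    have h1 : (i %% n < k)%N := leq_trans (ltn_pmod i n0) nk'.
    have h2 : ((i %/ n).+1 * k <= mu * k)%N by rewrite leq_mul2r lt_j orbT.
    by rewrite /node add0n; move: h2; rewrite mulSn; clear -h1; lia.
  - move=> s _ le_s; apply: (row_fun_bound n0 nk' V0 VU' I_le z_le x_le close) => //.
    by apply: ltnW.
have w1 r : 1 <= w r by rewrite mulr_ege1.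
have W : \prod_(r < N) w (f r) <= (z ^+ 'C(T, 2) * z ^+ 'C(I, 2))^-1 *
    ((V%:R ^+ n.-1 * (5 / 4) ^+ N) ^+ I * 4 ^+ 'C(I, 2)).
  apply: le_trans (@ler_prod_inj _ _ _ f (fun r => w r) injf (fun r => w1 r)) _.
  rewrite big_split_ord /=.
  have -> : \prod_(i < T) w i = (z ^+ 'C(T, 2))^-1.
    rewrite -prodr_exp_bin2 -prodfV; apply: eq_bigr => i _.
    by rewrite /w /row_scale /row_order ltn_ord mul1r.
  have -> : \prod_(i < I) w (T + i)%N =
      (z ^+ 'C(I, 2))^-1 * ((V%:R ^+ n.-1 * (5 / 4) ^+ N) ^+ I * 4 ^+ 'C(I, 2)).
    rewrite -!prodr_exp_bin2 -prodfV -[X in _ ^+ X]card_ord -prodr_const -!big_split /=.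
    apply: eq_bigr => i _; rewrite /w /row_scale /row_order ltnNge leq_addr /= addKn.
    by rewrite mulrC -[V%:R ^+ _ * _ * _]mulrA.
  by rewrite invfM [X in X <= _]mulrA lexx.
have C : \prod_(b < N) c b = z ^+ 'C(N, 2) / (\prod_(b < N) b`!)%N%:R.
  by rewrite -prodr_exp_bin2 natr_prod -prodfV -big_split.
have PA : \prod_(r < N) a r = X ^+ N * \prod_(r < N) w (f r).
  by rewrite /a big_split /= prodr_const card_ord.
have pw0 : 0 <= \prod_(r < N) w (f r) by apply: prodr_ge0 => r _; apply: le_trans (w1 _).
have bf0 : (0 : rat) < (\prod_(b < N) b`!)%N%:R.
  by rewrite ltr0n prodn_gt0 // => b; apply: fact_gt0.
have Xn0 : 0 <= X ^+ N by rewrite exprn_ge0 // (le_trans _ X1).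
have := le_trans det1 _; rewrite normrM [`|A|]ger0_norm //.
move=> /(_ _ (ler_wpM2r A0 (det_le dd))); rewrite PA C.
set Y := (V%:R ^+ n.-1 * (5 / 4) ^+ N) ^+ I * 4 ^+ 'C(I, 2) in W *.
have Y0 : 0 <= Y by exact: mulr_ge0 (exprn_ge0 _ (mulr_ge0 (exprn_ge0 _ (ler0n _ _)) (ratio_exp_ge0 _ _ _ _))) (exprn_ge0 _ (ler0n _ 4)).
move=> h1.
have zE : z ^+ 'C(N, 2) / (z ^+ 'C(T, 2) * z ^+ 'C(I, 2)) <= (k%:R ^+ E)^-1.
  rewrite -exprD ler_pdivrMr //; apply: le_trans (_ : z ^+ (E + ('C(T, 2) + 'C(I, 2))) <= _).
    by rewrite ler_wiXn2l // ltW.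
  rewrite exprD ler_wpM2r ?(ltW (zr0 _)) // -exprVn lerXn2r ?nnegrE ?(ltW z0) //.
  by rewrite invr_ge0 ler0n.
have h2 : 1 <= N`!%:R * (X ^+ N * (Y / k%:R ^+ E) / (\prod_(b < N) b`!)%N%:R) * A.
  apply: le_trans h1 _; rewrite ler_wpM2r // ler_wpM2l ?ler0n //.
  rewrite mulrA ler_wpM2r ?invr_ge0 ?(ltW bf0) // -mulrA ler_wpM2l //.
  apply: le_trans (ler_wpM2r (ltW (zr0 _)) W) _.
  by rewrite mulrAC mulrC ler_wpM2l // mulrC.
have kE0 : (0 : rat) < k%:R ^+ E by rewrite exprn_gt0 // ltr0n.
have h3 : (\prod_(b < N) b`!)%N%:R * k%:R ^+ E <= A * N`!%:R * X ^+ N * Y.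
  have pp := mulr_gt0 bf0 kE0.
  rewrite -[X in X <= _]mulr1; apply: le_trans (ler_wpM2l (ltW pp) h2) _.
  rewrite le_eqVlt; apply/orP; left; apply/eqP; field.
  by rewrite !gt_eqF.
rewrite -(ler_nat rat) !(natrM, natrX) -AE.
have f40 : (0 : rat) <= 4 ^+ (N * I) by rewrite exprn_ge0.
apply: le_trans (ler_wpM2r f40 h3) _; rewrite le_eqVlt; apply/orP; left; apply/eqP.
rewrite -[(2 * 27 ^+ mu) ^+ N]/(X ^+ N) /Y; move: (X ^+ N) => P.
rewrite exprMn -!exprM expr_div_n.
by field; rewrite expf_neq0.
Qed.

(** * The Vandermonde product of the nodes *)

Section ExpBound.
Variable F : realFieldType.

Lemma fact_ge_3 (i : nat) : (2 * 3 ^ i <= (i.+2)`!)%N.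
Proof.
elim: i => // i IH; rewrite factS expnS; apply: leq_trans (_ : i.+3 * (2 * 3 ^ i) <= _)%N.
  by rewrite mulnCA leq_mul2r; lia.
by rewrite leq_mul2l IH orbT.
Qed.

Lemma geo3 (M : nat) : \sum_(i < M) (3^-1 : F) ^+ i <= 3 / 2.
Proof.
have -> : \sum_(i < M) (3^-1 : F) ^+ i = 3 / 2 - 3 / 2 * 3^-1 ^+ M.
  elim: M => [|M IH]; first by rewrite big_ord0 mulr1 subrr.
  by rewrite big_ord_recr /= IH exprS; field.
have : (0 : F) <= 3^-1 ^+ M by rewrite exprn_ge0 // invr_ge0.
lra.
Qed.

Lemma euler_const_le (M : nat) : (1 + M%:R^-1) ^+ M <= 11 / 4 :> F.
Proof.
case: M => [|M]; first by rewrite expr0; lra.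
have M0 : (0 : F) < M.+1%:R by rewrite ltr0n.
have term (i : nat) : (M.+1%:R^-1 : F) ^+ i *+ 'C(M.+1, i) <= i`!%:R^-1.
  rewrite -mulr_natr exprVn mulrC ler_pdivrMr ?exprn_gt0 // ler_pdivlMl ?ltr0n ?fact_gt0 //.
  rewrite -natrX -natrM ler_nat mulnC bin_ffact.
  rewrite ffact_prod -[X in (_ <= _ ^ X)%N]card_ord -prod_nat_const.
  by apply: leq_prod => j _; rewrite leq_subr.
rewrite exprDn.
under eq_bigr => i _ do rewrite expr1n mul1r.
rewrite big_ord_recl /= expr0 bin0 mulr1n.
rewrite big_ord_recl /= /bump /= expr1 bin1 -mulr_natr mulVf ?gt_eqF //.
apply: le_trans (_ : 1 + (1 + \sum_(i < M) 2^-1 * 3^-1 ^+ i) <= _).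
  rewrite !lerD2l; apply: ler_sum => i _; rewrite /bump /= !add1n.
  apply: le_trans (term _) _; rewrite exprVn -invfM lef_pV2 ?posrE ?ltr0n ?fact_gt0 //.
    by rewrite -natrX -natrM ler_nat fact_ge_3.
  by rewrite mulr_gt0 ?exprn_gt0.
by rewrite -mulr_sumr; have := geo3 M; lra.
Qed.

(** By Bernoulli, 1 + a <= (1 + 1/M)^E; here 11/4 is a rational upper bound for Euler's number. *)
Lemma exp_le_11_4 (a : F) (M E : nat) : 0 <= a -> a * M%:R <= E%:R -> (1 + a) ^+ M <= (11 / 4) ^+ E.
Proof.
move=> a0 le_a; case: M le_a => [_|M le_a].
  by rewrite expr0 exprn_ege1 //; lra.
have M0 : (0 : F) < M.+1%:R by rewrite ltr0n.
apply: le_trans (_ : ((1 + M.+1%:R^-1) ^+ M.+1) ^+ E <= _); last first.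
  apply: lerXn2r; rewrite ?nnegrE; last exact: euler_const_le.
    by rewrite exprn_ge0 // addr_ge0 // invr_ge0 ler0n.
  by lra.
rewrite exprAC.
have bern : 1 + E%:R * M.+1%:R^-1 <= (1 + M.+1%:R^-1) ^+ E :> F.
  elim: (E) => [|e IH]; first by rewrite mul0r addr0.
  rewrite exprS; have h : 0 <= (M.+1%:R^-1 : F) by rewrite invr_ge0 ler0n.
  have h1 : (0 : F) <= e%:R by rewrite ler0n.
  have h2 := ler_wpM2l (addr_ge0 ler01 h) IH.
  apply: le_trans h2; rewrite -natr1 mulrDl mul1r mulrDr mulr1 mulrDl mul1r.
  move: h {IH}; move: (M.+1%:R^-1) => i h.
  by have := mulr_ge0 h (mulr_ge0 h1 h); lra.
apply: lerXn2r; rewrite ?nnegrE; first by rewrite addr_ge0.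
  by rewrite exprn_ge0 // addr_ge0 // invr_ge0 ler0n.
by apply: le_trans bern; rewrite lerD2l ler_pdivlMr.
Qed.

End ExpBound.

(** The product of all differences between two blocks of n consecutive integers whose first elements
    differ by m. *)
Definition block_prod (m n : nat) : nat := \prod_(l < n) \prod_(l' < n) (m + l - l').

Lemma prod_const_ord2 (c n : nat) : (\prod_(l < n) \prod_(l' < n) c = c ^ (n * n))%N.
Proof.
under eq_bigr => l _ do rewrite prod_nat_const card_ord.
by rewrite prod_nat_const card_ord expnM.
Qed.

Lemma dist_mul (m a b : nat) : (a <= m)%N -> (b <= m)%N ->
  ((m + a - b) * (m + b - a) = m * m - ((a - b) + (b - a)) * ((a - b) + (b - a)))%N.
Proof.
wlog le_ab : a b / (a <= b)%N => [hw am bm|am bm].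
  case: (leqP a b) => [|/ltnW] h; first exact: hw.
  by rewrite mulnC [(a - b + _)%N]addnC hw.
have -> : (a - b = 0)%N by apply/eqP.
rewrite add0n; have -> : (m + a - b = m - (b - a))%N by lia.
have -> : (m + b - a = m + (b - a))%N by lia.
by rewrite -subn_sqr !mulnn.
Qed.

(** The factors for (l, l') and (l', l) multiply to m^2 - (l - l')^2. *)
Lemma block_prod_le (m n : nat) : (n <= m)%N -> (block_prod m n <= m ^ (n * n))%N.
Proof.
move=> nm; rewrite -(@leq_exp2r _ _ 2) //.
have -> : (block_prod m n ^ 2 = \prod_(l < n) \prod_(l' < n) ((m + l - l') * (m + l' - l)))%N.
  rewrite -mulnn {2}/block_prod exchange_big /= /block_prod -big_split /=.
  by apply: eq_bigr => l _; rewrite -big_split.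
rewrite -expnM mulnC expnM -mulnn -prod_const_ord2.
apply: leq_prod => l _; apply: leq_prod => l' _.
by rewrite dist_mul ?leq_subr // ltnW // (leq_trans _ nm).
Qed.

Lemma prod_triangle (F : comNzRingType) (h : nat -> F) (n : nat) :
  \prod_(s < n) \prod_(e < s) h e = \prod_(e < n) h e ^+ (n.-1 - e).
Proof.
elim: n => [|n IH]; first by rewrite !big_ord0.
rewrite big_ord_recr /= IH [RHS]big_ord_recr /= subnn expr0 mulr1 -big_split /=.
apply: eq_bigr => e _; rewrite -exprSr; congr (_ ^+ _).
by have := ltn_ord e; lia.
Qed.

Lemma block_prod_square (F : comNzRingType) (g : nat -> nat -> F) (n : nat) :
  (forall i, g i i = 1) -> (forall i j e, g (i + e)%N (j + e)%N = g i j) ->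
  (forall i j, g i j = g j i) ->
  \prod_(l < n) \prod_(l' < n) g l l' = (\prod_(e < n) g 0%N e.+1 ^+ (n.-1 - e)) ^+ 2.
Proof.
move=> g1 gD gC; rewrite -(@prod_triangle _ (fun e => g 0%N e.+1)).
elim: n => [|n IH]; first by rewrite !big_ord0 expr1n.
rewrite big_ord_recr /= [in RHS]big_ord_recr /= exprMn -IH.
under eq_bigr => l _ do rewrite big_ord_recr /=.
rewrite big_split /= big_ord_recr /= g1 mulr1 -mulrA; congr (_ * _).
have e1 : \prod_(l < n) g l n = \prod_(e < n) g 0%N e.+1.
  rewrite (reindex_inj rev_ord_inj) /=; apply: eq_bigr => e _.
  by rewrite -(gD 0%N e.+1 (n - e.+1)%N) add0n subnKC.
have e2 : \prod_(l < n) g n l = \prod_(e < n) g 0%N e.+1.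
  by rewrite -e1; apply: eq_bigr => e _; rewrite gC.
by rewrite e1 e2 expr2.
Qed.

(** The relative loss at distance a is m^2 / (m^2 - a^2) = 1 + a^2 / (m^2 - a^2), occurring for 2 (n
    - a) ordered pairs. As 2a (n - a) <= (m + a)(m - a), all of them together lose at most (11/4)^a.
    Fourth powers keep the exponents integral. *)
Lemma block_prod_ge (m n : nat) : (n <= m)%N ->
  (m ^ (4 * (n * n)) * 4 ^ (n * n) <= block_prod m n ^ 4 * 11 ^ (n * n))%N.
Proof.
case: n => [|n] nm; first by rewrite !muln0 /block_prod big_ord0.
have m0 : (0 < m)%N by apply: leq_trans nm.
pose d (l l' : nat) : nat := ((m + l - l') * (m + l' - l))%N.
have dE (l l' : 'I_n.+1) : (0 < d l l')%N.
  by rewrite /d muln_gt0; have := ltn_ord l; have := ltn_ord l'; lia.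
pose g (l l' : nat) : rat :=
  (m * m)%N%:R / (m * m - ((l - l') + (l' - l)) * ((l - l') + (l' - l)))%N%:R.
have gd (l l' : 'I_n.+1) : g l l' = (m * m)%N%:R / (d l l')%:R.
  by rewrite /g /d dist_mul // ltnW // (leq_trans _ nm).
have mm0 : ((m * m)%N%:R : rat) != 0 by rewrite pnatr_eq0 muln_eq0 orbb -lt0n.
have E1 : \prod_(l < n.+1) \prod_(l' < n.+1) g l l' =
    (m ^ (2 * (n.+1 * n.+1)))%N%:R / (block_prod m n.+1 ^ 2)%N%:R.
  have -> : (block_prod m n.+1 ^ 2 = \prod_(l < n.+1) \prod_(l' < n.+1) d l l')%N.
    rewrite -mulnn {2}/block_prod exchange_big /= /block_prod -big_split /=.
    by apply: eq_bigr => l _; rewrite -big_split.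
  have -> : (m ^ (2 * (n.+1 * n.+1)) = \prod_(l < n.+1) \prod_(l' < n.+1) (m * m))%N.
    by rewrite prod_const_ord2 (mulnn m) -expnM.
  rewrite !natr_prod -prodf_div; apply: eq_bigr => l _.
  by rewrite !natr_prod -prodf_div; apply: eq_bigr => l' _; rewrite gd.
have gs : \prod_(l < n.+1) \prod_(l' < n.+1) g l l' =
    (\prod_(e < n) g 0%N e.+1 ^+ (n - e)) ^+ 2.
  rewrite block_prod_square ?big_ord_recr /= ?subnn ?expr0 ?mulr1 //.
  - by move=> i; rewrite /g subnn addn0 muln0 subn0 divff.
  - by move=> i j e; rewrite /g !subnDr.
  - by move=> i j; rewrite /g [(i - j + _)%N]addnC.
have bnd (e : 'I_n) : (g 0%N e.+1 ^+ (n - e)) ^+ 2 <= (11 / 4) ^+ e.+1.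
  rewrite -exprM /g sub0n subn0 add0n.
  set a := e.+1; have la : (a < n.+1)%N by exact: ltn_ord e.
  have lm : (a * a < m * m)%N by rewrite ltn_mul // (leq_trans la).
  have q0 : (0 : rat) < (m * m - a * a)%N%:R by rewrite ltr0n subn_gt0.
  have -> : (m * m)%N%:R / (m * m - a * a)%N%:R = 1 + (a * a)%N%:R / (m * m - a * a)%N%:R :> rat.
    by rewrite -{1}(subnK (ltnW lm)) natrD mulrDl divff // gt_eqF.
  apply: exp_le_11_4; first by rewrite divr_ge0 ?ler0n.
  rewrite mulrAC ler_pdivrMr // -!natrM ler_nat.
  have h1 : (n.+1 - a <= m - a)%N by rewrite leq_sub2r.
  have h2 : (2 * a <= m + a)%N by rewrite mul2n -addnn leq_add2r (leq_trans (ltnW la)).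
  have h3 : ((n.+1 - a) * (2 * a) <= m * m - a * a)%N.
    by apply: leq_trans (leq_mul h1 h2) _; rewrite -subn_sqr !mulnn.
  have -> : (a * a * ((n - e) * 2) = a * ((n.+1 - a) * (2 * a)))%N.
    by rewrite /a subSS; move: (n - e)%N => y; ring.
  by rewrite leq_mul2l h3 orbT.
have b0 : (0 : rat) < (block_prod m n.+1)%:R.
  rewrite ltr0n prodn_gt0 // => l; rewrite prodn_gt0 // => l'.
  by have := ltn_ord l'; lia.
have key : ((m ^ (2 * (n.+1 * n.+1)))%N%:R / (block_prod m n.+1 ^ 2)%N%:R) ^+ 2 <=
    (11 / 4) ^+ (n.+1 * n.+1) :> rat.
  rewrite -E1 gs.
  apply: le_trans (_ : (\prod_(e < n) (11 / 4) ^+ e.+1) ^+ 2 <= _).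
    apply: lerXn2r; rewrite ?nnegrE ?sqr_ge0 //.
      by apply: prodr_ge0 => e _; apply: ratio_exp_ge0.
    rewrite -prodrXl; apply: ler_prod => e _.
    by rewrite sqr_ge0 bnd.
  have -> : (\prod_(e < n) (11 / 4) ^+ e.+1) ^+ 2 = (11 / 4) ^+ (n * n.+1) :> rat.
    elim: (n) => [|p IH]; first by rewrite big_ord0 expr1n.
    rewrite big_ord_recr /= exprMn IH -exprM -exprD; congr (_ ^+ _); lia.
  by apply: ratio_exp_le; rewrite // leq_mul2r leqnSn orbT.
move: key; rewrite expr_div_n expr_div_n -!natrX -!expnM ler_pdivrMr; last first.
  by rewrite natrX exprn_gt0.
rewrite mulrAC ler_pdivlMr; last by rewrite ltr0n expn_gt0.
rewrite -!natrM ler_nat [(11 ^ _ * _)%N]mulnC => h; apply: leq_trans h.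
by rewrite leq_mul2r; apply/orP; right; rewrite leq_eqVlt; apply/orP; left; apply/eqP; congr (_ ^ _)%N; lia.
Qed.

Local Open Scope nat_scope.

Definition node_prod (k n N : nat) : nat :=
  \prod_(b < N) \prod_(c < b) (node k n b - node k n c).

Lemma prod_ord_mul (mu n : nat) (F : nat -> nat) :
  \prod_(b < mu * n) F b = \prod_(j < mu) \prod_(m < n) F (j * n + m).
Proof.
elim: mu => [|mu IH]; first by rewrite !big_ord0.
by rewrite big_ord_recr /= -IH mulSnr big_split_ord.
Qed.

Lemma node_mul_add (k n j l : nat) : l < n -> node k n (j * n + l) = j * k + l.
Proof.
move=> ln; have n0 : 0 < n by apply: leq_ltn_trans ln.
by rewrite /node divnMDl // divn_small // addn0 modnMDl modn_small.
Qed.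

Lemma node_prodS (k n mu : nat) : n <= k ->
  node_prod k n (mu.+1 * n) = node_prod k n (mu * n) *
    ((\prod_(j < mu) block_prod ((mu - j) * k) n) * \prod_(l < n) \prod_(l' < l) (l - l')).
Proof.
move=> nk; rewrite /node_prod mulSnr big_split_ord /=; congr (_ * _).
have E (l : 'I_n) : \prod_(c < mu * n + l) (node k n (mu * n + l) - node k n c) =
    (\prod_(j < mu) \prod_(l' < n) ((mu - j) * k + l - l')) * \prod_(l' < l) (l - l').
  rewrite big_split_ord /=; congr (_ * _).
    rewrite (@prod_ord_mul mu n (fun c => node k n (mu * n + l) - node k n c)).
    apply: eq_bigr => j _; apply: eq_bigr => l' _; rewrite !node_mul_add //.
    rewrite -{1}(subnK (ltnW (ltn_ord j))) mulnDl; lia.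
  apply: eq_bigr => l' _; rewrite !node_mul_add //; first by lia.
  by apply: ltn_trans (ltn_ord l') _.
under eq_bigr => l _ do rewrite E.
rewrite big_split /= exchange_big /=; congr (_ * _).
Qed.

Lemma node_prod_diag (n N : nat) : 0 < n -> node_prod n n N = \prod_(b < N) b`!.
Proof.
move=> n0; apply: eq_bigr => b _.
have nodeE c : node n n c = c by rewrite /node -divn_eq.
rewrite nodeE; under eq_bigr => c _ do rewrite nodeE.
by rewrite -ffactnn ffact_prod.
Qed.

(** Compares the C(mu, 2) pairs of blocks, at distance D k, with blocks of consecutive integers at
    distance D n. The case k = n is a product of factorials, which cancels against the factorials
    from the divided differences. *)
Lemma node_prod_le (k n mu : nat) : 0 < n <= k ->
  node_prod k n (mu * n) ^ 4 * (n ^ (4 * (n * n)) * 4 ^ (n * n)) ^ 'C(mu, 2) <=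
  node_prod n n (mu * n) ^ 4 * (k ^ (4 * (n * n)) * 11 ^ (n * n)) ^ 'C(mu, 2).
Proof.
move=> /andP[n0 nk]; elim: mu => [|mu IH].
  by rewrite !mul0n /node_prod !big_ord0 !bin0n !expn0.
rewrite !node_prodS // binS bin1 [('C(mu, 2) + mu)%N]addnC !(expnD _ mu).
set p := \prod_(l < n) _.
have step D : 0 < D -> block_prod (D * k) n ^ 4 * (n ^ (4 * (n * n)) * 4 ^ (n * n)) <=
    block_prod (D * n) n ^ 4 * (k ^ (4 * (n * n)) * 11 ^ (n * n)).
  move=> D0.
  have h1 : block_prod (D * k) n <= (D * k) ^ (n * n).
    by apply: block_prod_le; rewrite (leq_trans nk) // leq_pmull.
  have h2 : (D * n) ^ (4 * (n * n)) * 4 ^ (n * n) <= block_prod (D * n) n ^ 4 * 11 ^ (n * n).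
    by apply: block_prod_ge; rewrite leq_pmull.
  apply: leq_trans (_ : ((D * k) ^ (n * n)) ^ 4 * (n ^ (4 * (n * n)) * 4 ^ (n * n)) <= _).
    by rewrite leq_mul2r leq_exp2r // h1 orbT.
  rewrite -expnM [n * n * 4]mulnC mulnA -expnMn.
  rewrite (_ : D * k * n = k * (D * n)); last by lia.
  by rewrite expnMn -mulnA [_ ^ 4 * _]mulnCA leq_mul2l h2 orbT.
have steps : (\prod_(j < mu) block_prod ((mu - j) * k) n) ^ 4 *
      (n ^ (4 * (n * n)) * 4 ^ (n * n)) ^ mu <=
    (\prod_(j < mu) block_prod ((mu - j) * n) n) ^ 4 *
      (k ^ (4 * (n * n)) * 11 ^ (n * n)) ^ mu.
  have powE (c : nat) (G : 'I_mu -> nat) : (\prod_j G j) ^ 4 * c ^ mu = \prod_j (G j ^ 4 * c).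
    rewrite big_split /= prod_nat_const card_ord; congr (_ * _).
    by elim/big_rec2: _ => // j x y _ <-; rewrite expnMn.
  by rewrite !powE; apply: leq_prod => j _; apply: step; rewrite subn_gt0.
have := leq_mul (leq_mul IH steps) (leqnn (p ^ 4)).
move: (node_prod k n _) (node_prod n n _) (_ ^ 'C(mu, 2)) (_ ^ 'C(mu, 2)) (_ ^ mu) (_ ^ mu).
move: (\prod_(j < mu) _) (\prod_(j < mu) _) => s t x y c d c' d'.
have e (u v w z : nat) : (u * (v * p)) ^ 4 * (w * z) = u ^ 4 * z * (v ^ 4 * w) * p ^ 4.
  by rewrite !expnMn; ring.
by rewrite !e.
Qed.

Lemma fact_le_exp (N : nat) : N`! <= N ^ N.
Proof.
rewrite -ffactnn ffact_prod -[X in _ <= _ ^ X]card_ord -prod_nat_const.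
by apply: leq_prod => i _; apply: leq_subr.
Qed.

Lemma interpolation_bound (k n mu T I E U V : nat) :
  0 < n <= k -> 0 < V < U -> mu * n.+1 <= (T + I).+1 -> I <= mu * k ->
  E + ('C(T, 2) + 'C(I, 2)) <= 'C(mu * n, 2) ->
  k * (U - V) <= V -> U ^ k <= 3 * V ^ k ->
  mu * 3 ^ mu * ((2 * V ^ k - U ^ k) + (U ^ k - 2 * V ^ k)) * (8 * V) ^ (mu * n) <=
    V ^ k * (5 * (U - V)) ^ (mu * n) ->
  (k ^ E * 4 ^ (mu * n * I)) ^ 4 * (n ^ (4 * (n * n)) * 4 ^ (n * n)) ^ 'C(mu, 2) <=
  (k ^ (4 * (n * n)) * 11 ^ (n * n)) ^ 'C(mu, 2) *
  ((mu * n) ^ (mu * n) * (2 * 27 ^ mu) ^ (mu * n) * V ^ (n.-1 * I) * 5 ^ (mu * n * I) *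
    4 ^ 'C(I, 2)) ^ 4.
Proof.
move=> nk VU le_mu I_le leE z_le x_le close.
have /andP[n0 _] := nk.
have H := interpolation_inequality nk VU le_mu I_le leE z_le x_le close.
have {}H : node_prod n n (mu * n) * (k ^ E * 4 ^ (mu * n * I)) <=
   node_prod k n (mu * n) * ((mu * n) ^ (mu * n) * (2 * 27 ^ mu) ^ (mu * n) *
      V ^ (n.-1 * I) * 5 ^ (mu * n * I) * 4 ^ 'C(I, 2)).
  rewrite node_prod_diag // mulnA; apply: leq_trans H _; rewrite -/(node_prod _ _ _).
  rewrite !mulnA !leq_mul2r; do 4![apply/orP; right].
  by rewrite leq_mul2l fact_le_exp orbT.
move: H (node_prod_le mu nk).
have Q0 : 0 < node_prod n n (mu * n).
  by rewrite node_prod_diag // prodn_gt0 // => b; apply: fact_gt0.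
move: (node_prod n n _) (node_prod k n _) Q0 => Q P Q0.
set a := k ^ E * _; set b := _ ^ (n.-1 * I); set r := _ * 4 ^ 'C(I, 2).
set c := _ ^ 'C(mu, 2); set d := _ ^ 'C(mu, 2) => h1 h2.
rewrite -(@leq_pmul2l (Q ^ 4)) ?expn_gt0 ?Q0 // mulnA -expnMn.
apply: leq_trans (_ : (P * r) ^ 4 * c <= _); first by rewrite leq_mul2r leq_exp2r // h1 orbT.
by rewrite expnMn mulnAC [Q ^ 4 * _]mulnA leq_mul2r h2 orbT.
Qed.

End Interpolation.

(** * Exponents from 2600 on *)

Module Estimates.

Import Reals Lra Lia Psatz Arith.
Local Open Scope R_scope.

Lemma ln_le_of_pow (a b : R) (p q : nat) :
  0 < a -> 0 < b -> a ^ p <= b ^ q -> INR p * ln a <= INR q * ln b.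
Proof.
intros ha hb h; rewrite <- !ln_pow by assumption.
destruct h as [h | h]; [left; apply ln_increasing; auto using pow_lt | right; now rewrite h].
Qed.

Lemma ln_le_tangent (a c : R) : 0 < a -> 0 < c -> ln a <= a / c + ln c - 1.
Proof.
intros ha hc.
assert (h : ln (a / c) <= a / c - 1).
{ assert (h1 : 0 < a / c) by now apply Rdiv_lt_0_compat.
  rewrite <- (ln_exp (a / c - 1)).
  assert (h2 := exp_ineq1_le (a / c - 1)).
  destruct (Rle_lt_or_eq_dec _ _ h2) as [h3 | h3].
  - left; apply ln_increasing; lra.
  - right; f_equal; lra. }
unfold Rdiv at 1 in h; rewrite ln_mult, ln_Rinv in h; auto using Rinv_0_lt_compat; lra.
Qed.

Lemma ln2_ge : / 2 <= ln 2.
Proof.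
assert (h := exp_le_3); assert (h1 := exp_pos 1).
assert (h2 : ln (exp 1) <= 2 * ln 2).
{ change 2 with (INR 2) at 1; rewrite <- ln_pow by lra.
  left; apply ln_increasing; simpl; lra. }
rewrite ln_exp in h2; lra.
Qed.

(** After taking logarithms and dividing by a multiple of (mu nu)^2, the gain is nearly 2 ln k from
    E, while the powers of V cost at most (3/5)(1 + 1/mu)(ln k + 2 ln 2). The Vandermonde products
    contribute through ln (k / n) only, which is about ln 5. All other logarithms are compared with
    ln 2. *)
Lemma numeric_contradiction (k V mu nu p q E : nat) :
  (2600 <= k)%nat -> (15 * nu <= k < 15 * nu + 15)%nat -> (4 <= mu)%nat -> (1 <= V)%nat ->
  INR V ^ 5 < (4 * INR k) ^ S mu ->
  (2 * p = mu * (mu - 1))%nat -> (2 * q = mu * nu * (mu * nu - 1))%nat ->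
  (E + 2 * (mu * mu * nu) + mu * mu = 2 * (mu * mu * nu * nu))%nat ->
  (INR k ^ E * 4 ^ (mu * (3 * nu) * (mu * nu))) ^ 4 *
    (INR (3 * nu) ^ (4 * (3 * nu * (3 * nu))) * 4 ^ (3 * nu * (3 * nu))) ^ p <=
  (INR k ^ (4 * (3 * nu * (3 * nu))) * 11 ^ (3 * nu * (3 * nu))) ^ p *
  (INR (mu * (3 * nu)) ^ (mu * (3 * nu)) * (2 * 27 ^ mu) ^ (mu * (3 * nu)) *
    INR V ^ ((3 * nu - 1) * (mu * nu)) * 5 ^ (mu * (3 * nu) * (mu * nu)) * 4 ^ q) ^ 4 -> False.
Proof.
intros hk [hn1 hn2] hmu hV hVk hp hq hE H.
assert (hnu : (173 <= nu)%nat) by lia.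
assert (k0 : 0 < INR k) by (apply lt_0_INR; lia).
assert (V0 : 0 < INR V) by (apply lt_0_INR; lia).
assert (n0 : 0 < INR (3 * nu)) by (apply lt_0_INR; lia).
assert (N0 : 0 < INR (mu * (3 * nu))) by (apply lt_0_INR; nia).
assert (pp : forall a n, 0 < a -> 0 < a ^ n) by (intros; now apply pow_lt).
assert (L : 4 * (INR E * ln (INR k) + INR (mu * (3 * nu) * (mu * nu)) * ln 4)
   + INR p * (INR (4 * (3 * nu * (3 * nu))) * ln (INR (3 * nu)) + INR (3 * nu * (3 * nu)) * ln 4)
  <= INR p * (INR (4 * (3 * nu * (3 * nu))) * ln (INR k) + INR (3 * nu * (3 * nu)) * ln 11)
   + 4 * (INR (mu * (3 * nu)) * ln (INR (mu * (3 * nu))) + INR (mu * (3 * nu)) * (ln 2 + INR mu * ln 27)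
     + INR ((3 * nu - 1) * (mu * nu)) * ln (INR V) + INR (mu * (3 * nu) * (mu * nu)) * ln 5
     + INR q * ln 4)).
{ match type of H with ?a <= ?b =>
    assert (hl : ln a <= ln b) end.
  { destruct H as [H | H]; [left; apply ln_increasing; [|exact H] | right; now rewrite H].
    repeat (apply Rmult_lt_0_compat || apply pow_lt); lra. }
  revert hl.
  repeat first
    [ rewrite ln_mult by (repeat (apply Rmult_lt_0_compat || apply pow_lt); lra)
    | rewrite ln_pow by (repeat (apply Rmult_lt_0_compat || apply pow_lt); lra) ].
  replace (INR 4) with 4 by (simpl; lra). intros hl; lra. }
clear H.
set (m := INR mu); set (v := INR nu); set (K := ln (INR k)) in *; set (W := ln (INR V)) in *.
assert (m4 : 4 <= m) by (replace 4 with (INR 4) by (simpl; lra); apply le_INR; lia).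
assert (v173 : 173 <= v) by (replace 173 with (INR 173) by (rewrite INR_IZR_INZ; reflexivity); apply le_INR; lia).
assert (mu1 : INR (mu - 1) = m - 1) by (unfold m; rewrite minus_INR by lia; simpl; lra).
assert (ep : 2 * INR p = m * (m - 1)).
{ rewrite <- mu1; unfold m; rewrite <- mult_INR, <- hp, mult_INR; simpl (INR 2); lra. }
assert (eq : 2 * INR q <= m * v * (m * v)).
{ assert (h : (2 * q <= mu * nu * (mu * nu))%nat) by (rewrite hq; nia).
  apply le_INR in h; rewrite !mult_INR in h; simpl (INR 2) in h; exact h. }
assert (eE : INR E = 2 * (m * m * v * v) - 2 * (m * m * v) - m * m).
{ apply (f_equal INR) in hE; rewrite !plus_INR, !mult_INR in hE; simpl (INR 2) in hE.
  fold m v in hE; lra. }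
assert (hv1 : INR ((3 * nu - 1) * (mu * nu)) <= 3 * v * (m * v)).
{ apply Rle_trans with (INR (3 * nu * (mu * nu))); [apply le_INR, PeanoNat.Nat.mul_le_mono_r; lia|].
  rewrite !mult_INR; simpl (INR 3); fold m v; lra. }
set (l := ln 2) in *.
assert (l2 : / 2 <= l) by exact ln2_ge.
assert (e4 : ln 4 = 2 * l).
{ replace 4 with (2 ^ 2) by lra; rewrite ln_pow by lra; simpl; unfold l; lra. }
assert (e5 : 3 * ln 5 <= 7 * l).
{ assert (h := ln_le_of_pow 5 2 3 7 ltac:(lra) ltac:(lra) ltac:(lra)); simpl in h; fold l in h; lra. }
assert (e27 : ln 27 <= 24 / 5 * l).
{ assert (h := ln_le_of_pow 27 2 5 24 ltac:(lra) ltac:(lra) ltac:(lra)); simpl in h; fold l in h; lra. }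
assert (e11 : 13 * ln 11 <= 45 * l).
{ assert (h := ln_le_of_pow 11 2 13 45 ltac:(lra) ltac:(lra) ltac:(lra)); simpl in h; fold l in h; lra. }
assert (eK : 34 * l <= 3 * K).
{ assert (h := ln_le_of_pow 2 (INR k) 34 3 ltac:(lra) k0).
  assert (h1 : 2600 <= INR k).
  { replace 2600 with (INR 2600) by (rewrite INR_IZR_INZ; reflexivity); apply le_INR; lia. }
  assert (h2 : 2 ^ 34 <= INR k ^ 3).
  { apply Rle_trans with (2600 ^ 3); [lra | apply pow_incr; lra]. }
  specialize (h h2); replace (INR 34) with 34 in h by (simpl; lra).
  replace (INR 3) with 3 in h by (simpl; lra). exact h. }
assert (W0 : 0 <= W).
{ unfold W; rewrite <- ln_1; destruct (Req_dec (INR V) 1) as [->|ne]; [lra|].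
  left; apply ln_increasing; [lra|]. apply le_INR in hV; simpl in hV; lra. }
assert (eW : 5 * W <= (m + 1) * (2 * l + K)).
{ assert (h := ln_le_of_pow (INR V) (4 * INR k) 5 (S mu) V0 ltac:(lra) ltac:(lra)).
  rewrite (S_INR mu), ln_mult, e4 in h by lra.
  replace (INR 5) with 5 in h by (simpl; lra). exact h. }
assert (en : K - ln (INR (3 * nu)) <= 7 / 3 * l + / v).
{ assert (h1 : INR k <= 5 * (1 + / v) * INR (3 * nu)).
  { apply Rle_trans with (INR (15 * nu + 15)); [apply le_INR; lia|].
    rewrite plus_INR, !mult_INR; replace (INR 15) with 15 by (simpl; lra).
    replace (INR 3) with 3 by (simpl; lra). fold v; right; field; lra. }
  assert (v0 : 0 < / v) by (apply Rinv_0_lt_compat; lra).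
  assert (h2 : K <= ln (5 * (1 + / v) * INR (3 * nu))).
  { unfold K; destruct h1 as [h1|h1]; [left; apply ln_increasing; auto | right; now rewrite h1]. }
  rewrite !ln_mult in h2 by lra.
  assert (h3 := ln_le_tangent (1 + / v) 1 ltac:(lra) ltac:(lra)); rewrite ln_1 in h3.
  lra. }
set (y := / m); set (w := / v) in *.
assert (my : m * y = 1) by (unfold y; field; lra).
assert (vw : v * w = 1) by (unfold w; field; lra).
assert (y0 : 0 < y) by (apply Rinv_0_lt_compat; lra).
assert (w0 : 0 < w) by (apply Rinv_0_lt_compat; lra).
assert (y4 : y <= / 4) by nra.
assert (w173 : w <= / 173) by nra.
assert (eN : y * w * ln (INR (mu * (3 * nu))) <= 3 / 2048 + 11 / 692 * l).
{ assert (h := ln_le_tangent (INR (mu * (3 * nu))) (2 ^ 11) N0 ltac:(lra)).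
  rewrite ln_pow in h by lra; replace (INR 11) with 11 in h by (simpl; lra); fold l in h.
  rewrite !mult_INR in *; replace (INR 3) with 3 in * by (simpl; lra).
  fold m v in h |- *. replace (2 ^ 11) with 2048 in h by lra.
  assert (yw0 : 0 < y * w) by nra.
  assert (yw : y * w <= / 692) by nra.
  apply Rle_trans with (y * w * (m * (3 * v) / 2048 + 11 * l - 1)).
  { apply Rmult_le_compat_l; lra. }
  replace (y * w * (m * (3 * v) / 2048 + 11 * l - 1)) with (3 * (m * y) * (v * w) / 2048 + y * w * (11 * l) - y * w) by field.
  rewrite my, vw. nra. }
rewrite e4 in L.
set (S := m * m * v * v).
assert (S0 : 0 < S) by (unfold S; repeat apply Rmult_lt_0_compat; lra).
assert (E1 : INR E = S * (2 - 2 * w - w * w)) by (rewrite eE; unfold S, w; field; lra).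
assert (P1 : INR p * (v * v) = S * ((1 - y) / 2)).
{ replace (INR p) with (m * (m - 1) / 2) by lra; unfold S, y; field; lra. }
assert (N1 : m * v = S * (y * w)) by (unfold S, y, w; field; lra).
assert (N2 : m * v * m = S * w) by (unfold S, w; field; lra).
assert (C1 : v * (m * v) = S * y) by (unfold S, y; field; lra).
assert (X : (2 - 2 * w - w * w) * K + 6 * l <=
   9 / 2 * (1 - y) * (7 / 3 * l + w + (45 / 13 * l - 2 * l) / 4) + 3 * (3 / 2048 + 11 / 692 * l)
   + 3 * w * (l * y + 24 / 5 * l) + 3 * y * W + 3 * ln 5 + l).
{ apply Rmult_le_reg_l with S; [exact S0|].
  set (ln_n := ln (INR (3 * nu))) in *; set (ln_N := ln (INR (mu * (3 * nu)))) in *.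
  rewrite !mult_INR in L; replace (INR 3) with 3 in * by (simpl; lra).
  replace (INR 4) with 4 in * by (simpl; lra). fold m v in L. rewrite E1 in L.
  assert (L1 : 4 * (S * (2 - 2 * w - w * w) * K + 3 * S * (2 * l)) + 9 * (S * ((1 - y) / 2)) * (4 * ln_n + 2 * l)
    <= 9 * (S * ((1 - y) / 2)) * (4 * K + ln 11)
     + 4 * (3 * (S * (y * w)) * ln_N + 3 * (S * (y * w)) * l + 3 * (S * w) * ln 27
        + 3 * (S * y) * W + 3 * S * ln 5 + S * l)).
  { rewrite <- P1, <- N1, <- N2, <- C1.
    assert (hW := Rmult_le_compat_r W _ _ W0 hv1).
    assert (hQ := Rmult_le_compat_r l _ _ ltac:(lra) eq).
    rewrite !mult_INR in hW; fold m v in hW.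
    unfold S in *; lra. }
  assert (y1 : 0 <= S * (1 - y)) by (apply Rmult_le_pos; lra).
  assert (Y1 := Rmult_le_compat_l (S * (1 - y)) _ _ y1 en).
  assert (Y2 := Rmult_le_compat_l (S * (1 - y)) _ _ y1 e11).
  assert (Y3 := Rmult_le_compat_l S _ _ ltac:(lra) eN).
  assert (sw : 0 <= S * w) by (apply Rmult_le_pos; lra).
  assert (Y4 := Rmult_le_compat_l (S * w) _ _ sw e27).
  clear - L1 Y1 Y2 Y3 Y4. lra. }
assert (Y5 := Rmult_le_compat_l y _ _ ltac:(lra) eW).
assert (Y6 : y * ((m + 1) * (2 * l + K)) = (1 + y) * (2 * l + K)).
{ rewrite <- Rmult_assoc; replace (y * (m + 1)) with (m * y + y) by ring; now rewrite my. }
assert (K0 : 34 / 3 * l <= K) by lra.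
assert (w2 := Rmult_le_compat w (/ 173) w (/ 173) ltac:(lra) ltac:(lra) w173 w173).
(* The coefficient of K left after the elimination of W is nonnegative, so K may be replaced by its
   lower bound. *)
assert (coef : 0 <= 2 - 2 * w - w * w - 3 / 5 * (1 + y)) by lra.
assert (Y7 := Rmult_le_compat_l _ _ _ coef K0).
assert (Y8 : (2 - 2 * w - w * w - 3 / 5 * (1 + y)) * (34 / 3 * l) + 6 * l <=
   9 / 2 * (1 - y) * (7 / 3 * l + w + (45 / 13 * l - 2 * l) / 4) + 3 * (3 / 2048 + 11 / 692 * l)
   + 3 * w * (l * y + 24 / 5 * l) + 6 / 5 * (1 + y) * l + 3 * ln 5 + l).
{ assert (Y9 : 3 * y * W <= 3 / 5 * (1 + y) * (2 * l + K)) by lra.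
  lra. }
assert (wl : w <= 2 / 173 * l) by lra.
assert (Z1 : (1 - y) * w <= (1 - y) * (2 / 173 * l)) by (apply Rmult_le_compat_l; lra).
assert (Z2 : w * (l * y + 24 / 5 * l) <= / 173 * (l * / 4 + 24 / 5 * l)).
{ assert (h1 := Rmult_le_compat_l l _ _ ltac:(lra) y4).
  assert (h2 := Rmult_lt_0_compat l y ltac:(lra) y0).
  apply Rmult_le_compat; lra. }
assert (Z3 : 2 * w * l <= 2 / 173 * l) by (apply Rmult_le_compat_r; lra).
assert (Z4 : w * w * l <= / 29929 * l) by (apply Rmult_le_compat_r; lra).
(* Constant terms are absorbed into multiples of ln 2 by 1/2 <= ln 2; what remains is linear in y =
   1/mu and fails for 0 < y <= 1/4. *)
assert (Z5 : (2 - 2 / 173 - / 29929 - 3 / 5 * (1 + y)) * (34 / 3) * l + 6 * l <=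
   9 / 2 * (1 - y) * (7 / 3 + 2 / 173 + 19 / 52) * l + 3 * (6 / 2048 + 11 / 692) * l
   + 3 / 173 * (/ 4 + 24 / 5) * l + 6 / 5 * (1 + y) * l + 8 * l) by lra.
assert (l0 : 0 < l) by lra.
assert (Z6 : (2 - 2 / 173 - / 29929 - 3 / 5 * (1 + y)) * (34 / 3) + 6 <=
   9 / 2 * (1 - y) * (7 / 3 + 2 / 173 + 19 / 52) + 3 * (6 / 2048 + 11 / 692)
   + 3 / 173 * (/ 4 + 24 / 5) + 6 / 5 * (1 + y) + 8).
{ apply Rmult_le_reg_r with l; lra. }
lra.
Qed.

Lemma pow_ge_binom2 (a : R) (k : nat) : 0 <= a ->
  1 + INR k * a + INR k * (INR k - 1) / 2 * a ^ 2 <= (1 + a) ^ k.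
Proof.
intros ha; induction k as [|k IH]; [simpl; lra|].
rewrite S_INR; simpl pow in *.
assert (k0 := pos_INR k).
destruct k as [|k]; [simpl; nra|].
assert (k1 : 1 <= INR (S k)) by (rewrite S_INR; assert (h := pos_INR k); lra).
set (K := INR (S k)) in *; set (p := (1 + a) ^ S k) in *.
assert (h1 : (1 + a) * (1 + K * a + K * (K - 1) / 2 * (a * (a * 1))) <= (1 + a) * p)
  by (apply Rmult_le_compat_l; lra).
assert (h2 : 0 <= K * (K - 1)) by nra.
assert (h3 : 0 <= a * a * a) by (repeat apply Rmult_le_pos; lra).
assert (h4 := Rmult_le_pos _ _ h2 h3); lra.
Qed.

Lemma pow2_ge (k : nat) : (20 <= k)%nat -> (100 * k <= 2 ^ k)%nat.
Proof.
induction 1 as [|k hk IH]; [apply Nat.leb_le; reflexivity|].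
simpl; lia.
Qed.

Lemma pow32_ge (n : nat) : (21 <= n)%nat -> 180 * INR n + 180 <= (3 / 2) ^ n.
Proof.
induction 1 as [|n hn IH].
- replace (INR 21) with 21 by (rewrite INR_IZR_INZ; reflexivity); lra.
- apply le_INR in hn; replace (INR 21) with 21 in hn by (rewrite INR_IZR_INZ; reflexivity).
  rewrite S_INR; simpl pow; lra.
Qed.

Lemma largest_exponent (b N : nat) : (2 <= b)%nat -> (b ^ 4 <= N)%nat ->
  exists mu, (4 <= mu)%nat /\ (b ^ mu <= N < b ^ S mu)%nat.
Proof.
intros hb hN.
assert (h : forall d, (N < b ^ (4 + d))%nat -> exists mu, (4 <= mu)%nat /\ (b ^ mu <= N < b ^ S mu)%nat).
{ induction d as [|d IH]; intros hd; [rewrite Nat.add_0_r in hd; lia|].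
  destruct (Nat.lt_ge_cases N (b ^ (4 + d))) as [h|h]; [now apply IH|].
  exists (4 + d)%nat; split; [lia|split; [exact h|]].
  now replace (S (4 + d)) with (4 + S d)%nat by lia. }
apply (h N), Nat.lt_le_trans with (b ^ N)%nat; [apply Nat.pow_gt_lin_r; lia|].
apply Nat.pow_le_mono_r; lia.
Qed.

(** [mu] is the largest exponent with (4k)^mu <= V^5. Put N = 3 mu nu. Then V^k >= (4k)^N, whereas
    |U^k - 2 V^k| <= 2k and U - V >= V / (2k) require only (16k/5)^N up to smaller factors. The
    spare (5/4)^N pays for these. *)
Lemma approximation_parameters (k nu U V : nat) :
  (2600 <= k)%nat -> (15 * nu <= k < 15 * nu + 15)%nat -> (1 <= V < U)%nat ->
  (U ^ k <= 2 * V ^ k + 2 * k)%nat -> (2 * V ^ k <= U ^ k + 2 * k)%nat ->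
  exists mu, (4 <= mu)%nat /\ (V ^ 5 < (4 * k) ^ S mu)%nat /\ (k * (U - V) <= V)%nat /\
    (U ^ k <= 3 * V ^ k)%nat /\
    (mu * 3 ^ mu * ((2 * V ^ k - U ^ k) + (U ^ k - 2 * V ^ k)) * (8 * V) ^ (mu * (3 * nu)) <=
     V ^ k * (5 * (U - V)) ^ (mu * (3 * nu)))%nat.
Proof.
intros hk hnu hUV h1 h2.
assert (hp := pow2_ge k ltac:(lia)).
assert (V2 : (2 <= V)%nat).
{ destruct (Nat.eq_dec V 1) as [e|]; [|lia]. subst V.
  rewrite Nat.pow_1_l in h1.
  assert (h := Nat.pow_le_mono_l 2 U k ltac:(lia)); lia. }
assert (hV := Nat.pow_le_mono_l 2 V k V2).
assert (F3 : (U ^ k <= 3 * V ^ k)%nat) by lia.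
set (u := INR U); set (v := INR V); set (K := INR k).
assert (K0 : 2600 <= K).
{ replace 2600 with (INR 2600) by (rewrite INR_IZR_INZ; reflexivity); apply le_INR; lia. }
assert (v2 : 2 <= v) by (replace 2 with (INR 2) by (simpl; lra); apply le_INR; lia).
assert (vk0 : 0 < v ^ k) by (apply pow_lt; lra).
set (z := INR (U - V) / v).
assert (uz : u = v * (1 + z)).
{ unfold z; rewrite minus_INR by lia; fold u v; field; lra. }
assert (d1 : 1 <= INR (U - V)) by (replace 1 with (INR 1) by (simpl; lra); apply le_INR; lia).
assert (z0 : 0 < z) by (apply Rdiv_lt_0_compat; lra).
assert (zk : u ^ k = v ^ k * (1 + z) ^ k) by (rewrite uz, Rpow_mult_distr; reflexivity).
assert (R1 : (1 + z) ^ k <= 2 + 1 / 50).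
{ apply Rmult_le_reg_l with (v ^ k); [lra|]. rewrite <- zk.
  apply le_INR in h1, hV, hp. rewrite plus_INR, !mult_INR, !pow_INR in h1.
  rewrite !pow_INR in hV. rewrite mult_INR, pow_INR in hp.
  replace (INR 100) with 100 in hp by (rewrite INR_IZR_INZ; reflexivity).
  simpl (INR 2) in h1, hV, hp. fold u v K in h1, hV, hp. lra. }
assert (R2 : 2 - 1 / 50 <= (1 + z) ^ k).
{ apply Rmult_le_reg_l with (v ^ k); [lra|]. rewrite <- zk.
  apply le_INR in h2, hV, hp. rewrite plus_INR, !mult_INR, !pow_INR in h2.
  rewrite !pow_INR in hV. rewrite mult_INR, pow_INR in hp.
  replace (INR 100) with 100 in hp by (rewrite INR_IZR_INZ; reflexivity).
  simpl (INR 2) in h2, hV, hp. fold u v K in h2, hV, hp. lra. }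
(* If k z > 1, the quadratic term pushes (1 + z)^k close to 5/2, above its upper bound 2 + 1/50. *)
assert (F2 : (k * (U - V) <= V)%nat).
{ destruct (Nat.le_gt_cases (k * (U - V)) V) as [|h]; [assumption|exfalso].
  apply lt_INR in h; rewrite mult_INR in h; fold K v in h.
  assert (hz : 1 < K * z).
  { unfold z. replace (K * (INR (U - V) / v)) with (K * INR (U - V) / v) by (field; lra).
    apply Rmult_lt_reg_r with v; [lra|]. unfold Rdiv; rewrite Rmult_assoc, Rinv_l by lra. lra. }
  assert (hb := pow_ge_binom2 z k ltac:(lra)); fold K in hb.
  assert (hzz : 1 < (K * z) * (K * z)) by nra.
  replace (K * (K - 1) / 2 * z ^ 2) with ((K * z * (K * z)) * (1 - / K) / 2) in hb by (field; lra).
  assert (hK : / K <= / 2600) by (apply Rinv_le_contravar; lra).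
  nra. }
(* If k z < 1/2, then (1 + z)^k is below the square root of 3, less than 2 - 1/50. *)
assert (F4 : v <= 2 * K * INR (U - V)).
{ destruct (Rle_lt_dec v (2 * K * INR (U - V))) as [|h]; [assumption|exfalso].
  assert (hz : K * z < / 2).
  { unfold z. replace (K * (INR (U - V) / v)) with (K * INR (U - V) / v) by (field; lra).
    apply Rmult_lt_reg_r with v; [lra|]. unfold Rdiv; rewrite Rmult_assoc, Rinv_l by lra. lra. }
  assert (he : (1 + z) ^ k <= exp (K * z)).
  { apply Rle_trans with (exp z ^ k).
    - apply pow_incr; split; [lra|apply exp_ineq1_le].
    - right; unfold K; clear. induction k as [|k IH]; [simpl; now rewrite Rmult_0_l, exp_0|].
      rewrite S_INR; simpl pow; rewrite IH, <- exp_plus; f_equal; ring. }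
  assert (hs : exp (/ 2) * exp (/ 2) <= 3).
  { rewrite <- exp_plus; replace (/ 2 + / 2) with 1 by lra; apply exp_le_3. }
  assert (hi : exp (K * z) < exp (/ 2)) by now apply exp_increasing.
  assert (hpos := exp_pos (/ 2)). nra. }
(* V >= k makes V^5 at least (4k)^4, which secures mu >= 4. *)
assert (kV : (k <= V)%nat) by nia.
assert (hb : ((4 * k) ^ 4 <= V ^ 5)%nat).
{ apply Nat.le_trans with (k ^ 5)%nat; [|apply Nat.pow_le_mono_l; lia].
  rewrite Nat.pow_mul_l, (Nat.pow_succ_r _ 4) by lia. apply Nat.mul_le_mono_r; simpl; lia. }
destruct (largest_exponent (4 * k) (V ^ 5) ltac:(lia) hb) as [mu [m4 [m1 m2]]].
exists mu; repeat split; try assumption.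
set (N := (mu * (3 * nu))%nat).
apply INR_le; rewrite !mult_INR, !pow_INR, !mult_INR; fold v.
replace (INR 8) with 8 by (simpl; lra); replace (INR 5) with 5 by (simpl; lra);
replace (INR 3) with 3 by (simpl; lra).
assert (D : INR (2 * V ^ k - U ^ k + (U ^ k - 2 * V ^ k)) <= 2 * K).
{ unfold K; replace 2 with (INR 2) by (simpl; lra); rewrite <- mult_INR; apply le_INR; lia. }
set (m := INR mu).
assert (m0 : 0 <= m) by apply pos_INR.
assert (A1 : (v / (2 * K)) ^ N <= INR (U - V) ^ N).
{ apply pow_incr; split; [apply Rlt_le, Rdiv_lt_0_compat; lra|].
  apply Rmult_le_reg_r with (2 * K); [lra|]. unfold Rdiv; rewrite Rmult_assoc, Rinv_l by lra. lra. }
assert (A2 : (4 * K) ^ N <= v ^ k).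
{ apply Rle_trans with (v ^ (15 * nu)); [|apply Rle_pow; [lra|lia]].
  replace (15 * nu)%nat with (5 * (3 * nu))%nat by lia.
  unfold N; rewrite (pow_mult (4 * K)), (pow_mult v). apply pow_incr; split; [apply pow_le; lra|].
  apply le_INR in m1; rewrite !pow_INR, mult_INR in m1.
  replace (INR 4) with 4 in m1 by (simpl; lra). exact m1. }
assert (A3 : m * 3 ^ mu * (2 * K) <= (5 / 4) ^ N).
{ apply Rle_trans with ((12 * K) ^ mu).
  - replace (12 * K) with (2 * 3 * (2 * K)) by lra.
    rewrite (Rpow_mult_distr (2 * 3)), (Rpow_mult_distr 2 3).
    assert (B1 : m <= 2 ^ mu).
    { unfold m. replace 2 with (INR 2) by (simpl; lra). rewrite <- pow_INR.
      apply le_INR, Nat.lt_le_incl, Nat.pow_gt_lin_r; lia. }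
    assert (B2 : 2 * K <= (2 * K) ^ mu).
    { rewrite <- (pow_1 (2 * K)) at 1. apply Rle_pow; [lra|lia]. }
    assert (B3 : 0 <= 3 ^ mu) by (apply pow_le; lra).
    apply Rmult_le_compat; [apply Rmult_le_pos; lra|lra|now apply Rmult_le_compat_r|exact B2].
  - unfold N; rewrite Nat.mul_comm, pow_mult. apply pow_incr; split; [lra|].
    apply Rle_trans with ((3 / 2) ^ nu).
    + apply Rle_trans with (180 * INR nu + 180); [|apply pow32_ge; lia].
      assert (h : (k <= 15 * nu + 15)%nat) by lia. apply le_INR in h.
      rewrite plus_INR, mult_INR in h; replace (INR 15) with 15 in h by (simpl; lra).
      fold K in h. lra.
    + rewrite pow_mult. apply pow_incr; lra. }
assert (V8 : 0 <= (8 * v) ^ N) by (apply pow_le; lra).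
assert (m3 : 0 <= m * 3 ^ mu) by (apply Rmult_le_pos; [lra|apply pow_le; lra]).
apply Rle_trans with ((5 / 4) ^ N * (8 * v) ^ N).
{ apply Rmult_le_compat_r; [exact V8|].
  apply Rle_trans with (m * 3 ^ mu * (2 * K)); [now apply Rmult_le_compat_l|exact A3]. }
apply Rle_trans with ((4 * K) ^ N * (5 ^ N * (v / (2 * K)) ^ N)).
{ right; rewrite <- !Rpow_mult_distr; f_equal; field; lra. }
rewrite (Rpow_mult_distr 5).
apply Rmult_le_compat; [apply pow_le; lra| |exact A2|].
- apply Rmult_le_pos; apply pow_le; [lra|apply Rlt_le, Rdiv_lt_0_compat; lra].
- apply Rmult_le_compat_l; [apply pow_le; lra|exact A1].
Qed.

End Estimates.

Module LargeExponents.

Import Reals Lra Lia.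
Import all_boot.
Import zify.
Local Open Scope R_scope.

Lemma INR_expn (a b : nat) : INR (expn a b) = INR a ^ b.
Proof.
elim: b => [|b IH]; first by rewrite expn0.
by rewrite expnS -tech_pow_Rmult -IH -mult_INR.
Qed.

Lemma INR_leq (a b : nat) : (a <= b)%N -> INR a <= INR b.
Proof. by move/leP; apply: le_INR. Qed.

Lemma expn_pow (a b : nat) : expn a b = Nat.pow a b.
Proof. by elim: b => // b IH; rewrite expnS IH. Qed.

Lemma mul2_bin2 (n : nat) : (2 * 'C(n, 2))%N = (n * n.-1)%N.
Proof. by rewrite -mul_bin_diag bin1. Qed.

Lemma large_exponent (k U V : nat) :
  (2600 <= k)%coq_nat -> (1 <= V)%coq_nat -> (V < U)%coq_nat ->
  (Nat.pow U k <= 2 * Nat.pow V k + 2 * k)%coq_nat ->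
  (2 * Nat.pow V k <= Nat.pow U k + 2 * k)%coq_nat -> False.
Proof.
move=> hk hV hU h1 h2.
pose nu := Nat.div k 15.
have hnu : le (15 * nu)%coq_nat k /\ lt k (15 * nu + 15)%coq_nat.
  have := Nat.div_mod_eq k 15; have := Nat.mod_upper_bound k 15; rewrite -/nu; lia.
have [mu [m4 [mV [hz [hx hc]]]]] := Estimates.approximation_parameters k nu U V hk hnu (conj hV hU) h1 h2.
have nu173 : (173 <= nu)%N by lia.
pose i := (mu * nu)%N.
(* T + I + 1 = mu (n + 1), with I = mu nu and n = 3 nu, is the least value that the zero estimate
   admits. The gain E is about T I; I is taken smaller than T because every row at U / V costs a
   power of V. *)
pose T := (2 * i + mu.-1)%N.
pose E := (2 * (i * i) - 2 * (i * mu) - mu * mu)%N.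
have le_i : (173 * mu <= i)%N by rewrite mulnC leq_mul2l nu173 orbT.
have ii : (i * (173 * mu) <= i * i)%N by rewrite leq_mul2l le_i orbT.
have mm : (173 * mu * mu <= i * mu)%N by rewrite leq_mul2r le_i orbT.
have EE : (E + 2 * (i * mu) + mu * mu)%N = (2 * (i * i))%N by rewrite /E; lia.
have c1 : (0 < 3 * nu <= k)%N by lia.
have c2 : (0 < V < U)%N by lia.
have c3 : (mu * (3 * nu).+1 <= (T + i).+1)%N by rewrite /T /i; lia.
have c4 : (i <= mu * k)%N by rewrite /i leq_mul2l; apply/orP; right; lia.
have c5 : (E + ('C(T, 2) + 'C(i, 2)) <= 'C(mu * (3 * nu), 2))%N.
  have -> : (mu * (3 * nu))%N = (3 * i)%N by rewrite /i; lia.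
  rewrite -(@leq_pmul2l 2%N) // !(mulnDr 2%N) !mul2_bin2.
  have [m em] : exists m, mu = m.+1 by exists mu.-1; lia.
  have i0 : (0 < i)%N by lia.
  rewrite /T em /=; rewrite em in EE.
  clearbody E; clear -EE i0; clearbody i; case: i EE i0 => // j EE _; nia.
have c6 : (k * (U - V) <= V)%N by apply/leP.
have c7 : (expn U k <= 3 * expn V k)%N by rewrite !expn_pow; apply/leP.
have c8 : (mu * expn 3 mu * ((2 * expn V k - expn U k) + (expn U k - 2 * expn V k)) *
    expn (8 * V) (mu * (3 * nu)) <= expn V k * expn (5 * (U - V)) (mu * (3 * nu)))%N.
  by rewrite !expn_pow; apply/leP.
have := INR_leq _ _ (Interpolation.interpolation_bound c1 c2 c3 c4 c5 c6 c7 c8).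
move=> H.
have cst (p : positive) : INR (Pos.to_nat p) = IZR (Zpos p) by rewrite INR_IZR_INZ Znat.positive_nat_Z.
have i2 : INR 2 = 2 by exact: (cst 2%positive).
have i4 : INR 4 = 4 by exact: (cst 4%positive).
have i5 : INR 5 = 5 by exact: (cst 5%positive).
have i11 : INR 11 = 11 by exact: (cst 11%positive).
have i27 : INR 27 = 27 by exact: (cst 27%positive).
apply: (Estimates.numeric_contradiction k V mu nu 'C(mu, 2) 'C(i, 2) E) => //.
- by have := lt_INR _ _ mV; rewrite !pow_INR mult_INR i4.
- by have := mul2_bin2 mu; rewrite -subn1.
- by have := mul2_bin2 i; rewrite -subn1.
- by clear -EE; clearbody E; rewrite /i in EE; lia.
move: H; rewrite -/i.
have m (a b : nat) : INR (muln a b) = INR a * INR b := mult_INR a b.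
have e3 : INR (3 * nu)%coq_nat = INR 3 * INR nu := mult_INR 3 nu.
have e4 : INR (mu * (3 * nu))%coq_nat = INR mu * INR (3 * nu)%coq_nat := mult_INR _ _.
rewrite e4 e3 !(INR_expn, m) i2 i4 i5 i11 i27.
by rewrite -subn1.
Qed.

End LargeExponents.

(** * Exponents below 2600 *)

Module MediumExponents.

Import NArith.
Import all_boot all_order all_algebra all_field.
Import zify ring.
Set Implicit Arguments. Unset Strict Implicit. Unset Printing Implicit Defensive.
Import Order.TTheory GRing.Theory.

Local Open Scope ring_scope.

Lemma mem_unity_roots (F : fieldType) (e : nat) (H : seq F) (x : F) :
  (0 < e)%N -> uniq H -> size H = e -> all (fun h => h ^+ e == 1) H -> x ^+ e = 1 -> x \in H.
Proof.
move=> e0 uH szH allH xe; apply/negPn/negP => xH.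
have sz : size ('X^e - 1 : {poly F}) = e.+1 by rewrite size_XnsubC.
have p0 : 'X^e - 1 != 0 :> {poly F} by rewrite -size_poly_eq0 sz.
have := max_poly_roots p0 (_ : all (root _) (x :: H)) _.
rewrite sz /= szH ltnn xH uH => h; suff : false by []; apply: h => //.
have rootE h : root ('X^e - 1) h = (h ^+ e == 1).
  by rewrite rootE !hornerE hornerXn subr_eq0.
by rewrite rootE xe eqxx /=; apply: sub_all allH => h; rewrite rootE.
Qed.

Lemma power_mem_roots (p k e : nat) (H : seq 'F_p) (x : 'F_p) :
  prime p -> p = (e * k).+1 -> (0 < e)%N -> (0 < k)%N -> uniq H -> size H = e -> all (fun h => h ^+ e == 1) H ->
  x ^+ k \in 0 :: H.
Proof.
move=> pp ep e0 k0 uH szH allH; rewrite inE.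
case: (eqVneq x 0) => [->|x0]; first by rewrite expr0n eqn0Ngt k0 eqxx.
rewrite (mem_unity_roots e0 uH szH allH) ?orbT // -exprM mulnC.
apply: (mulfI x0); rewrite mulr1 -exprS -ep.
by have := expf_card x; rewrite card_Fp.
Qed.

(** As e is even, -1 is an e-th root of unity, so negating both powers changes the sign of [c]: one
    test serves both equations. *)
Lemma no_solution_mod (p k e : nat) (H : seq 'F_p) (c : 'F_p) :
  prime p -> p = (e * k).+1 -> (0 < e)%N -> (0 < k)%N -> ~~ odd e ->
  uniq H -> size H = e -> all (fun h => h ^+ e == 1) H ->
  {in 0 :: H &, forall x y, y *+ 2 + c != x} ->
  forall x y : 'F_p, x ^+ k <> y ^+ k *+ 2 + c /\ y ^+ k *+ 2 <> x ^+ k + c.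
Proof.
move=> pp ep e0 k0 ev uH szH allH noH x y.
have mem z : z ^+ k \in 0 :: H by apply: power_mem_roots ep _ _ _ _ _.
have opp z : z \in 0 :: H -> - z \in 0 :: H.
  rewrite !inE oppr_eq0 => /orP[->//|zH]; rewrite (mem_unity_roots e0 uH szH allH) ?orbT //.
  by rewrite exprNn -signr_odd (negPf ev) mul1r; have /allP/(_ _ zH)/eqP := allH.
split=> E.
  by have := noH _ _ (mem x) (mem y); rewrite E eqxx.
have := noH _ _ (opp _ (mem x)) (opp _ (mem y)).
by rewrite mulNrn E opprD -addrA addNr addr0 eqxx.
Qed.

Local Close Scope ring_scope.

Definition residue_powers (l h : N) : nat -> N -> seq N :=
  fix go n x := if n is n'.+1 then x :: go n' (N.modulo (N.mul x h) l) else [::].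

Definition small_primes : seq N := Eval vm_compute in
  [seq N.of_nat d | d <- iota 0 320 & prime d].

(** Trial division. Running out of primes gives [false], so only numbers below 317^2 are ever
    certified. *)
Fixpoint no_small_factor (l : N) (ds : seq N) : bool :=
  if ds is d :: ds' then
    if N.ltb l (N.mul d d) then true
    else if N.eqb (N.modulo l d) 0 then false else no_small_factor l ds'
  else false.

Definition avoids (l c : N) (H : seq N) : bool :=
  all (fun y => ~~ has (N.eqb (N.modulo (N.add (N.double y) c) l)) H) H.

(** The conditions on [last] and [behead] say that the generator has order exactly 2j modulo l, so
    that H lists all 2j-th roots of unity and [0 :: H] contains all k-th powers. *)
Definition obstruction_check (k : N) (e : N * N) (cs : seq N) : bool :=
  let l := N.succ (N.mul (N.double e.1) k) in
  let H := residue_powers l e.2 (N.to_nat (N.double e.1)) 1 in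
  [&& N.ltb 0 e.1, N.ltb 0 k, no_small_factor l small_primes,
      N.eqb (N.modulo (N.mul (last 1%num H) e.2) l) 1,
      all (fun x => ~~ N.eqb x 1) (behead H) &
      all (fun c => avoids l c (0%num :: H)) cs].

Fixpoint obstruction_check_all (k : N) (es : seq (N * N)) : bool :=
  if es is e :: es' then
    obstruction_check k e [:: k; N.double k] && obstruction_check_all (N.add k 2) es'
  else true.

(* Entry number [i] is a pair [(j, h)] for the exponent [k = 13 + 2 i]: the modulus is the
   prime [2 j k + 1] and [h] generates its subgroup of order [2 j]. *)
Definition obstructions : seq (N * N) := [::
  (2,23); (2,11); (3,47); (5,7); (51,95); (3,43); (2,10); (2,33); (16,170); (5,95); (3,93);
  (3,15); (2,44); (2,28); (10,99); (2,80); (2,19); (7,249); (2,14); (4,31); (67,17); (3,32);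
  (2,107); (6,91); (3,84); (3,52); (4,43); (2,82); (2,60); (6,98); (2,138); (5,182); (3,22);
  (2,114); (3,233); (3,140); (8,63); (2,136); (15,881); (3,41); (2,104); (3,110); (2,115); (2,63);
  (3,211); (3,253); (2,29); (3,178); (5,79); (8,189); (7,261); (2,48); (4,14); (4,156); (3,282);
  (3,321); (3,73); (2,208); (4,231); (3,380); (6,285); (2,52); (3,175); (2,118); (4,31); (3,261);
  (5,430); (3,338); (4,362); (3,385); (2,35); (6,160); (5,179); (11,428); (3,143); (2,149);
  (2,106); (7,190); (2,26); (6,849); (3,141); (2,135); (2,96); (4,342); (3,258); (2,353); (4,511);
  (3,34); (2,87); (6,113); (2,317); (3,421); (9,447); (2,215); (4,355); (6,110); (2,295); (2,246);
  (7,59); (5,325); (2,333); (3,347); (3,96); (2,151); (3,348); (6,626); (4,464); (12,543);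
  (6,671); (5,305); (3,391); (2,97); (3,644); (4,305); (3,705); (3,340); (3,252); (3,39); (2,161);
  (9,862); (2,45); (2,374); (3,682); (5,280); (3,536); (3,640); (2,103); (2,249); (4,246);
  (3,265); (2,530); (6,290); (2,354); (2,214); (6,848); (3,398); (4,686); (3,42); (6,351);
  (3,372); (3,509); (2,243); (3,194); (4,58); (5,953); (2,495); (3,673); (2,597); (2,546);
  (3,835); (3,489); (4,159); (13,542); (2,113); (6,442); (6,15); (2,51); (4,99); (4,885); (3,648);
  (3,809); (3,206); (5,1175); (4,60); (4,66); (2,668); (2,366); (3,450); (5,2022); (5,653);
  (7,3215); (3,469); (2,620); (15,240); (26,620); (2,497); (12,464); (3,286); (4,456); (4,544);
  (2,432); (3,709); (7,287); (6,273); (3,805); (6,287); (3,883); (2,88); (12,948); (3,1063);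
  (5,97); (3,465); (3,1104); (2,610); (4,22); (2,127); (2,166); (4,753); (2,316); (3,217);
  (6,1333); (14,1195); (2,220); (7,584); (5,790); (2,92); (3,51); (2,390); (4,1338); (4,76);
  (2,410); (2,59); (9,889); (5,372); (3,186); (3,904); (3,545); (2,724); (4,799); (3,1328);
  (3,1266); (3,447); (18,53); (4,1010); (3,329); (6,829); (2,61); (3,414); (2,137); (4,409);
  (10,670); (2,218); (7,179); (4,19); (3,699); (2,598); (4,977); (2,589); (6,288); (4,1643);
  (2,259); (3,55); (7,1112); (2,412); (5,636); (3,240); (5,106); (2,992); (4,514); (3,974);
  (2,244); (7,1508); (2,164); (4,104); (16,604); (6,63); (4,107); (3,537); (12,647); (3,1316);
  (6,611); (2,419); (4,1008); (6,1601); (9,94); (3,853); (3,843); (5,905); (7,762); (3,58);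
  (2,1083); (2,790); (3,1425); (2,1021); (6,1008); (7,1299); (3,556); (2,982); (6,1528); (5,3421);
  (2,600); (13,4827); (2,688); (5,24); (4,1797); (2,108); (2,153); (7,846); (2,633); (3,1163);
  (3,1436); (2,69); (2,285); (4,192); (3,1400); (6,141); (3,336); (3,423); (2,398); (4,1431);
  (5,1020); (3,475); (4,95); (2,915); (3,1189); (3,695); (9,527); (5,4003); (6,23); (5,538);
  (7,245); (4,1284); (2,357); (2,611); (3,1893); (6,205); (5,1085); (7,876); (6,385); (3,63);
  (3,1170); (2,472); (3,1136); (4,1539); (3,889); (7,2061); (7,1697); (3,823); (2,550); (3,1821);
  (2,859); (3,798); (4,979); (5,2527); (4,78); (3,2018); (2,656); (2,640); (6,1723); (5,761);
  (3,1605); (9,1816); (2,167); (2,603); (9,1569); (3,113); (3,621); (3,299); (2,416); (4,1340);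
  (13,44); (2,1202); (4,395); (6,941); (3,628); (3,238); (4,1011); (2,878); (2,54); (4,2014);
  (5,458); (4,779); (3,67); (2,1222); (3,116); (15,2256); (5,1456); (3,506); (7,419); (3,792);
  (3,1057); (9,325); (8,2338); (2,281); (3,1113); (6,2855); (2,501); (3,180); (5,1409); (9,3088);
  (3,1361); (3,787); (2,727); (6,73); (8,1650); (6,1399); (6,478); (3,718); (7,1309); (4,475);
  (3,1526); (2,282); (3,1746); (11,2602); (5,288); (7,1479); (2,234); (2,839); (4,91); (5,837);
  (2,1598); (4,187); (3,2417); (4,645); (4,736); (5,1003); (2,1212); (7,1136); (5,1051); (3,1137);
  (3,2338); (3,2104); (3,954); (6,536); (6,3003); (2,1105); (4,1784); (2,1344); (4,78); (3,312);
  (2,1471); (7,31); (4,596); (11,3113); (3,125); (3,1498); (2,1453); (2,1003); (6,2879); (3,452);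
  (5,1732); (4,149); (8,228); (2,596); (9,929); (2,548); (2,852); (3,1283); (2,943); (3,480);
  (7,357); (2,364); (4,976); (4,2324); (3,1043); (2,85); (3,1534); (3,2589); (2,1027); (16,726);
  (3,2703); (4,11); (3,930); (2,1309); (3,877); (7,152); (2,1279); (2,1609); (4,146); (5,1991);
  (2,851); (4,348); (3,2014); (5,130); (3,854); (3,1465); (4,715); (3,1111); (2,742); (5,2407);
  (6,703); (2,376); (3,201); (4,86); (8,257); (2,1305); (3,1573); (8,2105); (2,502); (3,1351);
  (3,1855); (3,578); (4,955); (2,835); (5,315); (7,157); (5,3045); (3,429); (15,866); (9,171);
  (5,328); (6,2568); (2,481); (4,1654); (3,78); (2,1230); (2,723); (3,1716); (5,456); (3,666);
  (3,1554); (3,745); (8,2827); (16,482); (5,1969); (2,1059); (3,208); (3,79); (4,1074); (6,1312);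
  (2,733); (3,137); (4,3658); (2,1761); (3,2317); (6,3740); (3,2021); (4,290); (6,782); (6,74);
  (5,5171); (7,5288); (2,2082); (7,2668); (3,770); (2,561); (2,721); (4,3053); (5,52); (3,1085);
  (15,205); (3,213); (5,4152); (7,7667); (6,2439); (5,876); (4,2072); (2,608); (2,66); (3,2333);
  (2,1904); (3,2980); (7,743); (2,505); (3,1519); (3,570); (2,952); (5,1214); (6,954); (11,634);
  (3,943); (3,2919); (3,1481); (7,4203); (4,591); (2,2213); (4,2159); (3,2156); (2,1474); (4,413);
  (6,4409); (5,195); (2,1260); (6,309); (5,143); (8,1814); (3,1467); (3,220); (2,2129); (3,1857);
  (11,2285); (2,152); (4,2883); (2,2044); (3,383); (16,3171); (3,1382); (4,1847); (6,4299);
  (3,524); (3,303); (7,3076); (9,979); (4,2117); (6,5154); (2,897); (6,4001); (4,872); (12,3986);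
  (6,3522); (3,2881); (6,2556); (2,1481); (7,98); (3,1839); (2,1868); (6,2264); (3,3427);
  (7,2604); (4,3007); (6,258); (2,493); (12,3562); (2,719); (4,1673); (7,1196); (3,149); (2,1613);
  (4,475); (8,2527); (2,1194); (3,395); (8,3714); (2,359); (4,1273); (2,223); (5,416); (9,307);
  (5,2423); (3,607); (13,1826); (2,1363); (7,3929); (7,2848); (5,4087); (7,2655); (3,2454);
  (3,2095); (2,858); (4,3532); (3,2976); (2,101); (10,1741); (5,3807); (3,2275); (3,2270);
  (9,6145); (3,918); (4,41); (5,698); (3,1760); (6,6963); (2,2446); (2,1969); (10,1261); (8,3705);
  (6,3807); (4,499); (2,369); (3,1466); (3,1367); (2,827); (5,1390); (9,9688); (3,3760); (6,3596);
  (3,322); (2,1804); (5,3344); (6,1982); (2,2630); (3,90); (7,1579); (6,1366); (4,1488); (3,2766);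
  (2,1739); (7,688); (6,2667); (8,1461); (2,429); (9,6569); (8,127); (2,630); (3,3093); (3,1097);
  (3,91); (4,2241); (2,74); (5,1394); (6,886); (2,1115); (3,241); (10,8822); (3,569); (5,2823);
  (3,1267); (8,2568); (2,2478); (6,3254); (2,2017); (2,1437); (4,4336); (9,4143); (5,4155);
  (3,1962); (3,2148); (3,1036); (4,3161); (3,4188); (2,310); (6,5350); (2,1046); (4,925);
  (3,2977); (2,1193); (2,385); (3,2824); (2,2416); (9,10132); (3,1206); (2,2378); (2,806);
  (7,419); (3,795); (5,4385); (6,954); (12,6454); (4,2339); (3,2414); (2,796); (2,1242); (4,1782);
  (5,1967); (4,1201); (3,1268); (2,754); (2,1042); (12,2299); (8,389); (3,4373); (4,2867);
  (3,1462); (4,1933); (3,4228); (5,193); (5,3021); (3,3848); (5,1442); (8,1057); (7,540);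
  (2,1317); (7,6887); (6,2970); (3,1095); (5,6117); (4,411); (2,1801); (2,2652); (3,1082);
  (2,2832); (3,3389); (3,4380); (12,3156); (3,3011); (7,1951); (2,247); (5,2977); (7,2040);
  (3,4122); (2,865); (4,1443); (8,3645); (5,4940); (4,1480); (2,2447); (5,325); (3,2844);
  (2,2007); (4,773); (3,3139); (2,1121); (2,1451); (4,2583); (8,2521); (6,3637); (3,984);
  (2,1523); (2,1033); (4,999); (3,734); (2,2184); (3,608); (2,1963); (6,8325); (12,1279);
  (3,3491); (4,316); (4,1532); (3,3269); (2,1879); (6,3987); (2,2092); (2,1302); (4,2521);
  (3,4427); (2,825); (3,4597); (5,778); (4,1636); (3,2914); (6,3052); (2,2977); (4,684); (9,592);
  (3,2769); (4,1321); (9,2967); (4,452); (3,3032); (6,7318); (3,603); (24,3545); (14,7327);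
  (5,2033); (3,4751); (2,2727); (3,2537); (7,1669); (3,3336); (7,3816); (3,4232); (8,603);
  (2,2828); (3,458); (2,752); (2,658); (4,4188); (5,1439); (8,4313); (3,3732); (2,1721); (2,2150);
  (6,1388); (5,5708); (2,2217); (3,4282); (5,1339); (4,2063); (21,3554); (3,4594); (2,995);
  (4,2041); (6,754); (5,2908); (10,766); (8,2443); (2,1596); (6,397); (3,176); (8,4127); (4,75);
  (2,998); (5,748); (10,1152); (5,1711); (7,1197); (7,8220); (2,263); (6,7811); (3,445); (5,4911);
  (2,932); (4,3443); (11,3785); (3,1330); (22,2707); (5,1770); (2,1796); (4,227); (2,2480);
  (3,5081); (4,692); (9,9004); (3,1186); (6,8540); (9,2753); (2,188); (4,3289); (3,4287);
  (3,1894); (3,985); (2,304); (5,4698); (3,3654); (6,1815); (3,4501); (3,1256); (5,2070);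
  (5,3301); (6,8259); (3,3874); (5,2822); (6,5408); (6,3119); (2,1999); (3,3368); (2,3572);
  (2,2502); (3,2880); (2,2211); (3,1100); (3,479); (5,1044); (5,502); (3,4397); (5,1829);
  (2,2717); (4,459); (3,4359); (2,2909); (12,904); (2,2061); (4,3230); (3,1692); (3,4307);
  (3,1739); (3,4378); (20,5723); (10,614); (3,2356); (3,106); (7,9734); (10,1695); (20,6726);
  (7,9085); (6,8275); (5,5440); (2,1652); (4,3847); (3,5567); (3,1077); (4,4810); (2,3409);
  (3,4198); (3,1500); (2,2867); (2,2931); (6,3146); (5,5254); (2,3743); (4,2566); (2,3270);
  (4,3269); (18,1364); (5,4869); (2,2038); (3,2932); (11,319); (3,3402); (7,2745); (3,387);
  (2,2292); (6,3623); (3,5518); (5,3375); (3,3980); (9,14091); (2,2953); (3,754); (6,4344);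
  (2,3199); (4,360); (2,812); (6,416); (10,11825); (8,2272); (2,3378); (9,12020); (11,5355);
  (3,188); (3,3379); (2,2037); (6,3778); (15,3821); (2,1759); (6,4206); (4,182); (2,320);
  (3,3741); (3,680); (2,3346); (3,3226); (10,6530); (3,4534); (2,2950); (4,5697); (2,679);
  (4,3074); (6,1754); (3,766); (3,5226); (22,519); (5,1329); (3,1811); (12,2180); (5,3707);
  (3,3164); (4,1175); (6,6931); (2,370); (6,8824); (2,2732); (6,578); (15,8635); (2,3060); (2,90);
  (3,5696); (2,1733); (4,4054); (7,7771); (3,111); (12,7340); (6,1390); (5,3138); (5,530);
  (4,2275); (9,13881); (7,5133); (9,1755); (23,5288); (2,3745); (3,3423); (2,287); (5,2180);
  (3,5770); (3,4229); (2,643); (4,329); (15,14623); (2,531); (3,2513); (5,7301); (2,1371);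
  (3,5034); (8,6771); (3,3395); (9,11611); (11,3289); (3,6218); (6,2965); (8,1953); (2,3449);
  (6,7979); (5,6929); (3,3775); (6,3760); (2,2190); (6,2964); (4,1473); (6,2029); (2,1786);
  (3,5355); (5,3870); (5,1725); (3,5586); (2,4020); (3,3034); (4,2294); (14,4040); (3,2419);
  (6,10494); (3,1392); (5,4083); (6,822); (2,2195); (2,131); (7,3516); (2,2318); (3,2939);
  (3,5521); (9,18373); (2,4123); (12,2843); (3,5718); (3,3842); (4,922); (2,3876); (2,3963);
  (6,1626); (2,4048); (4,5225); (3,1348); (11,2045); (4,6103); (3,4617); (2,3320); (4,2979);
  (10,5149); (3,1895); (3,304); (3,5867); (3,1738); (5,2624); (4,5172); (3,5725); (2,297);
  (4,559); (2,94); (3,200); (6,442); (2,1791); (4,2757); (10,9790); (3,3143); (2,2851); (6,6459);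
  (5,2224); (5,97); (10,413); (2,762); (2,3080); (7,1372); (5,4344); (4,1429); (16,2873);
  (11,2777); (4,183); (9,3042); (5,4203); (2,1658); (4,5667); (2,4467); (6,629); (3,4759);
  (8,5163); (3,2742); (10,5703); (5,4447); (3,3225); (6,5935); (5,915); (2,1986); (4,3788);
  (3,2676); (2,3732); (3,3149); (3,2151); (2,2203); (4,274); (2,2514); (2,303); (7,9699);
  (14,1687); (3,118); (10,942); (2,3300); (4,2550); (7,8455); (6,7499); (3,2879); (4,6666);
  (3,657); (2,888); (18,7749); (2,482); (5,3313); (3,542); (5,870); (5,7010); (3,4212); (2,2638);
  (2,3641); (4,2169); (9,756); (5,14919); (3,1014); (3,2776); (2,1852); (3,5149); (2,4658);
  (2,2301); (3,5172); (2,830); (9,10798); (7,7940); (2,1510); (5,8246); (6,2855); (11,4069);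
  (6,1845); (3,5850); (9,4692); (6,4484); (6,567); (2,1977); (4,7317); (3,4631); (6,9183);
  (3,4471); (7,1210); (8,849); (5,3218); (6,9970); (3,3316); (2,3237); (3,551); (2,3832);
  (4,4171); (4,1346); (3,525); (2,139); (3,4174); (2,1338); (8,9966); (6,2991); (3,3836);
  (3,4296); (4,4698); (6,8915); (2,2709); (6,615); (2,356); (5,762); (10,11230); (8,3654);
  (2,1195); (3,3299); (6,8170); (4,3805); (6,5275); (3,1908); (2,1304); (9,1778); (3,5030);
  (3,6689); (6,5171); (5,2462); (4,3148); (3,7135); (8,6800); (2,1000); (7,11058); (9,19986);
  (3,7383); (7,9431); (2,141); (2,2543); (4,7221); (3,764); (2,2798); (4,410); (3,2657); (4,3928);
  (6,9686); (5,3251); (3,5360); (7,3815); (2,3271); (4,8955); (10,213); (2,4602); (2,4630);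
  (7,2926); (6,3668); (2,2388); (4,921); (8,733); (4,5959); (3,963); (2,1758); (2,1313); (4,7846);
  (5,1090); (5,1020); (3,5128); (2,1500); (5,986); (4,3582); (3,4548); (3,540); (3,3371);
  (9,1314); (11,2136); (9,2942); (2,1236); (3,2965); (10,5064); (6,4493); (3,3237); (3,7496);
  (2,1020); (5,3385); (6,4274); (11,4566); (2,3058); (3,5061); (9,13192); (2,4517); (9,10814);
  (3,3635); (5,2885); (3,5931); (6,8987)]%num.

Lemma obstructions_ok : obstruction_check_all 13 obstructions.
Proof. by vm_compute. Qed.

Local Open Scope ring_scope.

Lemma no_small_factorP (l : N) (ds : seq N) :
  sorted (fun a b => N.to_nat a < N.to_nat b)%N ds -> no_small_factor l ds ->
  (exists2 d, d \in map N.to_nat ds & N.to_nat l < d * d)%N /\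
  forall q, (q * q <= N.to_nat l)%N -> (q %| N.to_nat l)%N -> q \notin map N.to_nat ds.
Proof.
elim: ds => //= d ds IH path_ds.
case: N.ltb_spec => [lt_d _|_].
  have lt_d' : (N.to_nat l < N.to_nat d * N.to_nat d)%N by lia.
  split; first by exists (N.to_nat d); rewrite ?mem_head.
  move=> q le_q _; rewrite inE negb_or; apply/andP.
  have lt_qd : (q < N.to_nat d)%N.
    by rewrite ltnNge; apply/negP => h; have := leq_mul h h; lia.
  split; first by rewrite neq_ltn lt_qd.
  apply/negP => /mapP[d' d'ds eq_q].
  have tr : transitive (fun a b => N.to_nat a < N.to_nat b)%N by move=> a b c; apply: ltn_trans.
  by move: path_ds; rewrite (path_sortedE tr) => /andP[/allP/(_ _ d'ds) h _]; lia.
case: N.eqb_spec => // nz h; have [[d' d'ds lt_d'] IH2] := IH (path_sorted path_ds) h.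
split; first by exists d' => //; rewrite inE d'ds orbT.
move=> q le_q dv_q; rewrite inE negb_or IH2 // andbT; apply/eqP => eq_q.
apply: nz; move: dv_q; rewrite eq_q => /dvdnP[m em].
have el : l = N.mul (N.of_nat m) d by lia.
by rewrite el; apply: N.Div0.mod_mul.
Qed.

Lemma no_small_factor_prime (l : N) : (1 < N.to_nat l)%N ->
  no_small_factor l small_primes -> prime (N.to_nat l).
Proof.
move=> l1 /no_small_factorP[]; first by vm_compute.
have sp : map N.to_nat small_primes = [seq d <- iota 0 320 | prime d] by vm_compute.
rewrite sp => -[d]; rewrite mem_filter mem_iota => /and3P[_ _ lt_d] lt_l noq.
apply/negPn/negP => /primePns[|[q [pq le_q dv_q]]]; first by rewrite ltnNge l1.
have := noq q; rewrite mulnn le_q dv_q mem_filter mem_iota pq /= => /(_ isT isT)/negP; apply.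
have : (q < d)%N by rewrite ltnNge; apply/negP => h; have := leq_mul h h; lia.
by move/ltn_trans; apply.
Qed.

Section Soundness.
Variable l : N.
Let p := N.to_nat l.
Hypothesis pr_p : prime p.

Definition residue (n : N) : 'F_p := (N.to_nat n)%:R.

Lemma residue_mod (n : N) : residue (N.modulo n l) = residue n.
Proof.
have e : n = N.add (N.mul l (N.div n l)) (N.modulo n l) by apply: N.div_mod'.
rewrite [in RHS]e /residue N2Nat.inj_add N2Nat.inj_mul.
rewrite [RHS]natrD natrM.
have -> : (N.to_nat l)%:R = 0 :> 'F_p by apply: pchar_Fp_0.
by rewrite mul0r add0r.
Qed.

Lemma residue_inj (a b : N) : N.lt a l -> N.lt b l -> residue a = residue b -> a = b.
Proof.
move=> la lb /(congr1 (@nat_of_ord _)); rewrite /residue !val_Fp_nat //.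
by rewrite !modn_small; rewrite ?/p; lia.
Qed.

Lemma residue_powersE (h x : N) (n : nat) :
  map residue (residue_powers l h n x) = [seq residue x * residue h ^+ i | i <- iota 0 n].
Proof.
elim: n x => //= n IH x; rewrite expr0 mulr1 IH residue_mod; congr (_ :: _).
rewrite -[1%N]add1n iotaDl -map_comp; apply: eq_map => i /=.
by rewrite /residue N2Nat.inj_mul natrM -mulrA -exprS.
Qed.

Lemma residue_powers_lt (h x y : N) (n : nat) :
  N.lt x l -> y \in residue_powers l h n x -> N.lt y l.
Proof.
elim: n x => //= n IH x lx; rewrite inE => /orP[/eqP->//|]; apply: IH.
by apply: N.mod_lt; lia.
Qed.

End Soundness.

Lemma obstruction_check_sound (k : N) (e : N * N) (cs : seq N) (c : N) (x y : nat) :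
  obstruction_check k e cs -> c \in cs ->
  (x ^ N.to_nat k <> 2 * y ^ N.to_nat k + N.to_nat c)%N /\
  (2 * y ^ N.to_nat k <> x ^ N.to_nat k + N.to_nat c)%N.
Proof.
rewrite /obstruction_check; set l := N.succ _; set n := N.to_nat (N.double _).
set H := residue_powers _ _ _ _ => /and5P[j0 k0 nsf lastH /andP[noH1 av]] cs_c.
move/N.ltb_lt: j0 => j0; move/N.ltb_lt: k0 => k0.
pose p := N.to_nat l.
have ep : p = (n * N.to_nat k).+1 by rewrite /p /l /n; lia.
have n1 : (1 < n)%N by rewrite /n; lia.
have pr : prime p.
  apply: no_small_factor_prime nsf; rewrite -/p ep ltnS muln_gt0; apply/andP; split; lia.
have HE := residue_powersE pr e.2 1 n; rewrite -/H in HE.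
have l1 : N.lt 1 l by rewrite /l; lia.
pose g := residue l e.2.
have res1 : residue l 1 = 1 by [].
have HE' : map (residue l) H = [seq g ^+ i | i <- iota 0 n].
  by rewrite HE; apply: eq_map => i; rewrite res1 mul1r.
have szH : size H = n by rewrite -(size_map (residue l)) HE' size_map size_iota.
have ltH y0 : y0 \in H -> N.lt y0 l by apply: residue_powers_lt.
have gn : g ^+ n = 1.
  have : residue l (N.modulo (N.mul (last 1%num H) e.2) l) = residue l 1.
    by move/N.eqb_eq: lastH => ->.
  rewrite residue_mod // {1}/residue N2Nat.inj_mul natrM -/(residue l e.2) -/g.
  rewrite -/(residue l (last 1%num H)) -last_map -/p.
  rewrite HE' -[residue l 1]/(1 : 'F_p).
  have -> : last (1 : 'F_p) [seq g ^+ i | i <- iota 0 n] = g ^+ n.-1.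
    case: (n) n1 => // m _; rewrite -[m.+1]addn1 iotaD map_cat last_cat /=.
    by rewrite addn1.
  by rewrite -exprSr prednK // ltnW.
have g0 : g != 0 by apply/eqP => g0; move: gn; rewrite g0 expr0n eqn0Ngt (ltnW n1) => /eqP; rewrite eq_sym oner_eq0.
have gi i : (0 < i < n)%N -> g ^+ i != 1.
  move=> /andP[i0 ltin]; apply/eqP => gi1.
  have szi : (i < size H)%N by rewrite szH.
  have nthH : residue l (nth 0%num H i) = g ^+ i.
    by rewrite -(nth_map _ 0) // HE' (nth_map 0%N) ?size_iota // nth_iota.
  have inB : nth 0%num H i \in behead H.
    case: (H) szi i0 => // h0 H'; case: (i) => // i' szi _ /=.
    by apply: mem_nth.
  move/allP: noH1 => /(_ _ inB)/negP; apply; apply/N.eqb_eq.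
  by apply: (residue_inj pr (ltH _ (mem_nth _ szi)) l1); rewrite nthH gi1.
pose H' := map (residue l) H.
have uH : uniq H'.
  rewrite /H' HE' map_inj_in_uniq ?iota_uniq // => i i'.
  rewrite !mem_iota /= !add0n.
  wlog le_i : i i' / (i <= i')%N => [hw li li' e0|li li' e0].
    case: (leqP i i') => [h|/ltnW h]; first exact: hw.
    by apply/esym/hw.
  move: le_i; rewrite leq_eqVlt => /orP[/eqP//|lt_i].
  have := gi (i' - i)%N; rewrite subn_gt0 lt_i (leq_ltn_trans (leq_subr _ _) li') => /(_ isT).
  rewrite (_ : g ^+ (i' - i) = 1) ?eqxx //.
  apply: (mulfI (expf_neq0 i g0)); rewrite -exprD subnKC; last exact: ltnW.
  by rewrite mulr1.
have szH' : size H' = n by rewrite size_map.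
have allH : all (fun h => h ^+ n == 1) H'.
  by rewrite /H' HE'; apply/allP => h /mapP[i _ ->]; rewrite exprAC gn expr1n.
have av' : {in 0 :: H' &, forall x y : 'F_p, y *+ 2 + residue l c != x}.
  have rep z : z \in 0 :: H' -> exists2 w, w \in 0%num :: H & residue l w = z.
    rewrite inE => /orP[/eqP->|/mapP[w wH ->]]; first by exists 0%num; rewrite ?mem_head.
    by exists w; rewrite // inE wH orbT.
  move=> z1 z2 /rep[w1 w1H <-] /rep[w2 w2H <-].
  move/allP: av => /(_ _ cs_c)/allP/(_ _ w2H)/hasPn/(_ _ w1H)/N.eqb_spec ne.
  apply/eqP => E; apply: ne; apply: (residue_inj pr).
  - by apply: N.mod_lt; lia.
  - by move: w1H; rewrite inE => /orP[/eqP->|/ltH //]; lia.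
  have en : N.to_nat (N.add (N.double w2) c) = (N.to_nat w2 * 2 + N.to_nat c)%N by lia.
  by rewrite residue_mod // -E /residue en natrD natrM mulr_natr.
have ev : ~~ odd n by rewrite /n N2Nat.inj_double; lia.
have k0' : (0 < N.to_nat k)%N by lia.
have [h1 h2] := no_solution_mod pr ep (ltnW n1) k0' ev uH szH' allH av' x%:R y%:R.
split=> E; [apply: h1 | apply: h2].
  by rewrite -!natrX E natrD natrM mulr_natl.
by rewrite -!natrX -mulr_natl -natrM E natrD.
Qed.

Lemma obstruction_check_all_nth (es : seq (N * N)) (k : N) (i : nat) :
  obstruction_check_all k es -> (i < size es)%N ->
  obstruction_check (N.add k (N.of_nat (2 * i))) (nth (0, 0)%num es i)
    [:: N.add k (N.of_nat (2 * i)); N.double (N.add k (N.of_nat (2 * i)))].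
Proof.
elim: es k i => //= e es IH k [|i] /andP[h1 h2] lti; first by rewrite N.add_0_r.
have := IH _ i h2 lti.
by rewrite (_ : N.add (N.add k 2) (N.of_nat (2 * i)) = N.add k (N.of_nat (2 * i.+1))) //; lia.
Qed.

Lemma medium_exponent (k c x y : nat) : odd k -> (5 <= k < 2600)%N ->
  c = k \/ c = (2 * k)%N ->
  ~~ ((k, c) \in [:: (5, 10); (7, 7); (7, 14); (9, 18); (11, 22)])%N ->
  (x ^ k <> 2 * y ^ k + c)%N /\ (2 * y ^ k <> x ^ k + c)%N.
Proof.
move=> odd_k /andP[k5 lt_k] ec ne.
have [k13|k13] := leqP 13 k.
  pose i := ((k - 13)./2)%N.
  have ek : k = (13 + 2 * i)%N by rewrite /i; lia.
  have szo : size obstructions = 1294%N by vm_compute.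
  have := obstruction_check_all_nth obstructions_ok (_ : (i < size obstructions)%N).
  rewrite szo => /(_ _); set kk := N.add _ _ => h.
  have ekk : N.to_nat kk = k by rewrite /kk; lia.
  have hc : N.of_nat c \in [:: kk; N.double kk].
    by rewrite !inE; apply/orP; case: ec => ->; [left|right]; apply/eqP; rewrite /kk ek; lia.
  have := obstruction_check_sound x y (h _) hc.
  by rewrite ekk Nat2N.id; apply; lia.
have small (kk : N) (e : N * N) (cc : N) : obstruction_check kk e [:: cc] ->
    N.to_nat kk = k -> N.to_nat cc = c ->
    (x ^ k <> 2 * y ^ k + c)%N /\ (2 * y ^ k <> x ^ k + c)%N.
  by move=> h <- <-; apply: (obstruction_check_sound x y h); rewrite mem_head.
have : (k \in [:: 5; 7; 9; 11])%N by rewrite !inE; lia.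
rewrite !inE => /or4P[]/eqP ek; subst k; case: ec => ec; subst c => //.
(* For k < 13 the remaining pairs have c = k and the modulus 2k + 1, namely 11, 19 and 23. *)
- by apply: (small 5%num (1, 10)%num 5%num).
- by apply: (small 9%num (1, 18)%num 9%num).
- by apply: (small 11%num (1, 22)%num 11%num).
Qed.

End MediumExponents.

(** * Units of the orders generated by a root of 2 *)

Module RadicalUnits.

Import all_boot all_order all_fingroup all_algebra all_field.
Import zify ring.
Set Implicit Arguments. Unset Strict Implicit. Unset Printing Implicit Defensive.
Import Order.TTheory GRing.Theory Num.Theory.
Import Pdiv.Ring Pdiv.RingMonic.
Local Open Scope ring_scope.

(** * The order Z[theta] and its conjugates *)

Section RadicalOrder.
Variable k : nat.
Hypotheses (k_gt0 : (0 < k)%N) (k_odd : odd k).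

Definition radical_poly : {poly int} := 'X^k - 2%:P.

(** An element of Z[theta] is represented by any integer polynomial, and equality in Z[theta] is
    equality of the values of [red]. *)
Definition red (a : {poly int}) : {poly int} := rmodp a radical_poly.

Lemma radical_poly_monic : radical_poly \is monic.
Proof. exact: monicXnsubC. Qed.

Lemma size_radical_poly : size radical_poly = k.+1.
Proof. exact: size_XnsubC. Qed.

Lemma size_red a : (size (red a) <= k)%N.
Proof.
by rewrite -ltnS -size_radical_poly ltn_rmodp monic_neq0 ?radical_poly_monic.
Qed.

Lemma red_eq a : a = rdivp a radical_poly * radical_poly + red a.
Proof. exact: rdivp_eq radical_poly_monic _. Qed.

Section Eval.
Variables (R : comNzRingType) (t : R).
Hypothesis t_root : t ^+ k = 2.

Definition evalz (a : {poly int}) : R := (map_poly intr a).[t].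

Lemma evalzM a b : evalz (a * b) = evalz a * evalz b.
Proof. by rewrite /evalz rmorphM hornerM. Qed.
Lemma evalzD a b : evalz (a + b) = evalz a + evalz b.
Proof. by rewrite /evalz rmorphD hornerD. Qed.
Lemma evalz1 : evalz 1 = 1.
Proof. by rewrite /evalz rmorph1 hornerC. Qed.
Lemma evalzX_exp a n : evalz (a ^+ n) = evalz a ^+ n.
Proof. by rewrite /evalz rmorphXn horner_exp. Qed.
Lemma evalz_prod (I : Type) (r : seq I) (F : I -> {poly int}) :
  evalz (\prod_(i <- r) F i) = \prod_(i <- r) evalz (F i).
Proof. by rewrite /evalz rmorph_prod horner_prod. Qed.

Lemma evalz_radical : evalz radical_poly = 0.
Proof.
by rewrite /evalz rmorphB /= map_polyXn map_polyC /= hornerD hornerN hornerXn hornerC t_root subrr.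
Qed.

Lemma evalz_red a : evalz (red a) = evalz a.
Proof. by rewrite [in RHS](red_eq a) evalzD evalzM evalz_radical mulr0 add0r. Qed.

Lemma evalz_congr a b : red a = red b -> evalz a = evalz b.
Proof. by move=> e; rewrite -evalz_red e evalz_red. Qed.

Lemma evalzE (a : {poly int}) : (size a <= k)%N -> evalz a = \sum_(j < k) (a`_j)%:~R * t ^+ j.
Proof.
move=> sz; rewrite /evalz (horner_coef_wide _ (leq_trans (size_poly _ _) sz)).
by apply: eq_bigr => j _; rewrite coef_map.
Qed.

End Eval.

Variable zeta : algC.
Hypothesis zeta_prim : k.-primitive_root zeta.

Definition theta : algC := k.-root 2.
Definition conj_root (s : nat) : algC := theta * zeta ^+ s.
Definition ev (s : nat) (a : {poly int}) : algC := evalz (conj_root s) a.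

Lemma theta_exp : theta ^+ k = 2.
Proof. exact: rootCK. Qed.

Lemma theta_gt0 : 0 < theta.
Proof. by rewrite rootC_gt0. Qed.

Lemma theta_gt1 : 1 < theta.
Proof.
rewrite -(ltr_pXn2r k_gt0) ?nnegrE ?ler01 ?(ltW theta_gt0) // theta_exp expr1n.
by rewrite (_ : 2 = 1 + 1 :> algC) // ltrDl ltr01.
Qed.

Lemma zeta_exp : zeta ^+ k = 1. Proof. exact: prim_expr_order. Qed.

Lemma conj_root_exp s : conj_root s ^+ k = 2.
Proof. by rewrite exprMn theta_exp -exprM mulnC exprM zeta_exp expr1n mulr1. Qed.

Lemma norm_zeta : `|zeta| = 1.
Proof.
apply/eqP; rewrite -(@pexpr_eq1 _ _ k) // -normrX zeta_exp normr1 //.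
Qed.

Lemma ev_red s a : ev s (red a) = ev s a.
Proof. exact: evalz_red (conj_root_exp s) a. Qed.

Lemma sum_zeta m : ~~ (k %| m)%N -> \sum_(s < k) zeta ^+ (s * m) = 0.
Proof.
move=> ndv; have z1 : zeta ^+ m - 1 != 0 by rewrite subr_eq0 -(prim_order_dvd zeta_prim).
apply: (mulfI z1); rewrite mulr0.
have := subrX1 (zeta ^+ m) k; rewrite -exprM mulnC exprM zeta_exp expr1n subrr => e.
rewrite [RHS]e; congr (_ * _); apply: eq_bigr => s _.
by rewrite mulnC exprM.
Qed.

(** An inverse discrete Fourier transform over the conjugates. It yields both that the conjugates
    determine an element and that they bound its coefficients. *)
Lemma coef_ev (a : {poly int}) (j : nat) : (size a <= k)%N -> (j < k)%N ->
  \sum_(s < k) zeta ^+ (s * (k - j)) * ev s a = k%:R * (a`_j)%:~R * theta ^+ j.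
Proof.
move=> sz ltj.
under eq_bigr => s _ do rewrite /ev evalzE // mulr_sumr.
rewrite exchange_big /= (bigD1 (Ordinal ltj)) //= [X in _ + X]big1 ?addr0; last first.
  move=> i ne.
  under eq_bigr => s _ do rewrite /conj_root exprMn mulrCA [zeta ^+ _ * _]mulrCA -exprM -exprD -mulnDr.
  rewrite -mulr_sumr -mulr_sumr sum_zeta ?mulr0 //.
  apply/negP => /dvdnP[q e]; have := ltn_ord i; have ne' : (i : nat) != j by [].
  move: e ne'; case: q => [|[|q]]; lia.
under eq_bigr => s _ do rewrite /conj_root exprMn mulrCA [zeta ^+ _ * _]mulrCA -exprM -exprD -mulnDr subnK ?(ltnW ltj) // mulnC exprM zeta_exp expr1n mulr1.
by rewrite sumr_const card_ord -mulrA mulr_natl.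
Qed.

Lemma coef_le (a : {poly int}) (B : algC) (j : nat) : (size a <= k)%N ->
  (forall s, (s < k)%N -> `|ev s a| <= B) -> (j < k)%N -> `|(a`_j)%:~R| * theta ^+ j <= B.
Proof.
move=> sz leB ltj.
have k0 : (0 : algC) < k%:R by rewrite ltr0n.
rewrite -(ler_pM2l k0) mulrA -[X in X * _ * _]ger0_norm ?(ltW k0) //.
rewrite -[theta ^+ j]ger0_norm ?exprn_ge0 ?(ltW theta_gt0) // -!normrM -coef_ev //.
apply: le_trans (ler_norm_sum _ _ _) _.
rewrite mulr_natl -[X in _ *+ X]card_ord -sumr_const; apply: ler_sum => s _.
by rewrite normrM normrX norm_zeta expr1n mul1r leB.
Qed.

Lemma ev_inj (a b : {poly int}) : (size a <= k)%N -> (size b <= k)%N ->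
  (forall s, (s < k)%N -> ev s a = ev s b) -> a = b.
Proof.
move=> sa sb e; apply/polyP => j; case: (ltnP j k) => [ltj|lej]; last first.
  by rewrite !nth_default // (leq_trans _ lej).
have E : \sum_(s < k) zeta ^+ (s * (k - j)) * ev s a = \sum_(s < k) zeta ^+ (s * (k - j)) * ev s b.
  by apply: eq_bigr => s _; rewrite e.
have := coef_ev sb ltj; rewrite -E coef_ev //.
have k0 : (k%:R : algC) != 0 by rewrite pnatr_eq0 -lt0n.
have t0 : theta ^+ j != 0 by rewrite expf_neq0 ?gt_eqF ?theta_gt0.
by move/(mulIf t0)/(mulfI k0)/eqP; rewrite eqr_int => /eqP.
Qed.

Lemma red_congr a b : (forall s, (s < k)%N -> ev s a = ev s b) -> red a = red b.
Proof. by move=> e; apply: ev_inj; rewrite ?size_red // => s /e; rewrite !ev_red. Qed.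

(* A unit all of whose conjugates are k-th roots of unity has vanishing higher
   coefficients, because [theta ^ j > 1]. *)
Lemma red_torsion (a : {poly int}) : red (a ^+ k) = 1 -> red a = 1.
Proof.
move=> ak.
have ek s : ev s a ^+ k = 1.
  by rewrite -evalzX_exp -[evalz _ _]/(ev s (a ^+ k)) -ev_red ak /ev evalz1.
have n1 s : `|ev s a| = 1.
  by apply/eqP; rewrite -(@pexpr_eq1 _ _ k) // -normrX ek normr1.
have cj j : (0 < j < k)%N -> (red a)`_j = 0.
  move=> /andP[j0 ltj].
  have h : `|((red a)`_j)%:~R| * theta ^+ j <= 1.
    by apply: coef_le ltj; rewrite ?size_red // => s hs; rewrite ev_red n1.
  apply/eqP/negPn/negP => ne.
  have : (1 : algC) < `|((red a)`_j)%:~R| * theta ^+ j.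
    apply: lt_le_trans (_ : theta ^+ j <= _); first by rewrite exprn_egt1 ?theta_gt1 // -lt0n.
    rewrite ler_peMl ?exprn_ge0 ?(ltW theta_gt0) // -intr_norm -[1]/(1%:~R) ler_int.
    by rewrite -gtz0_ge1 normr_gt0.
  by move/lt_le_trans => /(_ _ h); rewrite ltxx.
have ea : red a = ((red a)`_0)%:P.
  apply/polyP => -[|j]; rewrite coefC //=.
  case: (ltnP j.+1 k) => [ltj|lej]; first by rewrite cj.
  by rewrite nth_default // (leq_trans (size_red a)).
rewrite ea; congr (_%:P); move: ((red a)`_0) ea => c ea.
have ck : c ^+ k = 1.
  have := ek 0%N; rewrite -ev_red ea /ev /evalz map_polyC hornerC /=.
  by rewrite -rmorphXn /= => /eqP; rewrite -[1]/(1%:~R) eqr_int => /eqP.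
have c0 : 0 <= c by rewrite leNgt -(exprn_odd_lt0 c k_odd) ck.
by apply/eqP; rewrite -(pexpr_eq1 k_gt0 c0) ck.
Qed.

Lemma theta_prod (p q : int) :
  \prod_(s < k) (p%:~R - q%:~R * conj_root s) = p%:~R ^+ k - 2 * q%:~R ^+ k.
Proof.
case: (eqVneq q 0) => [->|q0].
  under eq_bigr => s _ do rewrite mul0r subr0.
  by rewrite prodr_const card_ord expr0n eqn0Ngt k_gt0 mulr0 subr0.
have t0 : theta != 0 by rewrite gt_eqF ?theta_gt0.
have q0' : (q%:~R : algC) != 0 by rewrite intr_eq0.
pose x : algC := p%:~R / (q%:~R * theta).
have e (s : 'I_k) : p%:~R - q%:~R * conj_root s = q%:~R * theta * (x - zeta ^+ s).
  by rewrite /x /conj_root mulrBr mulrA mulrCA divff ?mulr1 ?mulrA // mulf_neq0.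
under eq_bigr => s _ do rewrite e.
rewrite big_split prodr_const card_ord /=.
have -> : \prod_(s < k) (x - zeta ^+ s) = x ^+ k - 1.
  have := congr1 (fun f => f.[x]) (factor_Xn_sub_1 zeta_prim).
  rewrite big_mkord horner_prod !hornerE => <-.
  by apply: eq_bigr => s _; rewrite hornerXsubC.
rewrite mulrBr mulr1 -exprMn /x mulrC divfK ?mulf_neq0 // exprMn theta_exp.
by rewrite mulrC [2 * _]mulrC.
Qed.

(** The determinant of multiplication by [a] in the basis of powers of theta, hence an integer by
    construction. *)
Definition normz (a : {poly int}) : int :=
  \det (\matrix_(i < k, j < k) (red (a * 'X^i))`_j).

Lemma ev_X s n : ev s ('X^n) = conj_root s ^+ n.
Proof. by rewrite /ev /evalz map_polyXn hornerXn. Qed.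

(** The Vandermonde matrix of the conjugates of theta diagonalizes multiplication by [a]. *)
Lemma normzE a : (normz a)%:~R = \prod_(s < k) ev s a.
Proof.
pose V : 'M[algC]_k := \matrix_(i, s) conj_root s ^+ i.
have V0 : \det V != 0.
  have -> : V = Vandermonde k (\row_s conj_root s) by apply/matrixP => i s; rewrite !mxE.
  rewrite det_Vandermonde; apply/prodf_neq0 => i _; apply/prodf_neq0 => j ij.
  have t0 : theta != 0 by rewrite gt_eqF ?theta_gt0.
  rewrite !mxE subr_eq0 /conj_root (inj_eq (mulfI t0)).
  by rewrite (eq_prim_root_expr zeta_prim) !modn_small // gtn_eqF.
pose D : 'rV[algC]_k := \row_s ev s a.
pose M := map_mx intr (\matrix_(i < k, j < k) (red (a * 'X^i))`_j) : 'M[algC]_k.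
have MV : M *m V = V *m diag_mx D.
  apply/matrixP => i s; rewrite !mxE [RHS](bigD1 s) //= !mxE eqxx mulr1n [X in _ = _ + X]big1 ?addr0; last first.
    by move=> j ne; rewrite !mxE (negPf ne) mulr0n mulr0.
  under eq_bigr => j _ do rewrite !mxE.
  by rewrite -evalzE ?size_red // -[evalz _ _]/(ev s _) ev_red /ev evalzM -!/(ev s _) ev_X mulrC.
have := congr1 determinant MV; rewrite !det_mulmx det_diag mulrC => /(mulfI V0).
rewrite det_map_mx -/(normz a) => ->.
by apply: eq_bigr => s _; rewrite mxE.
Qed.

Lemma normzM a b : normz (a * b) = normz a * normz b.
Proof.
apply/eqP; rewrite -(eqr_int algC) rmorphM /= !normzE -big_split /=; apply/eqP.
by apply: eq_bigr => s _; rewrite /ev evalzM.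
Qed.

Lemma normz_red a b : red a = red b -> normz a = normz b.
Proof.
move=> e; apply/eqP; rewrite -(eqr_int algC) !normzE; apply/eqP; apply: eq_bigr => s _.
by rewrite -ev_red e ev_red.
Qed.

Lemma normz_linear (p q : int) : normz (p%:P - q%:P * 'X) = p ^+ k - 2 * q ^+ k.
Proof.
apply/eqP; rewrite -(eqr_int algC) normzE rmorphB rmorphM /= !rmorphXn /= -theta_prod; apply/eqP.
apply: eq_bigr => s _.
by rewrite /ev /evalz rmorphB rmorphM /= !map_polyC map_polyX !hornerE.
Qed.

(* The first row of the inverse of the multiplication matrix is the inverse. *)
Lemma unit_inverse a : `|normz a| = 1 -> exists b, red (a * b) = 1.
Proof.
move=> n1; pose M := \matrix_(i < k, j < k) (red (a * 'X^i))`_j.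
pose i0 : 'I_k := Ordinal k_gt0.
have dd : \det M * \det M = 1 by rewrite -[\det M]/(normz a) -expr2 -real_normK ?num_real // n1 expr1n.
have MA : (\det M *: \adj M) *m M = 1%:M.
  by rewrite -scalemxAl mul_adj_mx scale_scalar_mx dd.
pose b : {poly int} := \sum_(i < k) ((\det M *: \adj M) i0 i) *: 'X^i.
exists b; apply: ev_inj; rewrite ?size_red ?size_poly1 // => s lts.
rewrite ev_red /b.
have -> : a * b = \sum_(i < k) ((\det M *: \adj M) i0 i) *: (a * 'X^i).
  by rewrite /b mulr_sumr; apply: eq_bigr => i _; rewrite scalerAr.
have evS (c : 'I_k -> int) (f : 'I_k -> {poly int}) : ev s (\sum_i c i *: f i) = \sum_i (c i)%:~R * ev s (f i).
  rewrite /ev /evalz rmorph_sum horner_sum; apply: eq_bigr => i _.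
  by rewrite -mul_polyC rmorphM /= map_polyC hornerM hornerC.
rewrite evS.
have evr (i : 'I_k) : ev s (a * 'X^i) = \sum_(j < k) (M i j)%:~R * conj_root s ^+ j.
  rewrite -ev_red /ev evalzE ?size_red //; apply: eq_bigr => j _.
  by rewrite mxE.
under eq_bigr => i _ do rewrite evr mulr_sumr.
rewrite exchange_big /=.
transitivity (\sum_(j < k) (((\det M *: \adj M) *m M) i0 j)%:~R * conj_root s ^+ j).
  apply: eq_bigr => j _; rewrite mxE rmorph_sum mulr_suml; apply: eq_bigr => i _.
  by rewrite rmorphM mulrA.
rewrite MA (bigD1 i0) //= mxE eqxx expr0 mulr1 big1 ?addr0 ?/ev ?evalz1 // => j ne.
by rewrite mxE eq_sym (negPf ne) mul0r.
Qed.

End RadicalOrder.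

Lemma pigeon_fiber (A B : finType) (f : A -> B) (n : nat) :
  (n * #|B| < #|A|)%N -> exists y, (n < #|[set x | f x == y]|)%N.
Proof.
move=> lt; case: (boolP [exists y, n < #|[set x | f x == y]|]%N) => [/existsP//|].
rewrite negb_exists => /forallP h.
move: lt; rewrite ltnNge => /negP[].
rewrite -sum1_card (partition_big f xpredT) //= mulnC -sum_nat_const.
by apply: leq_sum => y _; rewrite sum1dep_card leqNgt h.
Qed.

Lemma pigeon_pair (A C : finType) (g : A -> C) (S : {set A}) :
  (#|C| < #|S|)%N -> exists x y, [/\ x \in S, y \in S, x != y & g x = g y].
Proof.
move=> lt; have : ~~ dinjectiveb g S.
  apply/negP => /dinjectiveP inj.
  by move: lt; rewrite -(card_in_imset inj) ltnNge max_card.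
case/dinjectivePn => x xS [y]; rewrite inE => /andP[ne yS] e.
by exists x, y; split; rewrite // eq_sym.
Qed.

Lemma red_mulr (k : nat) (a b c : {poly int}) : (0 < k)%N ->
  red k a = red k b -> red k (a * c) = red k (b * c).
Proof.
move=> k0 e; have ea := red_eq k0 a; have eb := red_eq k0 b.
rewrite /red in e *; have mon := radical_poly_monic k0.
have -> : a * c = (rdivp a (radical_poly k) - rdivp b (radical_poly k)) * c * radical_poly k + b * c.
  by rewrite {1}ea {2}eb /red e; ring.
by rewrite Pdiv.RingMonic.rmodpD // Pdiv.RingMonic.rmodp_mull // add0r.
Qed.

(** * Multiplicative dependence of units *)

Section UnitRelation.
Variables (k r : nat) (zeta : algC).
Hypotheses (ek : k = (2 * r).+1) (zeta_prim : k.-primitive_root zeta).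

Let k_gt0 : (0 < k)%N. Proof. by rewrite ek. Qed.
Let k_odd : odd k. Proof. by rewrite ek /= oddM. Qed.

Local Notation ev := (ev k zeta).

(** Places s and k - s are complex conjugate. This leaves r complex pairs and the real place s =
    0. *)
Lemma norm_ev_sym (s : nat) (a : {poly int}) : (0 < s < k)%N -> `|ev (k - s) a| = `|ev s a|.
Proof.
move=> /andP[s0 sk].
suff -> : ev (k - s) a = (ev s a)^* by rewrite norm_conjC.
have cr : conj_root k zeta (k - s) = (conj_root k zeta s)^*.
  rewrite /conj_root rmorphM /= (CrealP (ger0_real (ltW (theta_gt0 k_gt0)))); congr (_ * _).
  have z0 : zeta ^+ s != 0.
    by rewrite -normr_eq0 normrX (norm_zeta k_gt0 zeta_prim) expr1n oner_eq0.
  apply: (mulfI z0); rewrite -exprD subnKC ?(ltnW sk) // (prim_expr_order zeta_prim).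
  by rewrite -normCK normrX (norm_zeta k_gt0 zeta_prim) !expr1n.
rewrite /ev /evalz cr -horner_map /= -map_poly_comp; congr (_.[_]).
by apply: eq_map_poly => z /=; rewrite rmorph_int.
Qed.

Variables (u v : 'I_r.+1 -> {poly int}).
Hypothesis uv : forall i, red k (u i * v i) = 1.

Let evuv s i : ev s (u i) * ev s (v i) = 1.
Proof.
rewrite -evalzM -[evalz _ _]/(ev s _) -(ev_red k_gt0 zeta_prim) uv.
by rewrite /ev evalz1.
Qed.

Definition bounding_exponent : nat :=
  \max_(i < r.+1) \max_(s < k)
    maxn (Num.bound `|ev s (u i)|) (Num.bound `|ev s (v i)|).
Local Notation q := bounding_exponent.

Lemma le_bounding_exponent (i : 'I_r.+1) (s : 'I_k) :
  `|ev s (u i)| <= 2 ^+ q /\ `|ev s (v i)| <= 2 ^+ q.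
Proof.
have h : (maxn (Num.bound `|ev s (u i)|) (Num.bound `|ev s (v i)|) <= q)%N.
  apply: leq_trans (leq_bigmax i).
  by apply: (leq_bigmax (F := fun s : 'I_k => maxn (Num.bound `|ev s (u i)|) (Num.bound `|ev s (v i)|)) s).
have bnd (x : algC) : 0 <= x -> (Num.bound x <= q)%N -> x <= 2 ^+ q.
  move=> x0 le_q; apply: le_trans (ltW (archi_boundP x0)) _.
  rewrite -natrX ler_nat; apply: leq_trans le_q _; exact/ltnW/ltn_expl.
by move: h; rewrite geq_max => /andP[h1 h2]; split; apply: bnd.
Qed.

Variable M : nat.
Local Notation exps := {ffun 'I_r.+1 -> 'I_M}.
Definition upow (b : exps) : {poly int} := \prod_i u i ^+ b i.
Definition vpow (b : exps) : {poly int} := \prod_i v i ^+ b i.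
Let Q : nat := (q * M * r.+1)%N.

Lemma norm_pow_le (w : 'I_r.+1 -> {poly int}) (b : exps) (s : nat) :
  (forall i, `|ev s (w i)| <= 2 ^+ q) -> `|ev s (\prod_i w i ^+ b i)| <= 2 ^+ Q.
Proof.
move=> le_w; rewrite /ev evalz_prod normr_prod.
apply: le_trans (_ : \prod_(i < r.+1) 2 ^+ (q * M) <= _); last first.
  by rewrite prodr_const card_ord -exprM.
apply: ler_prod => i _; rewrite normr_ge0 evalzX_exp normrX exprM.
apply: le_trans (lerXn2r _ _ _ (le_w i)) _; rewrite ?nnegrE ?exprn_ge0 //.
by rewrite ler_weXn2l ?exprn_ege1 ?ler1n // ltnW.
Qed.

Lemma ev_uvpow (s : nat) (b : exps) : ev s (upow b) * ev s (vpow b) = 1.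
Proof.
rewrite /upow /vpow /ev !evalz_prod -big_split big1 //= => i _.
by rewrite !evalzX_exp -exprMn -/(ev s _) -/(ev s _) evuv expr1n.
Qed.

(** The integer part of the binary logarithm of the absolute value, shifted by Q to make it
    nonnegative. *)
Definition bucket (s : nat) (b : exps) : nat :=
  find (fun e => `|ev s (upow b)| * 2 ^+ Q < 2 ^+ e.+1) (iota 0 (2 * Q).+1).

Lemma bucketP (s : 'I_k) (b : exps) :
  [/\ (bucket s b < (2 * Q).+1)%N, `|ev s (upow b)| * 2 ^+ Q < 2 ^+ (bucket s b).+1 &
      2 ^+ bucket s b <= `|ev s (upow b)| * 2 ^+ Q].
Proof.
pose x : algC := `|ev s (upow b)| * 2 ^+ Q.
have Q0 : (0 : algC) <= 2 ^+ Q by rewrite exprn_ge0.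
have le1 := norm_pow_le b (fun i => (le_bounding_exponent i s).1).
have le2 := norm_pow_le b (fun i => (le_bounding_exponent i s).2).
have xr : x \is Num.real by rewrite ger0_real // mulr_ge0.
have tr n : (2 : algC) ^+ n \is Num.real by rewrite ger0_real // exprn_ge0.
have hs : has (fun e => x < 2 ^+ e.+1) (iota 0 (2 * Q).+1).
  apply/hasP; exists (2 * Q)%N; first by rewrite mem_iota /= add0n.
  apply: le_lt_trans (_ : 2 ^+ (2 * Q) < _).
    by rewrite mul2n -addnn exprD ler_wpM2r.
  by rewrite ltr_eXn2l // ltr1n.
have ltb : (bucket s b < (2 * Q).+1)%N by have := hs; rewrite has_find size_iota.
split=> //.
  by have := nth_find 0%N hs; rewrite nth_iota // add0n.
case eb : (bucket s b) => [|e].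
  have := congr1 Num.norm (ev_uvpow s b); rewrite normrM normr1 => e1.
  by rewrite expr0 -[X in X <= _]e1 ler_wpM2l.
have lte : (e < bucket s b)%N by rewrite eb.
have := before_find 0%N lte; rewrite nth_iota; last by apply: ltn_trans lte ltb.
by rewrite add0n => /negbT; rewrite -real_leNgt.
Qed.

Lemma bucket_ratio (s : 'I_k) (b b' : exps) :
  bucket s b = bucket s b' -> `|ev s (upow b * vpow b')| <= 2.
Proof.
move=> e; have [_ h1 _] := bucketP s b; have [_ _ h2] := bucketP s b'.
rewrite e exprS in h1.
have Q0 : (0 : algC) < 2 ^+ Q by rewrite exprn_gt0.
have h3 : `|ev s (upow b)| <= 2 * `|ev s (upow b')|.
  rewrite -(ler_pM2r Q0) -mulrA; apply: le_trans (ltW h1) _.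
  by rewrite ler_pM2l.
rewrite /ev evalzM normrM -/(ev s _) -/(ev s _).
apply: le_trans (ler_wpM2r (normr_ge0 _) h3) _.
by rewrite -mulrA -normrM ev_uvpow normr1 mulr1.
Qed.

(** Conjugation extends the bound 2 to all s <> 0, for the ratio and for its inverse. The norm being
    1 in absolute value, the real place is the product of the 2r other conjugates of the inverse,
    hence at most 2^(2r). *)
Lemma ratio_le (b b' : exps) :
  (forall s : nat, (0 < s <= r)%N -> bucket s b = bucket s b') ->
  forall s, (s < k)%N -> `|ev s (upow b * vpow b')| <= (4 ^ r)%:R.
Proof.
move=> eb; pose w := upow b * vpow b'; pose w' := upow b' * vpow b.
have half s (c c' : exps) : (forall s : nat, (0 < s <= r)%N -> bucket s c = bucket s c') ->
    (0 < s < k)%N -> `|ev s (upow c * vpow c')| <= 2.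
  move=> ec /andP[s0 sk]; case: (leqP s r) => [ler|ltr].
    by apply: (@bucket_ratio (Ordinal sk)); apply: ec; rewrite s0.
  have lt' : (k - s < k)%N by lia.
  rewrite -norm_ev_sym ?s0 //.
  by apply: (@bucket_ratio (Ordinal lt')); apply: ec => /=; lia.
move=> s sk; case: (posnP s) => [->|s0]; last first.
  case: (posnP r) => [r0|r0]; first by move: sk s0; rewrite ek r0; lia.
  apply: le_trans (half s b b' eb _) _; first by rewrite s0.
  by rewrite ler_nat; apply: leq_trans (leq_pexp2l _ r0).
have ww' t : ev t w * ev t w' = 1.
  have evM a c : ev t (a * c) = ev t a * ev t c by rewrite /ev evalzM.
  by rewrite !evM mulrACA [X in _ * X]mulrC mulrACA !ev_uvpow mulr1.
have n1 : \prod_(s < k) `|ev s w| = 1.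
  have nz : normz k w * normz k w' = 1.
    apply/eqP; rewrite -(eqr_int algC) rmorphM /= !(normzE k_gt0 zeta_prim) -big_split /=.
    by rewrite big1 // => t _; apply: ww'.
  have : `|normz k w| = 1.
    have := congr1 Num.norm nz; rewrite normrM normr1 => e1.
    have u1 : `|normz k w| \is a GRing.unit by apply/unitrPr; exists `|normz k w'|.
    by case/orP: (u1) => /eqP // h; have := normr_ge0 (normz k w); rewrite h.
  by move/(congr1 (fun z : int => z%:~R : algC)); rewrite intr_norm (normzE k_gt0 zeta_prim) normr_prod.
have w0 t : `|ev t w| * `|ev t w'| = 1 by rewrite -normrM ww' normr1.
have n0 : `|ev 0 w| = \prod_(s < k | (0 < s)%N) `|ev s w'|.
  move: n1; rewrite (bigD1 (Ordinal k_gt0)) //= => n1.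
  have e2 : \prod_(s < k | s != Ordinal k_gt0) `|ev s w| * \prod_(s < k | s != Ordinal k_gt0) `|ev s w'| = 1.
    by rewrite -big_split big1 //= => t _; apply: w0.
  have -> : \prod_(s < k | (0 < s)%N) `|ev s w'| = \prod_(s < k | s != Ordinal k_gt0) `|ev s w'|.
    by apply: eq_bigl => t; rewrite -val_eqE /= lt0n.
  by have := congr1 (fun y => y * \prod_(s < k | s != Ordinal k_gt0) `|ev s w'|) n1;
    rewrite mul1r -mulrA e2 mulr1.
rewrite n0; apply: le_trans (_ : \prod_(s < k | (0 < s)%N) 2 <= _).
  apply: ler_prod => t t0; rewrite normr_ge0 /=; apply: half; last by rewrite t0 /=.
  by move=> s' hs'; rewrite eb.
rewrite prodr_const -natrX ler_nat -[4%N]/(2 ^ 2)%N -expnM leq_exp2l //.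
have -> : #|[pred s : 'I_k | (0 < s)%N]| = #|predC1 (Ordinal k_gt0)|.
  by apply: eq_card => t; rewrite !inE -val_eqE /= lt0n.
by have := cardC1 (Ordinal k_gt0); rewrite card_ord => ->; rewrite ek.
Qed.

End UnitRelation.

Lemma leq_exp2r_w (m n e : nat) : (m <= n)%N -> (m ^ e <= n ^ e)%N.
Proof. by case: e => // e le_mn; rewrite leq_exp2r. Qed.
Lemma exps_le (q m r : nat) : ((2 * (q * m.+1 * r.+1)).+1 <= (2 * q * r.+1).+1 * m.+1)%N.
Proof. nia. Qed.

Lemma shift_lt (x : int) (B : nat) : `|x| <= B%:Z -> (absz (x + B%:Z)%R < (2 * B).+1)%N.
Proof. lia. Qed.

Lemma shift_inj (x y : int) (B : nat) : `|x| <= B%:Z -> `|y| <= B%:Z ->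
  absz (x + B%:Z)%R = absz (y + B%:Z)%R -> x = y.
Proof. lia. Qed.

Lemma exps_lt (f g r m : nat) : m = (f * g ^ r).+1 -> (f * (g * m) ^ r < m ^ r.+1)%N.
Proof. by move=> e; rewrite expnMn mulnA expnS ltn_mul2r expn_gt0; apply/andP; split; rewrite e. Qed.

(** There are M^(r+1) exponent vectors, but the number of bucket vectors grows only like M^r, so for
    large M one fibre has more than F members. Their ratios to a fixed member [b0] have bounded
    coefficients, with at most F possibilities; two of them coincide. *)
Lemma unit_relation (k r : nat) (zeta : algC) (u v : 'I_r.+1 -> {poly int}) :
  k = (2 * r).+1 -> k.-primitive_root zeta -> (forall i, red k (u i * v i) = 1) ->
  exists b b' : 'I_r.+1 -> nat, (exists i, b i <> b' i) /\
    red k (\prod_i u i ^+ b i) = red k (\prod_i u i ^+ b' i).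
Proof.
move=> ek zeta_prim uv.
have k0 : (0 < k)%N by rewrite ek.
have k_odd : odd k by rewrite ek /= oddM.
pose q := bounding_exponent k zeta u v.
pose G := (2 * q * r.+1).+1.
pose B := (4 ^ r)%N.
pose F := ((2 * B).+1 ^ k)%N.
pose M := (F * G ^ r).+1.
pose Q := (q * M * r.+1)%N.
pose exps := {ffun 'I_r.+1 -> 'I_M}.
pose bk (s : nat) (b : exps) : nat := bucket k zeta u v s b.
pose beta (b : exps) : {ffun 'I_r -> 'I_(2 * Q).+1} := [ffun s : 'I_r => inord (bk s.+1 b)].
have cnt : (F * #|{ffun 'I_r -> 'I_(2 * Q).+1}| < #|{: exps}|)%N.
  rewrite !card_ffun !card_ord.
  have le_Q : ((2 * Q).+1 <= G * M)%N by exact: exps_le.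
  apply: leq_ltn_trans (_ : F * (G * M) ^ r < _)%N.
    have := leq_exp2r_w r le_Q; set a := (_ ^ r)%N; set b := (_ ^ r)%N => ab.
    by rewrite leq_mul2l ab orbT.
  exact: exps_lt.
have [y lt_F] := pigeon_fiber beta cnt.
set S := [set b | _] in lt_F.
have [b0 b0S] : exists b, b \in S by apply/set0Pn; rewrite -card_gt0; apply: leq_ltn_trans lt_F.
pose w (b : exps) := red k (upow u b * vpow v b0).
pose g (b : exps) : {ffun 'I_k -> 'I_(2 * B).+1} :=
  [ffun j : 'I_k => inord (absz ((w b)`_j + B%:Z))].
have bkS b s : b \in S -> (0 < s <= r)%N -> bk s b = bk s b0.
  move: b0S; rewrite !inE => /eqP e0 /eqP e /andP[s0 sr].
  have sr' : (s.-1 < r)%N by rewrite prednK.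
  have sk : (s < k)%N by lia.
  have := congr1 (fun f : {ffun 'I_r -> 'I_(2 * Q).+1} => val (f (Ordinal sr'))) (etrans e (esym e0)).
  have [lt1 _ _] := bucketP ek zeta_prim uv (Ordinal sk) b.
  have [lt0 _ _] := bucketP ek zeta_prim uv (Ordinal sk) b0.
  by rewrite !ffunE /= !inordK /bk /= prednK.
have wle b j : b \in S -> (j < k)%N -> `|(w b)`_j| <= B%:Z.
  move=> bS jk.
  have rl := ratio_le ek zeta_prim uv (fun s hs => bkS b s bS hs).
  have h : `|((w b)`_j)%:~R| * theta k ^+ j <= (4 ^ r)%:R :> algC.
    apply: (coef_le k0 k_odd zeta_prim _ _ jk); first exact: size_red.
    by move=> s sk; rewrite (ev_red k0 zeta_prim) rl.
  have t1 : 1 <= theta k ^+ j by rewrite exprn_ege1 // ltW // theta_gt1.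
  rewrite -(ler_int algC) intr_norm; apply: le_trans h.
  by rewrite ler_peMr.
have cardF : (#|{ffun 'I_k -> 'I_(2 * B).+1}| < #|S|)%N by rewrite card_ffun !card_ord.
have [b [b' [bS b'S ne eg]]] := pigeon_pair g cardF.
have ew : w b = w b'.
  apply/polyP => j; case: (ltnP j k) => [jk|kj]; last first.
    by rewrite !nth_default // (leq_trans _ kj) // size_red.
  have := congr1 (fun f : {ffun 'I_k -> 'I_(2 * B).+1} => val (f (Ordinal jk))) eg.
  have h1 := wle b j bS jk; have h2 := wle b' j b'S jk.
  by rewrite !ffunE /= !inordK ?shift_lt //; apply: shift_inj.
exists (fun i => val (b i)), (fun i => val (b' i)); split.
  have /existsP[i ni] : [exists i, b i != b' i].
    by apply: contraR ne => /existsPn h; apply/eqP/ffunP => i; apply/eqP/negPn/h.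
  by exists i => e; move/eqP: ni; apply; apply: val_inj.
apply: (red_congr k0 k_odd zeta_prim) => s sk.
have evM a c : ev k zeta s (a * c) = ev k zeta s a * ev k zeta s c by rewrite /ev evalzM.
have e1 : ev k zeta s (upow u b * vpow v b0) = ev k zeta s (upow u b' * vpow v b0).
  by rewrite -(ev_red k0 zeta_prim) -/(w b) ew /w (ev_red k0 zeta_prim).
have := congr1 (fun x => x * ev k zeta s (upow u b0)) e1.
by rewrite /= !evM -!mulrA ![ev k zeta s (vpow v b0) * _]mulrC (ev_uvpow ek zeta_prim uv) !mulr1.
Qed.

Lemma exists_prim_root (k : nat) : (0 < k)%N -> exists zeta : algC, k.-primitive_root zeta.
Proof. by move=> k0; have [z hz] := C_prim_root_exists k0; exists z. Qed.

(* Cancelling common factors and, when all exponents are congruent modulo [k], extracting a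
   [k]-th root with [red_torsion], leads to a relation that survives modulo [k]. *)
Lemma unit_relation_mod (k r : nat) (u v : 'I_r.+1 -> {poly int}) :
  k = (2 * r).+1 -> (1 < k)%N -> (forall i, red k (u i * v i) = 1) ->
  exists b b' : 'I_r.+1 -> nat, (exists i, b i <> b' i %[mod k]) /\
    red k (\prod_i u i ^+ b i) = red k (\prod_i u i ^+ b' i).
Proof.
move=> ek k1 uv.
have k0 : (0 < k)%N by rewrite ltnW.
have k_odd : odd k by rewrite ek /= oddM.
have [zeta zeta_prim] := exists_prim_root k0.
pose dist (b b' : 'I_r.+1 -> nat) := (\sum_i ((b i - b' i) + (b' i - b i)))%N.
have evuv s i : ev k zeta s (u i) * ev k zeta s (v i) = 1.
  by rewrite -evalzM -[evalz _ _]/(ev k zeta s _) -(ev_red k0 zeta_prim) uv /ev evalz1.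
have ev_pow s (b : 'I_r.+1 -> nat) : ev k zeta s (\prod_i u i ^+ b i) = \prod_i ev k zeta s (u i) ^+ b i.
  by rewrite /ev evalz_prod; apply: eq_bigr => i _; rewrite evalzX_exp.
have ev_pow' s (b : 'I_r.+1 -> nat) : ev k zeta s (\prod_i v i ^+ b i) = \prod_i ev k zeta s (v i) ^+ b i.
  by rewrite /ev evalz_prod; apply: eq_bigr => i _; rewrite evalzX_exp.
have evM s a c : ev k zeta s (a * c) = ev k zeta s a * ev k zeta s c by rewrite /ev evalzM.
have main n : forall b b' : 'I_r.+1 -> nat, (dist b b' <= n)%N -> (exists i, b i <> b' i) ->
    red k (\prod_i u i ^+ b i) = red k (\prod_i u i ^+ b' i) ->
    exists b b' : 'I_r.+1 -> nat, (exists i, b i <> b' i %[mod k]) /\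
      red k (\prod_i u i ^+ b i) = red k (\prod_i u i ^+ b' i).
  elim: n => [|n IH] b b' le_n [i0 ne0] e.
    by move: le_n; rewrite leqn0 sum_nat_eq0 => /forallP/(_ i0) /=; lia.
  case: (boolP [exists i, b i != b' i %[mod k]]) => [/existsP[i /eqP ni]|/existsPn cong].
    by exists b, b'; split=> //; exists i.
  have {}cong i : b i = b' i %[mod k] by apply/eqP/negPn/cong.
  pose c i := ((b i - b' i) %/ k)%N; pose c' i := ((b' i - b i) %/ k)%N.
  have dc i : (b i - b' i = c i * k)%N.
    rewrite divnK //; case: (leqP (b' i) (b i)) => h; last by rewrite (eqP (ltnW h)).
    by rewrite -eqn_mod_dvd // cong.
  have dc' i : (b' i - b i = c' i * k)%N.
    rewrite divnK //; case: (leqP (b i) (b' i)) => h; last by rewrite (eqP (ltnW h)).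
    by rewrite -eqn_mod_dvd // cong.
  have bc i : (c i * k + b' i = c' i * k + b i)%N by rewrite -dc -dc'; lia.
  pose W := \prod_i u i ^+ c i * \prod_i v i ^+ c' i.
  have evb s : \prod_i ev k zeta s (u i) ^+ b i = \prod_i ev k zeta s (u i) ^+ b' i.
    by rewrite -!ev_pow -(ev_red k0 zeta_prim) e (ev_red k0 zeta_prim).
  have u0 s i : ev k zeta s (u i) != 0.
    by apply/eqP => u0; have := evuv s i; rewrite u0 mul0r => /esym/eqP; rewrite oner_eq0.
  have Wk s : ev k zeta s (W ^+ k) = 1.
    have P0 : \prod_i ev k zeta s (u i) ^+ b' i != 0.
      by apply/prodf_neq0 => i _; rewrite expf_neq0.
    apply: (mulIf P0); rewrite mul1r -[RHS]evb.
    rewrite /ev evalzX_exp -/(ev k zeta s W) evM ev_pow ev_pow' exprMn -!prodrXl -!big_split /=.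
    apply: eq_bigr => i _; rewrite -!exprM mulrAC -exprD bc exprD -mulrA [X in _ * X]mulrC mulrA.
    by rewrite -exprMn evuv expr1n mul1r.
  have W1 : red k W = 1.
    apply: (red_torsion k0 k_odd zeta_prim).
    rewrite (red_congr k0 k_odd zeta_prim (b := 1)) => [|s _]; last by rewrite Wk /ev evalz1.
    apply: (ev_inj k0 k_odd zeta_prim); rewrite ?size_red ?size_poly1 // => s _.
    by rewrite (ev_red k0 zeta_prim).
  apply: (IH c c').
  - rewrite -ltnS; apply: leq_trans le_n; rewrite /dist (bigD1 i0) //= [X in (_ < X)%N](bigD1 i0) //=.
    rewrite -addSn leq_add //.
      have := bc i0; have := dc i0; have := dc' i0; move: ne0 k1; move: (c i0) (c' i0) (b i0) (b' i0).
      clear; move=> p q x y ne k1; nia.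
    apply: leq_sum => i _; have := dc i; have := dc' i; move: k0; move: (c i) (c' i) (b i) (b' i).
    clear; move=> p q x y k0; nia.
  - exists i0 => e0; apply: ne0; have := bc i0; rewrite e0; lia.
  apply: (red_congr k0 k_odd zeta_prim) => s _.
  have P0 : \prod_i ev k zeta s (v i) ^+ c' i != 0.
    apply/prodf_neq0 => i _; rewrite expf_neq0 //.
    by apply/eqP => v0; have := evuv s i; rewrite v0 mulr0 => /esym/eqP; rewrite oner_eq0.
  apply: (mulIf P0); rewrite -ev_pow' -!evM -/W -(ev_red k0 zeta_prim) W1 evM ev_pow ev_pow' /ev evalz1.
  rewrite -big_split big1 //= => i _.
  by rewrite -exprMn evuv expr1n.
have [b [b' [ne e]]] := unit_relation ek zeta_prim uv.
exact: (main (dist b b')).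
Qed.

(** * Power residue characters *)

Section Characters.
Variables (k m l : nat).
Hypotheses (k_prime : prime k) (l_prime : prime l) (lE : l = (m * k).+1).

(** A product of k-th power residue characters modulo the primes above l: each such prime is given
    by a root of X^k - 2 modulo l, paired with an exponent, and m = (l - 1) / k. *)
Definition character (c : seq ('F_l * nat)) (a : {poly int}) : 'F_l :=
  \prod_(te <- c) evalz te.1 a ^+ (m * te.2).

Definition on_roots (c : seq ('F_l * nat)) : bool := all (fun te => te.1 ^+ k == 2) c.

Lemma characterM c a b : character c (a * b) = character c a * character c b.
Proof. by rewrite /character -big_split; apply: eq_bigr => te _; rewrite evalzM exprMn. Qed.

Lemma character1 c : character c 1 = 1.
Proof. by rewrite /character big1 // => te _; rewrite evalz1 expr1n. Qed.

Lemma characterX c a n : character c (a ^+ n) = character c a ^+ n.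
Proof. by elim: n => [|n IH]; rewrite ?expr0 ?character1 // !exprS characterM IH. Qed.

Lemma character_prod (I : Type) (s : seq I) c (F : I -> {poly int}) :
  character c (\prod_(i <- s) F i) = \prod_(i <- s) character c (F i).
Proof. exact: (big_morph _ (characterM c) (character1 c)). Qed.

Lemma character_congr c a b : on_roots c -> red k a = red k b -> character c a = character c b.
Proof.
move=> /allP rc e; apply: eq_big_seq => te tec; congr (_ ^+ _).
exact: (evalz_congr (prime_gt0 k_prime) (eqP (rc te tec)) e).
Qed.

Lemma character_exp c a b : on_roots c -> red k (a * b) = 1 -> character c a ^+ k = 1.
Proof.
move=> /allP rc e; rewrite /character -prodrXl big1_seq // => te /= tec.
rewrite -exprM mulnAC.
have ne0 : evalz te.1 a != 0.
  apply/eqP => z; have := evalz_red (prime_gt0 k_prime) (eqP (rc te tec)) (a * b).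
  by rewrite e evalz1 evalzM z mul0r => /eqP; rewrite oner_eq0.
have h n : n = l -> evalz te.1 a ^+ n = evalz te.1 a.
  by move=> ->; have := expf_card (evalz te.1 a); rewrite card_Fp.
suff h1 : evalz te.1 a ^+ (m * k) = 1 by rewrite exprM h1 expr1n.
by apply: (mulfI ne0); rewrite mulr1 -exprS h.
Qed.

Lemma exp_congr (x : 'F_l) (n n' : nat) : x ^+ k = 1 -> n = n' %[mod k] -> x ^+ n = x ^+ n'.
Proof. by move=> xk e; rewrite -(expr_mod n xk) e expr_mod. Qed.

Lemma congr_exp (x : 'F_l) (n n' : nat) : x ^+ k = 1 -> x != 1 -> x ^+ n = x ^+ n' -> n = n' %[mod k].
Proof.
move=> xk x1 e; have [d xd dk] := prim_order_exists (prime_gt0 k_prime) xk.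
move/primeP: k_prime => [_ /(_ d dk)] /orP[/eqP d1|/eqP dk'].
  by move: (prim_expr_order xd) x1; rewrite d1 expr1 => ->; rewrite eqxx.
by apply/eqP; rewrite -dk' -(eq_prim_root_expr xd) e.
Qed.

End Characters.

Section Independence.
Variables (k r m l m' l' : nat).
Hypotheses (k_prime : prime k) (l_prime : prime l) (lE : l = (m * k).+1).
Hypotheses (l'_prime : prime l') (l'E : l' = (m' * k).+1).
Variables (eps epsv : 'I_r -> {poly int}) (dual : 'I_r -> seq ('F_l' * nat)).
Hypotheses (ek : k = (2 * r).+1) (epsP : forall i, red k (eps i * epsv i) = 1).
Hypotheses (dual_roots : forall i, on_roots k (dual i))
  (dualP : forall i j, (character m' (dual i) (eps j) == 1) = (i != j)).

(* Among [eta] and the [eps i] there is a relation that is nontrivial modulo [k]; the dual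
   characters show that [eta] occurs in it with an exponent prime to [k]. *)
Lemma character_trivial (eta etav : {poly int}) (c : seq ('F_l * nat)) :
  red k (eta * etav) = 1 -> on_roots k c -> (forall i, character m c (eps i) = 1) ->
  character m c eta = 1.
Proof.
move=> eta1 rc ceps.
pose u i := if unlift ord0 i is Some j then eps j else eta.
pose v i := if unlift ord0 i is Some j then epsv j else etav.
have uv i : red k (u i * v i) = 1 by rewrite /u /v; case: unliftP.
have [b [b' [[i ne] e]]] := unit_relation_mod ek (prime_gt1 k_prime) uv.
have rel M L (L_prime : prime L) (LE : L = (M * k).+1) (d : seq ('F_L * nat)) :
    on_roots k d -> character M d eta ^+ b ord0 * \prod_j character M d (eps j) ^+ b (lift ord0 j) =
    character M d eta ^+ b' ord0 * \prod_j character M d (eps j) ^+ b' (lift ord0 j).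
  move=> rd; have := character_congr M k_prime rd e; rewrite !character_prod !big_ord_recl.
  rewrite !characterX /u unlift_none => E.
  under eq_bigr => j _ do rewrite -[eps j]/(if Some j is Some j' then eps j' else eta) -(liftK ord0 j) -characterX.
  rewrite E; congr (_ * _); apply: eq_bigr => j _.
  by rewrite characterX liftK.
have ne0 : b ord0 <> b' ord0 %[mod k].
  move=> e0; apply: ne; case: (unliftP ord0 i) => [j ->|->] //.
  have := rel m' l' l'_prime l'E _ (dual_roots j).
  rewrite (exp_congr (character_exp k_prime l'_prime l'E (dual_roots j) eta1) e0).
  have x0 : character m' (dual j) eta ^+ b' ord0 != 0.
    rewrite expf_neq0 //; apply/eqP => z.
    have := character_exp k_prime l'_prime l'E (dual_roots j) eta1; apply/eqP; rewrite z expr0n eqn0Ngt prime_gt0 //= eq_sym oner_eq0.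
  move/(mulfI x0); rewrite (bigD1 j) //= [RHS](bigD1 j) //=.
  have triv (d : 'I_r -> nat) : \prod_(i < r | i != j) character m' (dual j) (eps i) ^+ d i = 1.
    apply: big1 => i' ni; have ji : j != i' by rewrite eq_sym.
    by have := dualP j i'; rewrite ji => /eqP ->; rewrite expr1n.
  rewrite !triv !mulr1; apply: (congr_exp k_prime); first exact: (character_exp k_prime l'_prime l'E (dual_roots j) (epsP j)).
  by rewrite dualP eqxx.
have := rel m l l_prime lE c rc.
have triv (d : 'I_r -> nat) : \prod_(i < r) character m c (eps i) ^+ d i = 1.
  by apply: big1 => i' _; rewrite ceps expr1n.
rewrite !triv !mulr1 => h.
apply/eqP/negPn/negP => ne1; apply: ne0; exact: (congr_exp k_prime (character_exp k_prime l_prime lE rc eta1) ne1 h).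
Qed.

End Independence.

End RadicalUnits.

(** * The exceptional exponents 5, 7 and 11 *)

Module ExceptionalExponents.

Import NArith.
Import all_boot all_order all_fingroup all_algebra all_field.
Import zify ring.
Import MediumExponents RadicalUnits.
Set Implicit Arguments. Unset Strict Implicit. Unset Printing Implicit Defensive.
Import Order.TTheory GRing.Theory Num.Theory.
Import Pdiv.Ring Pdiv.RingMonic.
Local Open Scope ring_scope.

(** * Computation with coefficient lists *)

Fixpoint add_coefs (s t : seq int) : seq int :=
  match s, t with
  | a :: s', b :: t' => (a + b) :: add_coefs s' t'
  | [::], _ => t
  | _, [::] => s
  end.

Definition mul_coefs (s t : seq int) : seq int :=
  foldr (fun a acc => add_coefs (map ( *%R a) t) (0 :: acc)) [::] s.

(** Replaces theta^k by 2 a single time, which fully reduces the product of two lists of length at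
    most k. *)
Definition reduce_coefs (k : nat) (s : seq int) : seq int :=
  add_coefs (take k s) (map ( *%R 2) (drop k s)).

Definition red_mul_check (k : nat) (s t b : seq int) : bool :=
  all (eq_op^~ 0) (reduce_coefs k (add_coefs (mul_coefs s t) (map -%R b))).

Lemma Poly_cons (a : int) (s : seq int) : Poly (a :: s) = Poly s * 'X + a%:P :> {poly int}.
Proof. by rewrite /= cons_poly_def. Qed.

Lemma Poly_add_coefs s t : Poly (add_coefs s t) = Poly s + Poly t :> {poly int}.
Proof.
elim: s t => [|a s IH] [|b t]; rewrite ?add0r ?addr0 //.
by rewrite [add_coefs _ _]/= !Poly_cons IH polyCD; ring.
Qed.

Lemma Poly_scale (c : int) s : Poly (map ( *%R c) s) = c%:P * Poly s :> {poly int}.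
Proof.
elim: s => [|a s IH]; first by rewrite mulr0.
by rewrite [map _ _]/= !Poly_cons IH polyCM; ring.
Qed.

Lemma Poly_opp (s : seq int) : Poly (map -%R s) = - Poly s :> {poly int}.
Proof.
elim: s => [|a s IH]; first by rewrite oppr0.
by rewrite [map _ _]/= !Poly_cons IH polyCN; ring.
Qed.

Lemma Poly_mul_coefs s t : Poly (mul_coefs s t) = Poly s * Poly t :> {poly int}.
Proof.
elim: s => [|a s IH]; first by rewrite mul0r.
rewrite [mul_coefs _ _]/= -/(mul_coefs s t) Poly_add_coefs Poly_scale !Poly_cons IH; ring.
Qed.

Lemma Poly_cat (s t : seq int) : Poly (s ++ t) = Poly s + 'X^(size s) * Poly t :> {poly int}.
Proof.
elim: s => [|a s IH]; first by rewrite add0r mul1r.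
by rewrite [_ ++ _]/= !Poly_cons IH [size _]/= exprS; ring.
Qed.

Lemma Poly_zeros s : all (eq_op^~ 0) s -> Poly s = 0 :> {poly int}.
Proof. by elim: s => // a s IH /andP[/eqP-> /IH e]; rewrite Poly_cons e mul0r add0r. Qed.

Section Reduction.
Variable k : nat.
Hypothesis k0 : (0 < k)%N.

Lemma redD a b : red k (a + b) = red k a + red k b.
Proof. by rewrite /red rmodpD // radical_poly_monic. Qed.

Lemma redB0 a b : red k (a - b) = 0 -> red k a = red k b.
Proof. by move=> e; rewrite -[a](subrK b) redD e add0r. Qed.

Lemma red_Xk a : red k ('X^k * a) = red k (2%:P * a).
Proof.
apply: redB0; rewrite -mulrBl mulrC /red rmodp_mull //; exact: radical_poly_monic.
Qed.

Lemma red_reduce s : red k (Poly (reduce_coefs k s)) = red k (Poly s).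
Proof.
rewrite Poly_add_coefs Poly_scale -{3}(cat_take_drop k s) Poly_cat !redD.
case: (leqP k (size s)) => h; first by rewrite size_takel // red_Xk.
by rewrite drop_oversize ?mulr0 // ltnW.
Qed.

Lemma red_mul_checkP s t b : red_mul_check k s t b -> red k (Poly s * Poly t) = red k (Poly b).
Proof.
move=> /Poly_zeros h; apply: redB0.
by rewrite -Poly_mul_coefs -Poly_opp -Poly_add_coefs -red_reduce h /red rmod0p.
Qed.

End Reduction.

Section NormPi.
Variables (k : nat) (pi kappa tau : {poly int}).
Hypotheses (k_prime : prime k) (k_odd : odd k).
Hypothesis pi_root : evalz (2 : 'F_k) pi = 0.

Let k0 : (0 < k)%N. Proof. exact: prime_gt0. Qed.

(** In F_k one has 2^k = 2, so theta = 2 defines a homomorphism from Z[theta] to F_k that kills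
    [pi]. Hence [pi] is not a unit, and its norm, a divisor of the prime k, is k up to sign. *)
Lemma norm_cofactor (e : {poly int}) : `|normz k (pi * e)| = k%:Z -> `|normz k e| = 1.
Proof.
have [zeta zeta_prim] := exists_prim_root k0.
rewrite (normzM k0 zeta_prim) normrM => nk.
have n1 : `|normz k pi| <> 1.
  move=> /(unit_inverse k0 k_odd zeta_prim)[b hb].
  have two : (2 : 'F_k) ^+ k = 2 by have := expf_card (2 : 'F_k); rewrite card_Fp.
  have := evalz_red k0 two (pi * b).
  by rewrite hb evalz1 evalzM pi_root mul0r => /eqP; rewrite oner_eq0.
have dk : (absz (normz k pi) %| k)%N by apply/dvdnP; exists (absz (normz k e)); lia.
move/primeP: k_prime => [_ /(_ _ dk)] /orP[/eqP d1|/eqP dk'].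
  by case: n1; lia.
have e1 : (k * absz (normz k e) = k * 1)%N.
  by have := congr1 absz nk; rewrite abszM !absz_id absz_nat dk' muln1.
by move/eqP: e1; rewrite eqn_pmul2l // => /eqP; lia.
Qed.

Lemma fermat_dvd (p : int) : (k %| p ^+ k - p)%Z.
Proof.
have h : ((p ^+ k - p)%:~R : 'F_k) = 0.
  by rewrite rmorphB rmorphXn /=; have := expf_card (p%:~R : 'F_k); rewrite card_Fp // => ->; rewrite subrr.
by rewrite (dvdz_pcharf (pchar_Fp k_prime)) h.
Qed.

End NormPi.

(** * Computable characters *)

Section ModularCharacters.
Variable l : N.

Definition mulm (a b : N) : N := N.modulo (N.mul a b) l.

Fixpoint powm_pos (a : N) (n : positive) : N :=
  match n with
  | xH => a
  | xO n' => let b := powm_pos a n' in mulm b b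
  | xI n' => let b := powm_pos a n' in mulm a (mulm b b)
  end.

Definition powm (a n : N) : N := if n is Npos n' then powm_pos a n' else 1%num.

Definition coefm (c : int) : N :=
  match c with
  | Posz n => N.of_nat n
  | Negz n => N.mul (N.of_nat n.+1) (N.pred l)
  end.

Definition evalm (s : seq int) (t : N) : N :=
  foldr (fun c acc => N.modulo (N.add (N.mul acc t) (coefm c)) l) 0%num s.

(** The argument is passed as its evaluation function, so that it may be a coefficient list or rho -
    theta with a residue rho. *)
Definition chim (m : N) (c : seq (N * N)) (f : N -> N) : N :=
  powm (foldr (fun te acc => mulm (powm (f te.1) te.2) acc) 1%num c) m.

Definition eqm (a b : N) : bool := N.eqb (N.modulo a l) (N.modulo b l).

Let p := N.to_nat l.
Hypothesis p_prime : prime p.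
Local Notation res := (residue l).

Lemma res_mul a b : res (N.mul a b) = res a * res b.
Proof. by rewrite /residue N2Nat.inj_mul natrM. Qed.

Lemma res_add a b : res (N.add a b) = res a + res b.
Proof. by rewrite /residue N2Nat.inj_add natrD. Qed.

Lemma res_mulm a b : res (mulm a b) = res a * res b.
Proof. by rewrite /mulm (residue_mod p_prime) res_mul. Qed.

Lemma res_powm a n : res (powm a n) = res a ^+ N.to_nat n.
Proof.
case: n => [|n]; first by rewrite expr0.
elim: n => [n IH|n IH|] /=; rewrite ?res_mulm ?IH -?exprD -?exprS ?expr1 //; congr (_ ^+ _); lia.
Qed.

Lemma res_pred : res (N.pred l) = -1.
Proof.
have l0 : (0 < p)%N := prime_gt0 p_prime.
apply/eqP; rewrite -subr_eq0 opprK /residue -[1]/(1%:R) -natrD.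
have -> : (N.to_nat (N.pred l) + 1)%N = p by rewrite /p in l0 *; lia.
by rewrite pchar_Fp_0.
Qed.

Lemma res_coefm c : res (coefm c) = c%:~R.
Proof.
case: c => n; rewrite /coefm; first by rewrite /residue Nat2N.id.
by rewrite res_mul res_pred mulrN1 /residue Nat2N.id NegzE mulrNz.
Qed.

Lemma res_evalm s t : res (evalm s t) = evalz (res t) (Poly s).
Proof.
elim: s => [|c s IH] /=; first by rewrite /evalz rmorph0 horner0.
rewrite (residue_mod p_prime) res_add res_mul IH res_coefm cons_poly_def evalzD evalzM.
by rewrite {3 4}/evalz map_polyX hornerX map_polyC hornerC.
Qed.

Lemma eqmE a b : eqm a b = (res a == res b).
Proof.
have l0 : (0 < p)%N := prime_gt0 p_prime.
apply/N.eqb_spec/eqP => [e|e]; first by rewrite -(residue_mod p_prime) e (residue_mod p_prime).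
have h c : N.lt (N.modulo c l) l by apply: N.mod_lt => l1; move: l0; rewrite /p l1.
by apply: (residue_inj p_prime (h a) (h b)); rewrite !(residue_mod p_prime).
Qed.

Definition lift_char (c : seq (N * N)) : seq ('F_p * nat) :=
  [seq (res te.1, N.to_nat te.2) | te <- c].

Lemma character_chim m c (a : {poly int}) (f : N -> N) :
  (forall t, res (f t) = evalz (res t) a) ->
  character (N.to_nat m) (lift_char c) a = res (chim m c f).
Proof.
move=> ef; rewrite /chim res_powm /character big_map.
elim: c => [|te c IH]; first by rewrite big_nil /= expr1n.
by rewrite big_cons IH [foldr _ _ _]/= res_mulm exprMn res_powm ef mulnC exprM.
Qed.

End ModularCharacters.

Lemma dvdz_of_norm (d n : nat) (a : int) : `|a| = n%:Z -> (d %| n)%N -> (d %| a)%Z.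
Proof. by move=> e dn; rewrite dvdzE (_ : absz a = n) //; lia. Qed.

(** * Certificates for a prime exponent *)

Section Certificate.
Variables (k r : nat) (l' m' l m : N).
Variables (units : seq (seq int * seq int)) (duals anns : seq (seq (N * N))).
Variables (pi kappa tau tau' : seq int).

Definition split_prime (q n : N) : bool :=
  [&& no_small_factor q small_primes, N.to_nat q == (N.to_nat n * k).+1 & N.ltb 0 n].

Definition at_roots (q : N) (cs : seq (seq (N * N))) : bool :=
  all (all (fun te => eqm q (powm q te.1 (N.of_nat k)) 2)) cs.

(** Character i of [duals] is nontrivial exactly on unit i, which proves the known units independent
    modulo k-th powers. The characters in [anns] are trivial on these units and therefore, by the
    rank bound, on all units. *)
Definition unit_certificate : bool :=
  [&& prime k, k == (2 * r).+1, split_prime l' m', split_prime l m, size units == r,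
      size duals == r, all (fun uv => red_mul_check k uv.1 uv.2 [:: 1]) units,
      at_roots l' duals, at_roots l anns,
      all (fun i => all (fun j =>
         eqm l' (chim l' m' (nth [::] duals i) (evalm l' (nth ([::], [::]) units j).1)) 1 == (i != j))
         (iota 0 r)) (iota 0 r) &
      all (fun c => all (fun uv => eqm l (chim l m c (evalm l uv.1)) 1) units) anns].

(* [pi] generates the prime above [k]; the other lists are the cofactors of [k], [2 - theta]
   and [theta ^ (k - 1) - 1]. *)
Definition ramified_certificate : bool :=
  [&& (k %| foldr (fun c acc => acc * 2 + c) 0 pi)%Z,
      red_mul_check k pi kappa [:: k%:Z], red_mul_check k pi tau [:: 2; -1] &
      red_mul_check k pi tau' (rcons (-1 :: nseq (k - 2) 0) 1)].

(* The entries of [anns] are characters trivial on all units; since their exponents sum to a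
   multiple of [k], their value at [x - y theta] only depends on [rho = x / y] modulo [l]. *)
Definition sieve (c0 : N) (pi' : seq int) : bool :=
  let ts := [seq (c, chim l m c (evalm l pi')) | c <- anns] in
  [&& has (fun ct => ~~ eqm l ct.2 1) ts,
      all (fun c => k %| sumn [seq N.to_nat te.2 | te <- c])%N anns,
      ~~ eqm l c0 0 &
      all (fun rho => has (fun ct =>
          ~~ eqm l (chim l m ct.1 (fun t => N.add rho (N.mul t (N.pred l)))) ct.2) ts)
        [seq N.of_nat i | i <- iota 0 (N.to_nat l)]].

Hypothesis units_ok : unit_certificate.

Let p := N.to_nat l.
Let p' := N.to_nat l'.

Lemma split_primeP q n : prime k -> split_prime q n ->
  N.to_nat q = (N.to_nat n * k).+1 /\ prime (N.to_nat q).
Proof.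
move=> k_prime /and3P[nsf /eqP e /N.ltb_lt n0]; split=> //.
apply: no_small_factor_prime => //; rewrite e ltnS muln_gt0 (prime_gt0 k_prime) andbT.
by clear -n0; lia.
Qed.

Lemma cert_k_prime : prime k. Proof. by case/and5P: units_ok. Qed.
Lemma cert_k : k = (2 * r).+1. Proof. by case/and5P: units_ok => _ /eqP. Qed.
Lemma cert_k_odd : odd k. Proof. by rewrite cert_k /= oddM. Qed.

Lemma cert_pE : p = (N.to_nat m * k).+1 /\ prime p.
Proof. by case/and5P: units_ok => kp _ _ /(split_primeP kp). Qed.

Lemma cert_p'E : p' = (N.to_nat m' * k).+1 /\ prime p'.
Proof. by case/and5P: units_ok => kp _ /(split_primeP kp). Qed.

Lemma cert_p : p = (N.to_nat m * k).+1. Proof. by case: cert_pE. Qed.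
Lemma cert_p_prime : prime p. Proof. by case: cert_pE. Qed.

Lemma on_roots_lift (q : N) cs c : prime (N.to_nat q) -> at_roots q cs -> c \in cs ->
  on_roots k (lift_char q c).
Proof.
move=> q_prime /allP h /h /allP hc.
apply/allP => _ /mapP[te tec ->] /=; have := hc te tec.
by rewrite (eqmE q_prime) (res_powm q_prime) Nat2N.id.
Qed.

Lemma cert_on_roots c : c \in anns -> on_roots k (lift_char l c).
Proof.
by case/and5P: units_ok => _ _ _ _ /and5P[_ _ _ _ /and3P[h _ _]]; apply: on_roots_lift cert_p_prime h.
Qed.

Lemma cert_trivial (eta etav : {poly int}) c :
  red k (eta * etav) = 1 -> c \in anns -> character (N.to_nat m) (lift_char l c) eta = 1.
Proof.
move=> eta1 cA; have [lE' l_prime'] := cert_p'E.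
case/and5P: units_ok => _ _ _ _ /and5P[/eqP su /eqP sd /allP uP hd /and3P[_ /allP dP /allP aP]].
pose eps (i : 'I_r) : {poly int} := Poly (nth ([::], [::]) units i).1.
pose epsv (i : 'I_r) : {poly int} := Poly (nth ([::], [::]) units i).2.
pose dual (i : 'I_r) := lift_char l' (nth [::] duals i).
have umem (i : 'I_r) : nth ([::], [::]) units i \in units by rewrite mem_nth // su.
have chi q n c' s : prime (N.to_nat q) ->
    character (N.to_nat n) (lift_char q c') (Poly s) = residue q (chim q n c' (evalm q s)).
  by move=> q_prime; apply: (character_chim q_prime) => t; apply: (res_evalm q_prime).
apply: (character_trivial (eps := eps) (epsv := epsv) (dual := dual) cert_k_prime cert_p_prime
  cert_p l_prime' lE' cert_k) eta1 _ _.
- move=> i; rewrite (red_mul_checkP (prime_gt0 cert_k_prime) (uP _ (umem i))).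
  rewrite /= cons_poly_def mul0r add0r /red rmodp_small //.
  by rewrite size_radical_poly ?prime_gt0 ?cert_k_prime // size_poly1 ltnS prime_gt0 ?cert_k_prime.
- by move=> i; apply: (on_roots_lift l_prime' hd); rewrite mem_nth // sd.
- move=> i j; rewrite /dual /eps chi //.
  have := dP i; rewrite mem_iota /= => /(_ (ltn_ord i))/allP/(_ j).
  by rewrite mem_iota /= => /(_ (ltn_ord j)); rewrite (eqmE l_prime') => /eqP.
- exact: cert_on_roots.
move=> i; rewrite /eps chi ?cert_p_prime //.
by have := allP (aP c cA) _ (umem i); rewrite (eqmE cert_p_prime) => /eqP.
Qed.

(** If l divides y but not x, then x - y theta is a nonzero constant modulo l, on which every [anns]
    character is 1, although one of them is not 1 at [pi']. If l divides both, it divides c0.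
    Otherwise y is factored out and the residue of x / y is excluded by the table. *)
Lemma sieve_sound (c0 : N) (pi' : seq int) (x y : int) (eta etav : {poly int}) :
  sieve c0 pi' -> `|x ^+ k - 2 * y ^+ k| = (N.to_nat c0)%:Z ->
  red k (x%:P - y%:P * 'X) = red k (Poly pi' * eta) -> red k (eta * etav) = 1 -> False.
Proof.
rewrite /sieve; set ts := [seq _ | _ <- _] => /and4P[/hasP[ct0 ct0ts ne1] /allP sumP nz /allP rhoP] exy ered eta1.
have k0 := prime_gt0 cert_k_prime.
set M := N.to_nat m.
have chi c : c \in anns -> character M (lift_char l c) (x%:P - y%:P * 'X) = residue l (chim l m c (evalm l pi')).
  move=> cA; have rc : on_roots k (lift_char l c) by exact: cert_on_roots.
  rewrite (character_congr M cert_k_prime rc ered) characterM (cert_trivial eta1 cA) mulr1.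
  by apply: (character_chim cert_p_prime) => t; apply: (res_evalm cert_p_prime).
have evlin (t : 'F_p) : evalz t (x%:P - y%:P * 'X) = x%:~R - y%:~R * t.
  by rewrite /evalz rmorphB rmorphM /= !map_polyC map_polyX !hornerE.
have fermat (z : 'F_p) : z != 0 -> z ^+ (M * k) = 1.
  move=> z0; apply: (mulfI z0); rewrite mulr1 -exprS -cert_p.
  by have := expf_card z; rewrite card_Fp // cert_p_prime.
have sumE c : c \in anns -> exists f, (\sum_(te <- lift_char l c) te.2 = k * f)%N.
  move=> /sumP/dvdnP[f e]; exists f; rewrite mulnC -e sumnE !big_map.
  by apply: eq_bigr.
have const (z : 'F_p) c : z != 0 -> c \in anns -> \prod_(te <- lift_char l c) z ^+ (M * te.2) = 1.
  move=> z0 /sumE[f e]; transitivity (z ^+ (M * \sum_(te <- lift_char l c) te.2)).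
    by rewrite big_distrr /= (big_morph (GRing.exp z) (exprD z) (expr0 z)).
  by rewrite e mulnA exprM fermat // expr1n.
have tsP ct : ct \in ts -> ct.1 \in anns /\ ct.2 = chim l m ct.1 (evalm l pi').
  by case/mapP => c cA ->.
case: (eqVneq (y%:~R : 'F_p) 0) => y0.
  case: (eqVneq (x%:~R : 'F_p) 0) => x0.
    move: nz; rewrite (eqmE cert_p_prime) => /negP; apply.
    have : (`|x ^+ k - 2 * y ^+ k|%:~R : 'F_p) = 0.
      have z : ((x ^+ k - 2 * y ^+ k)%:~R : 'F_p) = 0.
        by rewrite rmorphB rmorphM !rmorphXn /= x0 y0 expr0n eqn0Ngt k0 mulr0 subr0.
      by case: (ger0P (x ^+ k - 2 * y ^+ k)) => _; rewrite ?mulrNz z ?oppr0.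
    by rewrite exy => h; apply/eqP; exact: h.
  case/tsP: ct0ts => cA e; move: ne1; rewrite (eqmE cert_p_prime) e => /negP; apply.
  rewrite -(chi _ cA) /character; apply/eqP; rewrite -[RHS](const _ _ x0 cA).
  by apply: eq_bigr => te _; rewrite evlin y0 mul0r subr0.
pose rho : 'F_p := x%:~R / y%:~R.
have rho_lt : (rho < p)%N by apply: leq_trans (ltn_ord rho) _; rewrite (Fp_cast cert_p_prime).
have := rhoP (N.of_nat rho); rewrite map_f ?mem_iota // => /(_ isT)/hasP[ct /tsP[cA e]].
rewrite (eqmE cert_p_prime) e => /negP; apply; apply/eqP; rewrite -(chi _ cA).
have rr : residue l (N.of_nat rho) = rho by rewrite /residue Nat2N.id natr_Zp.
have <- : character M (lift_char l ct.1) (x%:P - y%:P * 'X) = residue l (chim l m ct.1 (fun t => N.add (N.of_nat rho) (N.mul t (N.pred l)))).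
  rewrite /chim (res_powm cert_p_prime).
  rewrite /character; under eq_bigr => te _.
    have -> : evalz te.1 (x%:P - y%:P * 'X) = y%:~R * (rho - te.1).
      by rewrite evlin mulrBr /rho mulrCA divff // mulr1.
    rewrite exprMn; over.
  rewrite big_split const //= mul1r big_map.
  elim: (ct.1) => [|te c IH]; first by rewrite big_nil /= expr1n.
  rewrite big_cons IH [foldr _ _ _]/= (res_mulm cert_p_prime) exprMn (res_powm cert_p_prime) res_add res_mul.
  by rewrite (res_pred cert_p_prime) rr mulrN1 mulnC exprM.
by [].
Qed.

Hypothesis pi_ok : ramified_certificate.

Let k0 : (0 < k)%N. Proof. exact: prime_gt0 cert_k_prime. Qed.

Lemma cert_pi_root : evalz (2 : 'F_k) (Poly pi) = 0.
Proof.
case/and4P: pi_ok => dv _ _ _; move: dv; rewrite (dvdz_pcharf (pchar_Fp cert_k_prime)) => /eqP <-.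
elim: (pi) => [|c s IH] /=; first by rewrite /evalz rmorph0 horner0.
rewrite cons_poly_def evalzD evalzM IH rmorphD rmorphM /=.
by rewrite {1 2}/evalz map_polyX hornerX map_polyC hornerC.
Qed.

Lemma linear_mod_k (x y : int) (c : int) : (k %| c)%Z -> x ^+ k - 2 * y ^+ k = c ->
  exists s, x - 2 * y = k%:Z * s.
Proof.
move=> /dvdzP[c' ->] e; have /dvdzP[s1 e1] := fermat_dvd cert_k_prime x.
have /dvdzP[s2 e2] := fermat_dvd cert_k_prime y.
by exists (c' - s1 + 2 * s2); rewrite mulrDr mulrBr; lia.
Qed.

Lemma red_eq_mulr (a b c : {poly int}) : red k a = red k b -> red k (c * a) = red k (c * b).
Proof. by move=> e; rewrite ![c * _]mulrC; apply: red_mulr. Qed.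

Lemma Poly_pi_mul (b : seq int) (t : seq int) : red_mul_check k pi t b -> red k (Poly pi * Poly t) = red k (Poly b).
Proof. exact: red_mul_checkP. Qed.

(** Fermat gives x - 2y = k s, so x - y theta = k s + y (2 - theta). Both k and 2 - theta are
    multiples of [pi], and the cofactor has norm 1 up to sign. *)
Lemma no_solution_k (x y : int) : sieve (N.of_nat k) pi -> `|x ^+ k - 2 * y ^+ k| <> k%:Z.
Proof.
move=> sv e; have [zeta zeta_prim] := exists_prim_root k0.
have dk : (k %| x ^+ k - 2 * y ^+ k)%Z by exact: dvdz_of_norm e _.
have [s es] := linear_mod_k dk erefl.
case/and4P: pi_ok => _ /Poly_pi_mul hk /Poly_pi_mul ht _.
pose eta := Poly kappa * s%:P + Poly tau * y%:P.
have ered : red k (x%:P - y%:P * 'X) = red k (Poly pi * eta).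
  rewrite /eta mulrDr !mulrA [in RHS]redD // (red_mulr _ k0 hk) (red_mulr _ k0 ht) -redD //; congr (red k _).
  have -> : x = k%:Z * s + 2 * y by lia.
  by rewrite /= !cons_poly_def mul0r add0r polyCD !polyCM; ring.
have n1 : `|normz k eta| = 1.
  apply: (norm_cofactor cert_k_prime cert_k_odd cert_pi_root).
  by rewrite -(normz_red k0 zeta_prim ered) (normz_linear k0 zeta_prim).
have [etav eta1] := unit_inverse k0 cert_k_odd zeta_prim n1.
by apply: (sieve_sound sv _ ered eta1); rewrite Nat2N.id.
Qed.

(** Here x = 2x' = theta^k x' and x' - y = k s'. Hence x - y theta is theta times (theta^(k-1) - 1)
    x' + k s', and [pi] divides this second factor. *)
Lemma no_solution_2k (x y : int) : sieve (N.of_nat (2 * k)) (0 :: pi) -> `|x ^+ k - 2 * y ^+ k| <> (2 * k)%:Z.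
Proof.
move=> sv e; have [zeta zeta_prim] := exists_prim_root k0.
have dk : (k %| x ^+ k - 2 * y ^+ k)%Z by apply: dvdz_of_norm e _; apply: dvdn_mull.
have [s es] := linear_mod_k dk erefl.
have [x' ex] : exists x', x = 2 * x'.
  have : (2 %| x ^+ k)%Z.
    have -> : x ^+ k = (x ^+ k - 2 * y ^+ k) + 2 * y ^+ k by ring.
    rewrite rpredD ?dvdz_mulr //; apply: dvdz_of_norm e _; exact: (dvdn_mulr k (dvdnn 2)).
  rewrite dvdzE abszX Euclid_dvdX // => /andP[h _].
  by have /dvdzP[z ->] : (2 %| x)%Z by []; exists z; rewrite mulrC.
have [s' es'] : exists s', x' - y = k%:Z * s'.
  have /dvdzP[z ez] : (k %| x' - y)%Z.
    rewrite -(@Gauss_dvdzr k 2) ?mulrBr -?ex ?es ?dvdz_mulr //.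
    by rewrite coprimezE /= coprimen2 cert_k_odd.
  by exists z; rewrite ez mulrC.
case/and4P: pi_ok => _ /Poly_pi_mul hk _ /Poly_pi_mul ht.
pose eta := Poly kappa * s'%:P + Poly tau' * x'%:P.
have ered : red k (x%:P - y%:P * 'X) = red k (Poly (0 :: pi) * eta).
  have -> : Poly (0 :: pi) * eta = 'X * (Poly pi * Poly kappa * s'%:P) + 'X * (Poly pi * Poly tau' * x'%:P).
    by rewrite Poly_cons /eta; ring.
  rewrite [in RHS]redD // (red_eq_mulr 'X (red_mulr _ k0 hk)) (red_eq_mulr 'X (red_mulr _ k0 ht)) -redD //.
  have -> : Poly (rcons (-1 :: nseq (k - 2) 0) 1) = 'X^(k.-1) - 1 :> {poly int}.
    have k2 : (k - 2).+1 = k.-1 by have := prime_gt1 cert_k_prime; lia.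
    have z0 : Poly (nseq (k - 2) 0) = 0 :> {poly int} by apply: Poly_zeros; rewrite all_nseq eqxx orbT.
    have p1 : Poly [:: 1] = 1 :> {poly int} by rewrite Poly_cons mul0r add0r.
    by rewrite -cats1 Poly_cat p1 mulr1 [size _]/= size_nseq k2 Poly_cons z0 mul0r add0r polyCN addrC.
  have -> : 'X * (('X^(k.-1) - 1) * x'%:P) = 'X^k * x'%:P - 'X * x'%:P.
    by rewrite -{2}(prednK k0) exprS; ring.
  rewrite addrCA [in RHS]redD // red_Xk // -redD //; congr (red k _).
  have -> : y = x' - k%:Z * s' by lia.
  by rewrite ex /= cons_poly_def mul0r add0r polyCB !polyCM; ring.
have n1 : `|normz k eta| = 1.
  apply: (norm_cofactor cert_k_prime cert_k_odd cert_pi_root).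
  have nX : normz k 'X = 2.
    have := normz_linear k0 zeta_prim 0 (-1).
    rewrite polyCN mulN1r opprK add0r => ->.
    by rewrite expr0n eqn0Ngt k0 -signr_odd cert_k_odd expr1 mulrN1 sub0r opprK.
  have : `|normz k (Poly (0 :: pi) * eta)| = (2 * k)%:Z.
    by rewrite -(normz_red k0 zeta_prim ered) (normz_linear k0 zeta_prim).
  rewrite Poly_cons addr0 mulrAC (normzM k0 zeta_prim (Poly pi * eta)) nX normrM PoszM mulrC (_ : `|2| = 2%:Z) //; exact: mulfI.
have [etav eta1] := unit_inverse k0 cert_k_odd zeta_prim n1.
by apply: (sieve_sound sv _ ered eta1); rewrite Nat2N.id.
Qed.

End Certificate.

(** * Certificates for 5, 7 and 11 *)

Definition units5 : seq (seq int * seq int) :=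
  [:: ([:: 1; -1], [:: -1; -1; -1; -1; -1]);
      ([:: 1; 1; 0; 1], [:: 1; -1; -1; 0; 1])].

Definition duals5 : seq (seq (N * N)) :=
  [:: [:: (22, 3); (25, 2)]%num;
      [:: (22, 3); (25, 1)]%num].

Definition annihilators5 : seq (seq (N * N)) :=
  [:: [:: (43, 4); (90, 1)]%num;
      [:: (130, 1); (107, 4)]%num;
      [:: (43, 1); (107, 1); (132, 3)]%num].

(** The element 1 + theta^2, of norm 1 + 2^2 = 5. *)
Definition ramified5 : seq int := [:: 1; 0; 1].

Lemma unit_certificate5 : unit_certificate 5 2 151 30 251 50 units5 duals5 annihilators5.
Proof. by vm_compute. Qed.

Lemma ramified_certificate5 : ramified_certificate 5 ramified5
  [:: 1; -2; -1; 2; 1] [:: 0; -1; 0; 1] [:: -1; 0; 1].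
Proof. by vm_compute. Qed.

Lemma sieve5_10 : sieve 5 251 50 annihilators5 10 (0 :: ramified5).
Proof. by vm_compute. Qed.

Definition units7 : seq (seq int * seq int) :=
  [:: ([:: 1; -1], [:: -1; -1; -1; -1; -1; -1; -1]);
      ([:: 1; 1; 0; 0; -1], [:: -1; 1; 1; -1; 0; 1]);
      ([:: 1; 1; 0; 1; 0; 1], [:: 1; 1; 1; 0; -1; -1])].

Definition duals7 : seq (seq (N * N)) :=
  [:: [:: (196, 1); (351, 4); (330, 1)]%num;
      [:: (196, 6); (351, 1); (330, 4)]%num;
      [:: (196, 3); (330, 2)]%num].

Definition annihilators7 : seq (seq (N * N)) :=
  [:: [:: (196, 1); (330, 2); (197, 4)]%num;
      [:: (351, 4); (400, 1); (330, 1); (620, 1)]%num;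
      [:: (400, 1); (430, 1); (197, 2); (620, 3)]%num].

(** The element theta^3 - 1, of norm 2^3 - 1 = 7. *)
Definition ramified7 : seq int := [:: -1; 0; 0; 1].

Lemma unit_certificate7 : unit_certificate 7 3 631 90 631 90 units7 duals7 annihilators7.
Proof. by vm_compute. Qed.

Lemma ramified_certificate7 : ramified_certificate 7 ramified7
  [:: 1; 4; 2; 1; 4; 2; 1] [:: 0; 1; 0; 0; 1] [:: 1; 0; 0; 1].
Proof. by vm_compute. Qed.

Lemma sieve7_7 : sieve 7 631 90 annihilators7 7 ramified7.
Proof. by vm_compute. Qed.

Lemma sieve7_14 : sieve 7 631 90 annihilators7 14 (0 :: ramified7).
Proof. by vm_compute. Qed.

Definition units11 : seq (seq int * seq int) :=
  [:: ([:: 1; -1], [:: -1; -1; -1; -1; -1; -1; -1; -1; -1; -1; -1]);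
      ([:: 1; 1; 0; 0; 0; 0; 1], [:: -1; 1; 1; -1; -1; 1; 0; -1; 0; 1]);
      ([:: 1; -1; 0; 0; -1; 0; 0; 0; 0; -1], [:: 1; 1; -1; 1; -2; 1; -2; 1; -1; 1]);
      ([:: 1; 0; 0; -1; 0; 0; 1; 0; -1], [:: 1; -2; -4; -5; -4; -2; 0; 2; 3; 3; 2]);
      ([:: 1; 1; -1; -1; 0; 1], [:: 3; -5; 4; 0; -3; 4; -2; -1; 3; -3; 1])].

Definition duals11 : seq (seq (N * N)) :=
  [:: [:: (62, 10); (190, 6); (326, 10); (305, 10); (262, 9)]%num;
      [:: (62, 7); (190, 1); (326, 4); (305, 3); (262, 5)]%num;
      [:: (62, 4); (190, 7); (326, 5); (305, 1); (262, 6)]%num;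
      [:: (62, 7); (190, 1); (326, 3); (305, 2); (262, 3)]%num;
      [:: (62, 10); (190, 10); (326, 2); (305, 6); (262, 8)]%num].

Definition annihilators11 : seq (seq (N * N)) :=
  [:: [:: (190, 1); (237, 1); (107, 6); (93, 2); (292, 1)]%num;
      [:: (326, 2); (237, 9); (107, 9); (93, 1); (285, 1)]%num].

(** The quotient of 1 + theta^5 by 1 + theta, of norm 33 / 3 = 11. *)
Definition ramified11 : seq int := [:: 1; -1; 1; -1; 1].

Lemma unit_certificate11 : unit_certificate 11 5 331 30 331 30 units11 duals11 annihilators11.
Proof. by vm_compute. Qed.

Lemma ramified_certificate11 : ramified_certificate 11 ramified11
  [:: 1; -5; -8; -4; -2; -1; 5; 8; 4; 2; 1] [:: 0; -1; -1; 0; 0; 0; 1; 1] [:: -1; -1; 0; 0; 0; 1; 1].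
Proof. by vm_compute. Qed.

Lemma sieve11_22 : sieve 11 331 30 annihilators11 22 (0 :: ramified11).
Proof. by vm_compute. Qed.

Lemma no_solution_exceptional (k c x y : nat) :
  ((k, c) \in [:: (5, 10); (7, 7); (7, 14); (11, 22)])%N ->
  (x ^ k <> 2 * y ^ k + c)%N /\ (2 * y ^ k <> x ^ k + c)%N.
Proof.
have abs_eq (K d X Y : nat) : `|X%:Z ^+ K - 2 * Y%:Z ^+ K| <> d%:Z ->
    (X ^ K <> 2 * Y ^ K + d)%N /\ (2 * Y ^ K <> X ^ K + d)%N.
  have pX n e : (n ^ e)%N%:Z = n%:Z ^+ e by rewrite -!natz natrX.
  move=> h; split=> /(congr1 Posz); rewrite PoszD PoszM !pX => e; apply: h.
    by rewrite e addrC addKr ger0_norm.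
  by rewrite e opprD addrA subrr sub0r normrN ger0_norm.
rewrite !inE !xpair_eqE => /or4P[] /andP[/eqP -> /eqP ->]; apply: abs_eq.
- exact: (no_solution_2k unit_certificate5 ramified_certificate5 sieve5_10).
- exact: (no_solution_k unit_certificate7 ramified_certificate7 sieve7_7).
- exact: (no_solution_2k unit_certificate7 ramified_certificate7 sieve7_14).
exact: (no_solution_2k unit_certificate11 ramified_certificate11 sieve11_22).
Qed.

End ExceptionalExponents.

(** * All odd exponents from 5 on *)

Module ExponentsFromFive.

Import ZArith.
Import all_boot.
Import zify ring.
Import LargeExponents MediumExponents ExceptionalExponents.
Set Implicit Arguments. Unset Strict Implicit. Unset Printing Implicit Defensive.

Lemma cube_mod9 (n : nat) :
  [\/ exists s, n ^ 3 = 27 * s, exists s, n ^ 3 = 9 * s + 1 | exists s, n ^ 3 = 9 * s + 8].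
Proof.
have [r r3 ->] : exists2 r, r < 3 & n = n %/ 3 * 3 + r by exists (n %% 3); rewrite ?ltn_mod -?divn_eq.
move: (n %/ 3) => q; case: r r3 => [|[|[|//]]] _.
- by constructor 1; exists (q ^ 3); ring.
- by constructor 2; exists (3 * q ^ 3 + 3 * q ^ 2 + q); ring.
by constructor 3; exists (3 * q ^ 3 + 6 * q ^ 2 + 4 * q); ring.
Qed.

(** Ninth powers are cubes, hence 0 modulo 27 or 1 or -1 modulo 9. The equation modulo 9 forces both
    powers to be multiples of 27, but 27 does not divide 18. *)
Lemma no_solution_9_18 (x y : nat) : x ^ 9 <> 2 * y ^ 9 + 18 /\ 2 * y ^ 9 <> x ^ 9 + 18.
Proof.
have cube n : [\/ exists s, n ^ 9 = 27 * s, exists s, n ^ 9 = 9 * s + 1 | exists s, n ^ 9 = 9 * s + 8].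
  by rewrite -[9%N]/(3 * 3) expnM; apply: cube_mod9.
move: (x ^ 9) (y ^ 9) (cube x) (cube y) => X Y.
by case=> -[s ->]; case=> -[t ->]; clear; lia.
Qed.

Lemma no_solution_ge5 (k c x y : nat) : odd k -> 5 <= k -> 0 < x -> 0 < y -> c = k \/ c = 2 * k ->
  x ^ k <> 2 * y ^ k + c /\ 2 * y ^ k <> x ^ k + c.
Proof.
move=> k_odd k5 x0 y0 ck; case: (ltnP k 2600) => [k_lt|k_ge].
  have m9 := no_solution_9_18 x y; have exc := @no_solution_exceptional k c x y.
  case: (boolP ((k, c) \in [:: (5, 10); (7, 7); (7, 14); (9, 18); (11, 22)])) => [|ne].
    rewrite !inE !xpair_eqE in exc * => /or4P[h|h|h|/orP[/andP[/eqP-> /eqP->]//|h]];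
      by apply: exc; rewrite h ?orbT.
  by apply: medium_exponent => //; rewrite k5.
have toPow a : a ^ k = Nat.pow a k by elim: (k) => //= n <-; rewrite expnS.
have lt_2k : 2 * k < 2 ^ k.
  clear -k_ge; have : 3 <= k by apply: leq_trans k_ge.
  by elim: k {k_ge} => // -[|[|[|n]]] IH // _; rewrite expnS; have := IH isT; lia.
have c_le : 0 < c <= 2 * k by lia.
case: (ltnP y x) => [lt_yx|le_xy].
  have big := @large_exponent k x y.
  split=> e; apply: big; rewrite -?toPow; apply/leP => //; rewrite -?multE -?plusE; lia.
(* For x <= y the difference 2 y^k - x^k is at least y^k, which exceeds 2k as soon as y >= 2. *)
have pow_le : x ^ k <= y ^ k by rewrite leq_exp2r // (leq_trans _ k5).
have [y1|y1] : y = 1 \/ 2 <= y by lia.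
  have x1 : x = 1 by lia.
  rewrite y1 x1 exp1n; lia.
have : 2 ^ k <= y ^ k by rewrite leq_exp2r // (leq_trans _ k5).
split; lia.
Qed.

Lemma no_solution_ge5_Z (k p q : Z) : (5 <= k)%Z -> Z.odd k = true -> (0 < p)%Z -> (0 < q)%Z ->
  let d := (p ^ k - 2 * q ^ k)%Z in Z.abs d <> k /\ Z.abs d <> (2 * k)%Z.
Proof.
move=> k5 k_odd p0 q0 d.
have powE a : Z.of_nat (a ^ Z.to_nat k) = (Z.of_nat a ^ k)%Z.
  rewrite -[in RHS](Z2Nat.id k); last by clear -k5; lia.
  rewrite -Nat2Z.inj_pow; congr Z.of_nat.
  by elim: (Z.to_nat k) => //= n <-; rewrite expnS.
have ko : odd (Z.to_nat k) by move/Z.odd_spec: k_odd => [z e]; clear -e k5; lia.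
have k5' : 5 <= Z.to_nat k by clear -k5; lia.
have p0' : 0 < Z.to_nat p by clear -p0; lia.
have q0' : 0 < Z.to_nat q by clear -q0; lia.
have [h1 h2] := no_solution_ge5 ko k5' p0' q0' (or_introl (erefl _)).
have [h3 h4] := no_solution_ge5 ko k5' p0' q0' (or_intror (erefl _)).
have ep := powE (Z.to_nat p); have eq := powE (Z.to_nat q).
rewrite Z2Nat.id in ep; last by clear -p0; lia.
rewrite Z2Nat.id in eq; last by clear -q0; lia.
rewrite {}/d -ep -eq; move: h1 h2 h3 h4 k5; move: (_ ^ _) (_ ^ _) => P Q; clear; lia.
Qed.

End ExponentsFromFive.

(** * The exponent 3 *)

Module CubicField.

Import ZArith Znumtheory Wf_nat Lia Ring Reals Lra Psatz.
Local Open Scope Z_scope.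

(** * The ring Z[theta] with theta^3 = 2 *)

Record cubic : Type := Cubic { c0 : Z; c1 : Z; c2 : Z }.

Definition cadd (x y : cubic) := Cubic (c0 x + c0 y) (c1 x + c1 y) (c2 x + c2 y).
Definition copp (x : cubic) := Cubic (- c0 x) (- c1 x) (- c2 x).
Definition csub (x y : cubic) := Cubic (c0 x - c0 y) (c1 x - c1 y) (c2 x - c2 y).
Definition cmul (x y : cubic) := Cubic
  (c0 x * c0 y + 2 * (c1 x * c2 y + c2 x * c1 y))
  (c0 x * c1 y + c1 x * c0 y + 2 * (c2 x * c2 y))
  (c0 x * c2 y + c1 x * c1 y + c2 x * c0 y).
Definition cst (z : Z) := Cubic z 0 0.

Lemma cubic_eq x y : c0 x = c0 y -> c1 x = c1 y -> c2 x = c2 y -> x = y.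
Proof. destruct x, y; simpl; intros; subst; reflexivity. Qed.

Ltac coords := apply cubic_eq; cbn [c0 c1 c2 cadd cmul csub copp cst]; ring.

Lemma cubic_ring : ring_theory (cst 0) (cst 1) cadd cmul csub copp eq.
Proof. constructor; intros; coords. Qed.

Lemma cst_morph : ring_morph (cst 0) (cst 1) cadd cmul csub copp eq
  0 1 Z.add Z.mul Z.sub Z.opp Z.eqb cst.
Proof.
  constructor; intros; try (coords).
  apply Z.eqb_eq in H; subst; reflexivity.
Qed.

Ltac cst_inv t := match t with cst ?z => match isZcst z with true => z | _ => NotConstant end | _ => NotConstant end.

Add Ring cubic_ring_inst : cubic_ring (morphism cst_morph, constants [cst_inv]).

Declare Scope cubic_scope.
Delimit Scope cubic_scope with K.
Infix "+" := cadd : cubic_scope.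
Infix "-" := csub : cubic_scope.
Infix "*" := cmul : cubic_scope.

Fixpoint cpow (x : cubic) (n : nat) : cubic :=
  match n with O => cst 1 | S n' => cmul x (cpow x n') end.

Lemma cpow_add x m n : cpow x (m + n) = cmul (cpow x m) (cpow x n).
Proof. induction m as [|m IH]; simpl; [ring | rewrite IH; ring]. Qed.

Lemma cpow_mul x m n : cpow x (m * n) = cpow (cpow x m) n.
Proof.
  induction n as [|n IH]; [rewrite Nat.mul_0_r; reflexivity|].
  rewrite Nat.mul_succ_r, Nat.add_comm, cpow_add, IH; reflexivity.
Qed.

Lemma cst_mul a b : cst (a * b) = (cst a * cst b)%K.
Proof. coords. Qed.

Lemma cst_add a b : cst (a + b) = (cst a + cst b)%K.
Proof. coords. Qed.

Lemma cpow_binomial (y : cubic) (u : nat) : exists (t : Z) (r : cubic),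
  cpow (cst 1 + y)%K u = (cst 1 + cst (Z.of_nat u) * y + cst t * (y * y) + y * y * y * r)%K.
Proof.
  induction u as [|u [t [r IH]]].
  - exists 0, (cst 0); simpl; ring.
  - exists (t + Z.of_nat u), (r + cst t + y * r)%K.
    cbn [cpow]; rewrite IH, Nat2Z.inj_succ, <- Z.add_1_r, !cst_add; ring.
Qed.

Definition omega : cubic := Cubic 0 1 (-1).
Definition epsilon : cubic := Cubic (-1) 1 0.
Definition xi : cubic := (cst 1 + cst 3 * omega)%K.

(** Obtained by cubing 1 + 3^(s+1) w, subtracting 1 and dividing by 3^(s+2). *)
Fixpoint omega_ (s : nat) : cubic :=
  match s with
  | O => omega
  | S s' => let w := omega_ s' in
      (w + cst (3 * 3 ^ Z.of_nat s') * (w * w) + cst (3 * 3 ^ (2 * Z.of_nat s')) * (w * w * w))%K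
  end.

Lemma epsilon_cube : cpow epsilon 3 = xi.
Proof. reflexivity. Qed.

Lemma pow3_S s : 3 ^ Z.of_nat (S s) = 3 * 3 ^ Z.of_nat s.
Proof. rewrite Nat2Z.inj_succ, Z.pow_succ_r; lia. Qed.

Lemma xi_pow3 (s : nat) : cpow xi (3 ^ s) = (cst 1 + cst (3 * 3 ^ Z.of_nat s) * omega_ s)%K.
Proof.
  induction s as [|s IH]; [reflexivity|].
  replace (3 ^ S s)%nat with (3 ^ s * 3)%nat by (simpl; lia).
  rewrite cpow_mul, IH, pow3_S; cbn [omega_].
  replace (3 ^ (2 * Z.of_nat s)) with (3 ^ Z.of_nat s * 3 ^ Z.of_nat s)
    by (rewrite <- Z.pow_add_r by lia; f_equal; lia).
  set (w := omega_ s); set (a := 3 ^ Z.of_nat s); cbn [cpow].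
  rewrite !cst_mul; ring.
Qed.

Lemma omega_mod3 (s : nat) : exists r, omega_ s = (omega + cst 3 * r)%K.
Proof.
  induction s as [|s [r IH]]; [exists (cst 0); cbn [omega_]; ring|].
  cbn [omega_]; set (w := omega_ s) in *.
  exists (r + cst (3 ^ Z.of_nat s) * (w * w) + cst (3 ^ (2 * Z.of_nat s)) * (w * w * w))%K.
  rewrite !cst_mul, IH at 1; ring.
Qed.

(** * Exact 3-adic valuation of a coordinate *)

Section Coefficient.
Variables (c : cubic -> Z) (B : cubic).
Hypothesis c_add : forall x y, c (x + y)%K = c x + c y.
Hypothesis c_cst : forall z x, c (cst z * x)%K = z * c x.

Let e (x : cubic) : Z := c (B * x)%K.

Lemma e_add x y : e (x + y)%K = e x + e y.
Proof. unfold e; rewrite <- c_add; f_equal; ring. Qed.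

Lemma e_cst z x : e (cst z * x)%K = z * e x.
Proof. unfold e; rewrite <- c_cst; f_equal; ring. Qed.

Hypothesis e_one : e (cst 1) = 0.
Hypothesis e_sq : (3 | e (omega * omega)%K).
Hypothesis e_cube : (3 | e (omega * omega * omega)%K).

Lemma e_omega_sq (s : nat) : (3 | e (omega_ s * omega_ s)%K).
Proof.
  destruct e_sq as [z Hz]; destruct (omega_mod3 s) as [r ->].
  replace ((omega + cst 3 * r) * (omega + cst 3 * r))%K
    with (omega * omega + cst 3 * (cst 2 * (omega * r) + cst 3 * (r * r)))%K by ring.
  rewrite e_add, e_cst, Hz; exists (z + e (cst 2 * (omega * r) + cst 3 * (r * r))%K); ring.
Qed.

Lemma e_omega_cube (s : nat) : (3 | e (omega_ s * omega_ s * omega_ s)%K).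
Proof.
  destruct e_cube as [z Hz]; destruct (omega_mod3 s) as [r ->].
  set (t := (cst 3 * (omega * omega * r) + cst 9 * (omega * r * r) + cst 9 * (r * r * r))%K).
  replace ((omega + cst 3 * r) * (omega + cst 3 * r) * (omega + cst 3 * r))%K
    with (omega * omega * omega + cst 3 * t)%K by (unfold t; ring).
  rewrite e_add, e_cst, Hz; exists (z + e t); ring.
Qed.

Variables (j s0 : nat) (v : Z).
Hypothesis j_le : (j <= s0 + 1)%nat.
Hypothesis e_base : exists z, e (omega_ s0) = 3 ^ Z.of_nat j * (v + 3 * z).
Hypothesis v_unit : ~ (3 | v).

(** For s >= s0 the quadratic and cubic corrections are divisible by 3^(s+2), and s + 2 > j, so they
    do not disturb the valuation j. *)
Lemma e_omega (s : nat) : (s0 <= s)%nat -> exists z, e (omega_ s) = 3 ^ Z.of_nat j * (v + 3 * z).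
Proof.
  induction 1 as [|s le_s [z IH]]; [exact e_base|].
  cbn [omega_]; rewrite !e_add, !e_cst, IH.
  destruct (e_omega_sq s) as [z2 ->]; destruct (e_omega_cube s) as [z3 ->].
  exists (z + 3 ^ Z.of_nat (s + 1 - j) * z2 + 3 ^ Z.of_nat (2 * s + 1 - j) * z3).
  replace (3 * 3 ^ Z.of_nat s) with (3 ^ Z.of_nat j * 3 ^ Z.of_nat (s + 1 - j))
    by (rewrite <- Z.pow_add_r, <- Z.pow_succ_r by lia; f_equal; lia).
  replace (3 * 3 ^ (2 * Z.of_nat s)) with (3 ^ Z.of_nat j * 3 ^ Z.of_nat (2 * s + 1 - j))
    by (rewrite <- Z.pow_add_r, <- Z.pow_succ_r by lia; f_equal; lia).
  ring.
Qed.

(** The term linear in u has valuation exactly s + 1 + j, and all later terms of the expansion have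
    a larger one. *)
Lemma coef_pow (s u : nat) : (s0 <= s)%nat -> ~ (3 | Z.of_nat u) ->
  ~ (3 ^ Z.of_nat (s + 2 + j) | e (cpow xi (3 ^ s * u))).
Proof.
  intros le_s u_unit [g Hg].
  destruct (e_omega s le_s) as [z Hz]; destruct (e_omega_sq s) as [z2 Hz2].
  rewrite cpow_mul, xi_pow3 in Hg.
  set (A := 3 * 3 ^ Z.of_nat s) in *; set (w := omega_ s) in *.
  destruct (cpow_binomial (cst A * w)%K u) as [t [r E]]; rewrite E in Hg.
  replace (cst 1 + cst (Z.of_nat u) * (cst A * w) + cst t * (cst A * w * (cst A * w)) + cst A * w * (cst A * w) * (cst A * w) * r)%K
    with (cst 1 + cst (Z.of_nat u) * (cst A * w) + cst t * (cst A * (cst A * (w * w))) + cst A * (cst A * (cst A * (w * w * w * r))))%K in Hg by ring.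
  rewrite !e_add, !e_cst, e_one, Hz, Hz2 in Hg.
  set (x := e (w * w * w * r)%K) in *; set (P := 3 ^ Z.of_nat j) in *.
  set (Q := 3 ^ Z.of_nat (s + 1 - j)).
  assert (HA : A = P * Q)
    by (unfold A, P, Q; rewrite <- Z.pow_add_r, <- Z.pow_succ_r by lia; f_equal; lia).
  assert (H3 : 3 ^ Z.of_nat (s + 2 + j) = A * P * 3).
  { unfold A, P; replace (Z.of_nat (s + 2 + j)) with (Z.of_nat s + Z.of_nat j + 2) by lia.
    rewrite !Z.pow_add_r by lia; change (3 ^ 2) with 9; ring. }
  assert (P0 : A * P <> 0).
  { apply Z.neq_mul_0; split; unfold A, P; [apply Z.neq_mul_0; split; [lia|]|];
      apply Z.pow_nonzero; lia. }
  rewrite H3 in Hg.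
  assert (Huv : (3 | Z.of_nat u * v)).
  { exists (g - Z.of_nat u * z - t * Q * z2 - 3 ^ Z.of_nat s * Q * x).
    apply (Z.mul_reg_l _ _ (A * P) P0).
    replace (A * P * ((g - Z.of_nat u * z - t * Q * z2 - 3 ^ Z.of_nat s * Q * x) * 3))
      with (g * (A * P * 3) - A * P * (3 * Z.of_nat u * z + 3 * t * Q * z2 + A * Q * x))
      by (unfold A; ring).
    rewrite <- Hg, HA; ring. }
  apply prime_mult in Huv; [tauto | exact prime_3].
Qed.

Lemma xi_pow_one (E N : nat) : exists r, cpow xi (3 ^ E * N) = (cst 1 + cst (3 * 3 ^ Z.of_nat E) * r)%K.
Proof.
  rewrite cpow_mul, xi_pow3; set (a := 3 * 3 ^ Z.of_nat E); set (w := omega_ E).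
  destruct (cpow_binomial (cst a * w)%K N) as [t [r ->]].
  exists (cst (Z.of_nat N) * w + cst t * cst a * (w * w) + cst a * cst a * (w * w * w * r))%K; ring.
Qed.

Lemma three_part (d : Z) : d <> 0 -> exists (s : nat) (u : Z), d = 3 ^ Z.of_nat s * u /\ ~ (3 | u).
Proof.
  remember (Z.to_nat (Z.abs d)) as n eqn:En; revert d En.
  induction n as [n IH] using lt_wf_ind; intros d En d0.
  destruct (Zdivide_dec 3 d) as [[d' Hd']|nd]; [|exists O, d; split; [rewrite Z.mul_1_l; reflexivity|exact nd]].
  destruct (IH (Z.to_nat (Z.abs d'))) with (d := d') as [s [u [Hs Hu]]]; try lia.
  exists (S s), u; split; [rewrite pow3_S; lia | exact Hu].
Qed.

(* Multiplying by a power [xi ^ (3 ^ E * N - N)] makes the exponent difference [M - N], which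
   may be negative, effectively a natural number, at the cost of a congruence. *)
Lemma coef_nonzero (alpha : cubic) (N M : nat) :
  (forall s, (3 ^ Z.of_nat s | Z.of_nat M - Z.of_nat N) ->
     ~ (3 ^ Z.of_nat (S s) | Z.of_nat M - Z.of_nat N) -> (s0 <= s)%nat) ->
  (alpha * cpow xi N = B * cpow xi M)%K -> c alpha = 0 -> M = N.
Proof.
  intros Hs0 E ca; destruct (Nat.eq_dec M N) as [|ne]; [assumption|exfalso].
  destruct (three_part (Z.of_nat M - Z.of_nat N)) as [s [u [Hd u3]]]; [lia|].
  assert (le_s : (s0 <= s)%nat).
  { apply Hs0; [exists u; lia|]; intros [g Hg]; apply u3; exists g.
    rewrite Hg, pow3_S in Hd; apply (Z.mul_reg_l _ _ (3 ^ Z.of_nat s)); [apply Z.pow_nonzero|]; lia. }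
  set (F := (s + (j + 1))%nat).
  assert (F1 : (1 <= 3 ^ F)%nat) by (pose proof (Nat.pow_nonzero 3 F); lia).
  destruct (xi_pow_one F N) as [r Hr].
  assert (Hu : exists u' : nat, (M + (3 ^ F - 1) * N = 3 ^ s * u')%nat /\ ~ (3 | Z.of_nat u')).
  { assert (HZ : Z.of_nat (M + (3 ^ F - 1) * N) = 3 ^ Z.of_nat s * (u + 3 * (3 ^ Z.of_nat j * Z.of_nat N))).
    { rewrite Nat2Z.inj_add, Nat2Z.inj_mul, Nat2Z.inj_sub, Nat2Z.inj_pow by exact F1.
      unfold F; rewrite !Nat2Z.inj_add, !Z.pow_add_r by lia; change (3 ^ Z.of_nat 1) with 3.
      change (Z.of_nat 3) with 3; change (Z.of_nat 1) with 1; nia. }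
    assert (Hpos : 0 <= u + 3 * (3 ^ Z.of_nat j * Z.of_nat N)).
    { pose proof (Z.pow_pos_nonneg 3 (Z.of_nat s)); nia. }
    exists (Z.to_nat (u + 3 * (3 ^ Z.of_nat j * Z.of_nat N))); split.
    - apply Nat2Z.inj; rewrite HZ, Nat2Z.inj_mul, Nat2Z.inj_pow, Z2Nat.id by exact Hpos; reflexivity.
    - rewrite Z2Nat.id by exact Hpos; intros [g Hg]; apply u3.
      exists (g - 3 ^ Z.of_nat j * Z.of_nat N); lia. }
  destruct Hu as [u' [Hu' u'3]].
  apply (coef_pow s u' le_s u'3).
  rewrite <- Hu'; unfold e.
  replace (B * cpow xi (M + (3 ^ F - 1) * N))%K with (alpha * cpow xi (3 ^ F * N))%K.
  - rewrite Hr.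
    replace (alpha * (cst 1 + cst (3 * 3 ^ Z.of_nat F) * r))%K
      with (alpha + cst (3 * 3 ^ Z.of_nat F) * (alpha * r))%K by ring.
    rewrite c_add, c_cst, ca; exists (c (alpha * r)%K).
    replace (Z.of_nat (s + 2 + j)) with (Z.succ (Z.of_nat F)) by (unfold F; lia).
    rewrite Z.pow_succ_r by lia; ring.
  - replace (3 ^ F * N)%nat with (N + (3 ^ F - 1) * N)%nat by nia.
    rewrite !cpow_add.
    transitivity ((alpha * cpow xi N) * cpow xi ((3 ^ F - 1) * N))%K; [ring|].
    rewrite E; ring.
Qed.

End Coefficient.

(** * Units of norm 1 *)

Definition norm (x : cubic) : Z :=
  c0 x * c0 x * c0 x + 2 * (c1 x * c1 x * c1 x) + 4 * (c2 x * c2 x * c2 x)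
  - 6 * (c0 x * c1 x * c2 x).

Definition adj (x : cubic) : cubic := Cubic
  (c0 x ^ 2 - 2 * c1 x * c2 x) (2 * c2 x ^ 2 - c0 x * c1 x) (c1 x ^ 2 - c0 x * c2 x).

Lemma mul_adj x : (x * adj x)%K = cst (norm x).
Proof. apply cubic_eq; unfold norm, adj; cbn [c0 c1 c2 cmul cst]; ring. Qed.

Lemma normM x y : norm (x * y)%K = norm x * norm y.
Proof. unfold norm; cbn [c0 c1 c2 cmul]; ring. Qed.

Definition epsilon_inv : cubic := Cubic 1 1 1.

Lemma epsilon_mul : (epsilon * epsilon_inv)%K = cst 1.
Proof. reflexivity. Qed.

Section Embedding.
Open Scope R_scope.

Definition tau : R := Rpower 2 (/ 3).

Lemma tau_cube : tau * tau * tau = 2.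
Proof.
  unfold tau; rewrite <- !Rpower_plus; replace (/ 3 + / 3 + / 3) with 1 by field.
  apply Rpower_1; lra.
Qed.

Lemma tau_pos : 0 < tau.
Proof. apply exp_pos. Qed.

Lemma tau_bounds : 1.25 < tau < 1.26.
Proof.
  pose proof tau_pos; pose proof tau_cube.
  split; apply Rnot_le_lt; intros h.
  - assert (tau * tau <= 1.25 * 1.25) by (apply Rmult_le_compat; lra).
    assert (tau * tau * tau <= 1.25 * 1.25 * 1.25) by (apply Rmult_le_compat; try lra; apply Rmult_le_pos; lra).
    lra.
  - assert (1.26 * 1.26 <= tau * tau) by (apply Rmult_le_compat; lra).
    assert (1.26 * 1.26 * 1.26 <= tau * tau * tau) by (apply Rmult_le_compat; lra).
    lra.
Qed.

Definition val (x : cubic) : R := IZR (c0 x) + IZR (c1 x) * tau + IZR (c2 x) * (tau * tau).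

Lemma valM x y : val (x * y)%K = val x * val y.
Proof.
  unfold val; cbn [c0 c1 c2 cmul]; rewrite !plus_IZR, !mult_IZR, !plus_IZR, !mult_IZR.
  pose proof tau_cube as t3.
  set (a := IZR (c0 x)); set (b := IZR (c1 x)); set (d := IZR (c2 x)).
  set (a' := IZR (c0 y)); set (b' := IZR (c1 y)); set (d' := IZR (c2 y)).
  transitivity (a * a' + (b * d' + d * b') * (tau * tau * tau)
    + (a * b' + b * a') * tau + d * d' * (tau * tau * tau) * tau + (a * d' + b * b' + d * a') * (tau * tau)).
  - rewrite t3; ring.
  - ring.
Qed.

(** The factorization of A^3 + B^3 + C^3 - 3ABC. The sum of squares is twice the squared absolute
    value of a complex conjugate. *)
Lemma val_norm x : let A := IZR (c0 x) in let B := IZR (c1 x) * tau in let C := IZR (c2 x) * (tau * tau) in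
  val x * ((A - B) * (A - B) + (B - C) * (B - C) + (A - C) * (A - C)) = 2 * IZR (norm x).
Proof.
  intros A B C; unfold norm, val; fold A B C.
  rewrite !minus_IZR, !plus_IZR, !mult_IZR; pose proof tau_cube as t3.
  set (a := IZR (c0 x)) in *; set (b := IZR (c1 x)) in *; set (d := IZR (c2 x)) in *.
  transitivity (2 * (A * A * A + B * B * B + C * C * C - 3 * (A * B * C))); [ring|].
  unfold A, B, C.
  replace (b * tau * (b * tau) * (b * tau)) with (b * b * b * (tau * tau * tau)) by ring.
  replace (d * (tau * tau) * (d * (tau * tau)) * (d * (tau * tau)))
    with (d * d * d * (tau * tau * tau) * (tau * tau * tau)) by ring.
  replace (a * (b * tau) * (d * (tau * tau))) with (a * b * d * (tau * tau * tau)) by ring.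
  rewrite t3; ring.
Qed.

Lemma sum_sq_bound p q : p * p + q * q + (p - q) * (p - q) <= 2 -> -2 <= p + q <= 2.
Proof.
  intros h; assert ((p + q) * (p + q) <= 4).
  { pose proof (Rle_0_sqr (p - q)) as h1; unfold Rsqr in h1; lra. }
  split; apply Rnot_lt_le; intros h2.
  - assert (2 * 2 < (- (p + q)) * (- (p + q))) by (apply Rmult_le_0_lt_compat; lra); lra.
  - assert (2 * 2 < (p + q) * (p + q)) by (apply Rmult_le_0_lt_compat; lra); lra.
Qed.

Lemma val_pos x : norm x = 1%Z -> 0 < val x.
Proof.
  intros n1; pose proof (val_norm x) as h; cbv zeta in h; rewrite n1 in h.
  set (A := IZR (c0 x)) in *; set (B := IZR (c1 x) * tau) in *; set (C := IZR (c2 x) * (tau * tau)) in *.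
  set (S := (A - B) * (A - B) + (B - C) * (B - C) + (A - C) * (A - C)) in *.
  assert (0 <= S).
  { pose proof (Rle_0_sqr (A - B)); pose proof (Rle_0_sqr (B - C)); pose proof (Rle_0_sqr (A - C)).
    unfold S, Rsqr in *; lra. }
  apply Rnot_le_lt; intros h1.
  assert (val x * S <= 0) by (rewrite <- (Rmult_0_l S); apply Rmult_le_compat_r; lra).
  lra.
Qed.

Lemma val_epsilon_inv : 2 < val epsilon_inv < 3.85.
Proof.
  pose proof tau_bounds; unfold val, epsilon_inv; cbn [c0 c1 c2].
  assert (1.25 * 1.25 <= tau * tau) by (apply Rmult_le_compat; lra).
  assert (tau * tau <= 1.26 * 1.26) by (apply Rmult_le_compat; lra).
  lra.
Qed.

(** A value at least 1 bounds the sum of squares by 2, so A, B, C lie within 2/3 of their mean,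
    which is less than 3.85 / 3. All coordinates are therefore 0 or 1. Among the eight candidates
    only 1 and [epsilon_inv] have norm 1, and the strict inequality excludes the latter. *)
Lemma fundamental_domain x : norm x = 1%Z -> 1 <= val x < val epsilon_inv -> x = cst 1.
Proof.
  intros n1 [lo hi]; pose proof (val_norm x) as h; cbv zeta in h; rewrite n1 in h.
  pose proof val_epsilon_inv as ve; pose proof tau_bounds as tb.
  assert (t2 : 1.5 <= tau * tau).
  { apply Rle_trans with (1.25 * 1.25); [lra | apply Rmult_le_compat; lra]. }
  assert (Ev : val x = IZR (c0 x) + IZR (c1 x) * tau + IZR (c2 x) * (tau * tau)) by reflexivity.
  set (A := IZR (c0 x)) in *; set (B := IZR (c1 x) * tau) in *; set (C := IZR (c2 x) * (tau * tau)) in *.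
  set (S := (A - B) * (A - B) + (B - C) * (B - C) + (A - C) * (A - C)) in *.
  assert (S0 : 0 <= S).
  { pose proof (Rle_0_sqr (A - B)); pose proof (Rle_0_sqr (B - C)); pose proof (Rle_0_sqr (A - C)).
    unfold S, Rsqr in *; lra. }
  assert (S2 : S <= 2).
  { assert (1 * S <= val x * S) by (apply Rmult_le_compat_r; lra); lra. }
  assert (bA : -2 <= (A - B) + (A - C) <= 2) by (apply sum_sq_bound; unfold S in S2; lra).
  assert (bB : -2 <= (B - A) + (B - C) <= 2) by (apply sum_sq_bound; unfold S in S2; lra).
  assert (bC : -2 <= (C - A) + (C - B) <= 2) by (apply sum_sq_bound; unfold S in S2; lra).
  assert (range : forall (z : Z) (t : R), 1 <= t -> -1 / 3 <= IZR z * t -> (0 <= z)%Z).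
  { intros z t t1 hz; destruct (Z_le_gt_dec 0 z) as [|h1]; [assumption|exfalso].
    assert (IZR z <= -1) by (apply (IZR_le z (-1)); lia).
    assert (IZR z * t <= -1 * t) by (apply Rmult_le_compat_r; lra); lra. }
  assert (range' : forall (z : Z) (t : R), 1 <= t -> IZR z * t < 2 -> (z <= 1)%Z).
  { intros z t t1 hz; destruct (Z_le_gt_dec z 1) as [|h1]; [assumption|exfalso].
    assert (2 <= IZR z) by (apply (IZR_le 2 z); lia).
    assert (2 * t <= IZR z * t) by (apply Rmult_le_compat_r; lra); lra. }
  assert (a0 : (0 <= c0 x <= 1)%Z) by (split; [apply (range _ 1) | apply (range' _ 1)]; fold A; lra).
  assert (b0 : (0 <= c1 x <= 1)%Z) by (split; [apply (range _ tau) | apply (range' _ tau)]; fold B; lra).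
  assert (d0 : (0 <= c2 x <= 1)%Z) by (split; [apply (range _ (tau * tau)) | apply (range' _ (tau * tau))]; fold C; lra).
  clear -n1 hi a0 b0 d0; destruct x as [a b d]; unfold norm in n1; cbn [c0 c1 c2] in *.
  assert (Ha : (a = 0 \/ a = 1)%Z) by lia; assert (Hb : (b = 0 \/ b = 1)%Z) by lia.
  assert (Hd : (d = 0 \/ d = 1)%Z) by lia.
  destruct Ha, Hb, Hd; subst; try discriminate n1; try reflexivity.
  exfalso; apply (Rlt_irrefl _ hi).
Qed.

Lemma unit_power_ge1 (k : nat) : forall x, norm x = 1%Z -> 1 <= val x < val epsilon_inv ^ S k ->
  exists n, (x * cpow epsilon n)%K = cst 1.
Proof.
  pose proof val_epsilon_inv as ve.
  assert (vv : val epsilon * val epsilon_inv = 1).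
  { rewrite <- valM, epsilon_mul; unfold val, cst; cbn [c0 c1 c2]; ring. }
  induction k as [|k IH]; intros x n1 [lo hi].
  - exists O; rewrite (fundamental_domain x n1); [reflexivity | simpl in hi; lra].
  - destruct (Rlt_le_dec (val x) (val epsilon_inv)) as [lt|ge].
    + exists O; rewrite (fundamental_domain x n1); [reflexivity | lra].
    + assert (v0 : 0 < val epsilon) by (apply val_pos; reflexivity).
      destruct (IH (x * epsilon)%K) as [n Hn].
      * rewrite normM, n1; reflexivity.
      * rewrite valM; split.
        -- rewrite <- vv, Rmult_comm; apply Rmult_le_compat_r; lra.
        -- change (val epsilon_inv ^ S (S k)) with (val epsilon_inv * val epsilon_inv ^ S k) in hi.
           apply Rlt_le_trans with (val epsilon_inv * val epsilon_inv ^ S k * val epsilon);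
             [apply Rmult_lt_compat_r; lra|].
           replace (val epsilon_inv * val epsilon_inv ^ S k * val epsilon)
             with (val epsilon * val epsilon_inv * val epsilon_inv ^ S k) by ring.
           rewrite vv; lra.
      * exists (S n); cbn [cpow]; rewrite <- Hn; ring.
Qed.

Lemma unit_power x : norm x = 1%Z -> exists m n, (x * cpow epsilon m)%K = cpow epsilon n.
Proof.
  pose proof val_epsilon_inv as ve.
  assert (main : forall y, norm y = 1%Z -> 1 <= val y -> exists n, (y * cpow epsilon n)%K = cst 1).
  { intros y n1 lo.
    destruct (Pow_x_infinity (val epsilon_inv)) with (b := val y + 1) as [k hk].
    { rewrite Rabs_right; lra. }
    apply (unit_power_ge1 k y n1); split; [exact lo|].
    specialize (hk (S k) (Nat.le_succ_diag_r k)).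
    rewrite Rabs_right in hk; [lra | apply Rle_ge, pow_le; lra]. }
  intros n1; destruct (Rle_lt_dec 1 (val x)) as [ge|lt].
  - destruct (main x n1 ge) as [m Hm]; exists m, O; exact Hm.
  - pose proof (mul_adj x) as xa; rewrite n1 in xa.
    assert (na : norm (adj x) = 1%Z).
    { pose proof (normM x (adj x)) as h; rewrite xa, n1 in h; change (norm (cst 1)) with 1%Z in h; lia. }
    assert (va : val x * val (adj x) = 1).
    { rewrite <- valM, xa; unfold val, cst; cbn [c0 c1 c2]; ring. }
    pose proof (val_pos x n1) as vx; pose proof (val_pos _ na) as va0.
    destruct (main (adj x) na) as [n Hn].
    { assert (val x * val (adj x) <= 1 * val (adj x)) by (apply Rmult_le_compat_r; lra); lra. }
    exists O, n; cbn [cpow].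
    transitivity ((x * adj x) * cpow epsilon n)%K; [|rewrite xa; ring].
    transitivity (x * (adj x * cpow epsilon n))%K; [rewrite Hn; ring | ring].
Qed.
End Embedding.

(** * The two cubic equations *)

Lemma norm_three (alpha beta : cubic) :
  alpha = (Cubic 1 1 0 * beta)%K -> norm beta = 1 ->
  exists (j N M : nat), (j < 3)%nat /\ (alpha * cpow xi N = Cubic 1 1 0 * cpow epsilon j * cpow xi M)%K.
Proof.
  intros -> nb; destruct (unit_power beta nb) as [m [n E]].
  exists ((n + 2 * m) mod 3)%nat, m, ((n + 2 * m) / 3)%nat; split.
  - apply Nat.mod_upper_bound; discriminate.
  - rewrite <- epsilon_cube, <- !cpow_mul.
    transitivity (Cubic 1 1 0 * cpow epsilon (n + 2 * m))%K.
    + replace (3 * m)%nat with (m + 2 * m)%nat by lia.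
      rewrite !cpow_add, <- E; ring.
    + rewrite (Nat.div_mod (n + 2 * m) 3) at 1 by discriminate.
      rewrite cpow_add; ring.
Qed.

Lemma xi_pow_mod3 (N : nat) : exists r, cpow xi N = (cst 1 + cst 3 * r)%K.
Proof.
  destruct (xi_pow_one 0 N) as [r Hr]; rewrite Nat.mul_1_l in Hr.
  exists r; rewrite Hr; reflexivity.
Qed.

Section Extract.
Variable c : cubic -> Z.
Hypothesis c_add : forall x y, c (x + y)%K = c x + c y.
Hypothesis c_cst : forall z x, c (cst z * x)%K = z * c x.

(** Since [xi] is 1 modulo 3, this discards every j for which the coordinate of (1 + theta)
    epsilon^j is prime to 3. *)
Lemma coef_mod3 (alpha B : cubic) (N M : nat) :
  (alpha * cpow xi N = B * cpow xi M)%K -> c alpha = 0 -> (3 | c B).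
Proof.
  destruct (xi_pow_mod3 N) as [r ->]; destruct (xi_pow_mod3 M) as [r' ->]; intros E ca.
  assert (E' : (alpha + cst 3 * (alpha * r) = B + cst 3 * (B * r'))%K).
  { transitivity (alpha * (cst 1 + cst 3 * r))%K; [ring|]; rewrite E; ring. }
  apply (f_equal c) in E'; rewrite !c_add, !c_cst, ca in E'.
  exists (c (alpha * r)%K - c (B * r')%K); lia.
Qed.
End Extract.

Lemma xi_cancel (x y : cubic) (N : nat) : (x * cpow xi N = y * cpow xi N)%K -> x = y.
Proof.
  assert (inv : exists z, (cpow xi N * z)%K = cst 1).
  { exists (cpow (cpow epsilon_inv 3) N).
    induction N as [|N IH]; [reflexivity|]; cbn [cpow] in *.
    transitivity ((xi * (epsilon_inv * (epsilon_inv * (epsilon_inv * cst 1))))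
      * (cpow xi N * cpow (epsilon_inv * (epsilon_inv * (epsilon_inv * cst 1))) N))%K; [ring|].
    rewrite IH; reflexivity. }
  destruct inv as [z Hz]; intros E.
  transitivity (x * (cpow xi N * z))%K; [rewrite Hz; ring|].
  transitivity (x * cpow xi N * z)%K; [ring|]; rewrite E.
  transitivity (y * (cpow xi N * z))%K; [ring|]; rewrite Hz; ring.
Qed.

Lemma c1_add x y : c1 (x + y)%K = c1 x + c1 y. Proof. reflexivity. Qed.
Lemma c2_add x y : c2 (x + y)%K = c2 x + c2 y. Proof. reflexivity. Qed.
Lemma c1_cst z x : c1 (cst z * x)%K = z * c1 x.
Proof. cbn [c0 c1 c2 cmul cst]; ring. Qed.
Lemma c2_cst z x : c2 (cst z * x)%K = z * c2 x.
Proof. cbn [c0 c1 c2 cmul cst]; ring. Qed.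

Lemma cube_sub_dvd (a : Z) : exists s, a * a * a - a = 3 * s.
Proof.
  pose proof (Z.div_mod a 3 ltac:(discriminate)) as E; pose proof (Z.mod_pos_bound a 3 eq_refl).
  set (q := a / 3) in *; assert (a mod 3 = 0 \/ a mod 3 = 1 \/ a mod 3 = 2) as [h | [h | h]] by lia;
    rewrite h in E; rewrite E; clear.
  - exists (9 * q * q * q - q); ring.
  - exists (9 * q * q * q + 9 * q * q + 2 * q); ring.
  - exists (9 * q * q * q + 18 * q * q + 11 * q + 2); ring.
Qed.

Lemma pure_theta_sq (a d : Z) : a * a * a + 4 * (d * d * d) = 3 -> a = -1 /\ d = 1.
Proof.
  intros H.
  assert (Hs : exists s, a = 3 * s - d).
  { destruct (cube_sub_dvd a) as [p Hp]; destruct (cube_sub_dvd d) as [q Hq].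
    exists (1 - d * d * d - p - q); lia. }
  destruct Hs as [s Hs].
  (* The quotient of a + d theta^2 by 1 + theta, integral because a = -d modulo 3. *)
  destruct (norm_three (Cubic a 0 d) (Cubic (s - d) (d - s) s)) as [j [N [M [j3 E]]]].
  - rewrite Hs; apply cubic_eq; cbn [c0 c1 c2 cmul]; ring.
  - unfold norm; cbn [c0 c1 c2]; subst a; nia.
  - assert (j = 0 \/ j = 1 \/ j = 2)%nat as [-> | [-> | ->]] by lia.
    + destruct (coef_mod3 c1 c1_add c1_cst _ _ _ _ E eq_refl) as [z Hz]; cbn in Hz; lia.
    (* (1 + theta) epsilon = theta^2 - 1 is itself the solution, and the valuation argument shows
       that it is the only one. *)
    + assert (M = N).
      { apply (coef_nonzero c1 (Cubic 1 1 0 * cpow epsilon 1)%K c1_add c1_cst eq_refl) with (j := 1%nat) (s0 := 0%nat) (v := -1) (alpha := Cubic a 0 d).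
        - exists 0; reflexivity.
        - exists 6; reflexivity.
        - lia.
        - exists 0; reflexivity.
        - intros [z Hz]; lia.
        - intros; lia.
        - exact E.
        - reflexivity. }
      subst M; apply xi_cancel in E; injection E; intros; split; assumption.
    + destruct (coef_mod3 c1 c1_add c1_cst _ _ _ _ E eq_refl) as [z Hz]; cbn in Hz; lia.
Qed.

(** K + 26 N replaces K - N, because xi^(27 N) is 1 modulo 81. When this exponent is a multiple of
    3, the theta^2 coordinate is 27 modulo 81, as 81 divides 9 * 945. *)
Lemma no_theta_sq_two_mod3 (alpha : cubic) (N K v : nat) : (K + 26 * N = 3 * v)%nat ->
  (alpha * cpow xi N = Cubic 1 1 0 * cpow xi 2 * cpow xi K)%K -> c2 alpha <> 0.
Proof.
  intros Hv E ca.
  destruct (xi_pow_one 3 N) as [r Hr].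
  assert (E' : (alpha * cpow xi (3 ^ 3 * N) = Cubic 1 1 0 * cpow xi 2 * cpow xi (3 ^ 1 * v))%K).
  { replace (3 ^ 3 * N)%nat with (N + 26 * N)%nat by (simpl; lia).
    replace (3 ^ 1 * v)%nat with (K + 26 * N)%nat by (simpl; lia).
    rewrite (cpow_add xi N), (cpow_add xi K).
    transitivity (alpha * cpow xi N * cpow xi (26 * N))%K; [ring|]; rewrite E; ring. }
  rewrite Hr, cpow_mul, xi_pow3 in E'.
  destruct (cpow_binomial (cst (3 * 3 ^ Z.of_nat 1) * omega_ 1)%K v) as [t [x Hx]].
  rewrite Hx in E'; clear Hx Hr E; set (w := omega_ 1) in *.
  set (B := (Cubic 1 1 0 * cpow xi 2)%K) in *.
  change (3 * 3 ^ Z.of_nat 1) with 9 in E'; change (3 * 3 ^ Z.of_nat 3) with 81 in E'.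
  set (n := Z.of_nat v) in *; clearbody n.
  assert (E2 : (alpha + cst 81 * (alpha * r) = B + cst 9 * (cst n * (B * w)) + cst 81 * (B * (cst t * (w * w) + cst 9 * (w * w * w * x))))%K).
  { transitivity (alpha * (cst 1 + cst 81 * r))%K; [ring|]; rewrite E'; ring. }
  apply (f_equal c2) in E2; rewrite !c2_add, !c2_cst, ca in E2.
  change (c2 (B * w)%K) with (-945) in E2; change (c2 B) with 27 in E2; lia.
Qed.

(** The theta^2 coordinate of (1 + theta) omega is 0, so the expansion is used from s0 = 1 on and M
    - N is split modulo 3. Residue 0 leads to 1 + theta, residue 1 to (1 + theta) xi = -5 + 4 theta,
    and residue 2 is impossible modulo 81. *)
Lemma pure_theta (a b : Z) : a * a * a + 2 * (b * b * b) = 3 -> (a = 1 /\ b = 1) \/ (a = -5 /\ b = 4).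
Proof.
  intros H.
  assert (Hs : exists s, a = b + 3 * s).
  { destruct (cube_sub_dvd a) as [p Hp]; destruct (cube_sub_dvd b) as [q Hq].
    exists (1 - b * b * b - p + q); lia. }
  destruct Hs as [s Hs].
  (* The quotient of a + b theta by 1 + theta, integral because a = b modulo 3. *)
  destruct (norm_three (Cubic a b 0) (Cubic (b + s) (- s) s)) as [j [N [M [j3 E]]]].
  - rewrite Hs; apply cubic_eq; cbn [c0 c1 c2 cmul]; ring.
  - unfold norm; cbn [c0 c1 c2]; subst a; nia.
  - assert (j = 0 \/ j = 1 \/ j = 2)%nat as [-> | [-> | ->]] by lia.
    + change (Cubic 1 1 0 * cpow epsilon 0)%K with (Cubic 1 1 0) in E.
      set (d := Z.of_nat M - Z.of_nat N).
      assert (s1 : forall s d', (3 | d') -> (3 ^ Z.of_nat s | d') -> ~ (3 ^ Z.of_nat (S s) | d') -> (1 <= s)%nat).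
      { intros [|s'] d' h3 h1 h2; [exfalso; apply h2; exact h3 | lia]. }
      assert (Hd : d mod 3 = 0 \/ d mod 3 = 1 \/ d mod 3 = 2) by (pose proof (Z.mod_pos_bound d 3); lia).
      pose proof (Z.div_mod d 3 ltac:(discriminate)) as Ed; destruct Hd as [h | [h | h]]; rewrite h in Ed.
      * left; assert (M = N).
        { apply (coef_nonzero c2 (Cubic 1 1 0) c2_add c2_cst eq_refl) with (j := 2%nat) (s0 := 1%nat) (v := 1) (alpha := Cubic a b 0).
          - exists 1; reflexivity.
          - exists 0; reflexivity.
          - lia.
          - exists 0; reflexivity.
          - intros [z Hz]; lia.
          - intros s'; apply s1; exists (d / 3); fold d; lia.
          - exact E.
          - reflexivity. }
        subst M; apply xi_cancel in E; injection E; intros; split; assumption.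
      * right; assert (M = S N).
        { apply (coef_nonzero c2 (Cubic 1 1 0 * xi)%K c2_add c2_cst eq_refl) with (j := 2%nat) (s0 := 1%nat) (v := 2) (alpha := Cubic a b 0).
          - exists 1; reflexivity.
          - exists (-18); reflexivity.
          - lia.
          - exists (-6); reflexivity.
          - intros [z Hz]; lia.
          - intros s'; apply s1; exists (d / 3); lia.
          - cbn [cpow]; transitivity (xi * (Cubic a b 0 * cpow xi N))%K; [ring|]; rewrite E; ring.
          - reflexivity. }
        subst M; assert (E' : (Cubic a b 0 * cpow xi N = Cubic 1 1 0 * xi * cpow xi N)%K)
          by (rewrite E; cbn [cpow]; ring).
        apply xi_cancel in E'; injection E'; intros; split; assumption.
      (* Adding 2 to the exponent N moves xi^2 into the reference element and makes the difference
         of exponents a multiple of 3. *)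
      * exfalso; apply (no_theta_sq_two_mod3 (Cubic a b 0) (2 + N) M (Z.to_nat (9 * Z.of_nat N + 18 + d / 3))).
        -- lia.
        -- rewrite (cpow_add xi 2); transitivity (cpow xi 2 * (Cubic a b 0 * cpow xi N))%K; [ring|]; rewrite E; ring.
        -- reflexivity.
    + destruct (coef_mod3 c2 c2_add c2_cst _ _ _ _ E eq_refl) as [z Hz]; cbn in Hz; lia.
    + destruct (coef_mod3 c2 c2_add c2_cst _ _ _ _ E eq_refl) as [z Hz]; cbn in Hz; lia.
Qed.

End CubicField.

(** * The reduction *)

Module PowerEquation.

Import ZArith Znumtheory Zpow_facts Lia.
Import CubicField ExponentsFromFive.
Local Open Scope Z_scope.

Lemma power_equation (A B p q : Z) : 0 < B -> 0 < A + B -> rel_prime A B -> 2 <= Z.abs A ->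
  0 < p -> 0 < q -> rel_prime p q -> 2 * (A + B) * q ^ Z.abs A = B * p ^ Z.abs A ->
  (A = -3 /\ B = 128) \/ (A = 3 /\ B = 1).
Proof.
  intros B0 AB0 AB A2 p0 q0 pq E; set (k := Z.abs A) in *.
  assert (pk : 0 < p ^ k) by (apply Z.pow_pos_nonneg; lia).
  assert (qk : 0 < q ^ k) by (apply Z.pow_pos_nonneg; lia).
  assert (pqk : rel_prime (p ^ k) (q ^ k)) by (apply rel_prime_Zpower; try lia; exact pq).
  assert (AB' : rel_prime (A + B) B).
  { destruct AB as [_ _ h]; constructor; try apply Z.divide_1_l.
    intros x xAB xB; apply h; [|exact xB]; replace A with (A + B - B) by ring; apply Z.divide_sub_r; assumption. }
  (* For even B, A is odd by coprimality. For odd B, p is even, so 4 divides p^k = 2 (A + B); then A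
     + B is even and A is odd. *)
  assert (cases : Z.odd A = true /\
    ((2 * (A + B) = p ^ k /\ B = q ^ k /\ exists w, p = 2 * w) \/ (A + B = p ^ k /\ B = 2 * q ^ k))).
  { destruct (Z.Even_or_Odd B) as [[B' HB]|HB].
    - destruct (rel_prime_cross_prod (A + B) B' (p ^ k) (q ^ k)) as [E1 E2]; try lia; [|exact pqk|].
      { destruct AB' as [_ _ h]; constructor; try apply Z.divide_1_l.
        intros x h1 h2; apply h; [exact h1|]; rewrite HB; apply Z.divide_mul_r; exact h2. }
      split; [|right; lia].
      destruct (Z.Even_or_Odd A) as [[A' HA]|HA]; [exfalso|apply Z.odd_spec; exact HA].
      destruct AB as [_ _ h]; assert (h2 : (2 | 1)) by (apply h; [exists A' | exists B']; lia).
      apply Z.divide_1_r_nonneg in h2; lia.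
    - assert (h2 : rel_prime 2 B).
      { apply prime_rel_prime; [exact prime_2|]; intros [z Hz]; destruct HB as [w Hw]; lia. }
      destruct (rel_prime_cross_prod (2 * (A + B)) B (p ^ k) (q ^ k)) as [E1 E2]; try lia; [|exact pqk|].
      { apply rel_prime_sym, rel_prime_mult; apply rel_prime_sym; assumption. }
      assert (p2 : exists w, p = 2 * w).
      { apply Z.even_spec; rewrite <- (Z.even_pow p k) by lia; apply Z.even_spec; exists (A + B); lia. }
      split; [|left; tauto].
      destruct p2 as [w Hw]; rewrite Hw in E1.
      replace k with (2 + (k - 2)) in E1 by ring; rewrite Z.pow_add_r in E1 by lia.
      apply Z.odd_spec; destruct HB as [B' HB].
      exists (w ^ 2 * (2 * w) ^ (k - 2) - B' - 1).
      replace ((2 * w) ^ 2) with (4 * w ^ 2) in E1 by ring; lia. }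
  destruct cases as [Ao cases].
  assert (k3 : k = 3).
  { destruct (Z_lt_le_dec k 5) as [lt|ge].
    - assert (k = 2 \/ k = 3 \/ k = 4) as [h | [h | h]] by lia; [exfalso|exact h|exfalso];
        apply Z.odd_spec in Ao; destruct Ao as [z Hz]; lia.
    - exfalso; assert (ko : Z.odd k = true).
      { apply Z.odd_spec; apply Z.odd_spec in Ao; destruct Ao as [z Hz].
        destruct (Z_le_gt_dec 0 A); [exists z | exists (- z - 1)]; lia. }
      pose proof (no_solution_ge5_Z ge ko p0 q0) as h; cbv zeta in h.
      destruct h as [h1 h2]; destruct cases as [[E1 [E2 _]]|[E1 E2]]; [apply h2 | apply h1]; lia. }
  rewrite k3 in *; assert (A3 : A = 3 \/ A = -3) by lia.
  replace (p ^ 3) with (p * p * p) in * by ring; replace (q ^ 3) with (q * q * q) in * by ring.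
  (* With p = 2w the equation becomes 4 w^3 - q^3 = A, otherwise p^3 - 2 q^3 = A; signs are moved
     into the cubes to reach the right-hand side 3. *)
  destruct cases as [[E1 [E2 [w Hw]]]|[E1 E2]].
  - subst p; destruct A3 as [-> | ->].
    + destruct (pure_theta_sq (- q) w); [lia|]; right; subst w; assert (q = 1) by lia; subst q; lia.
    + destruct (pure_theta_sq q (- w)); lia.
  - destruct A3 as [-> | ->].
    + destruct (pure_theta p (- q)); lia.
    + destruct (pure_theta (- p) q) as [h | h]; [lia | lia |].
      left; assert (q = 4) by lia; subst q; lia.
Qed.

End PowerEquation.

Require Import Defs.
Import ZArith Znumtheory Lia Lra.
Import PowerEquation.
Open Scope R_scope.

(** * From real powers to integer powers *)

Definition posrat (r : R) : Prop := exists p q : Z, (0 < p)%Z /\ (0 < q)%Z /\ r = IZR p / IZR q.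

Lemma posrat_pos r : posrat r -> 0 < r.
Proof.
  intros [p [q [p0 [q0 ->]]]]; apply IZR_lt in p0, q0; apply Rdiv_lt_0_compat; assumption.
Qed.

Lemma posrat_Q2R (x : Q) : (0 < x)%Q -> posrat (Q2R x).
Proof.
  intros h; exists (Qnum x), (Zpos (Qden x)); split; [|split; [reflexivity|reflexivity]].
  unfold Qlt in h; simpl in h; lia.
Qed.

Lemma posrat_one : posrat 1.
Proof. exists 1%Z, 1%Z; repeat split; field. Qed.

Lemma posrat_mul r s : posrat r -> posrat s -> posrat (r * s).
Proof.
  intros [p [q [p0 [q0 ->]]]] [p' [q' [p0' [q0' ->]]]]; exists (p * p')%Z, (q * q')%Z.
  split; [lia | split; [lia|]]; rewrite !mult_IZR; apply IZR_lt in q0, q0'; field; lra.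
Qed.

Lemma posrat_inv r : posrat r -> posrat (/ r).
Proof.
  intros [p [q [p0 [q0 ->]]]]; exists q, p; split; [lia | split; [lia|]].
  apply IZR_lt in p0, q0; field; lra.
Qed.

Lemma posrat_pow r n : posrat r -> posrat (r ^ n).
Proof. intros h; induction n; simpl; [apply posrat_one | apply posrat_mul; assumption]. Qed.

Lemma posrat_powerRZ r z : posrat r -> posrat (powerRZ r z).
Proof.
  intros h; destruct z; simpl; [apply posrat_one | apply posrat_pow; exact h | apply posrat_inv, posrat_pow; exact h].
Qed.

Lemma posrat_lowest r : posrat r ->
  exists p q : Z, (0 < p)%Z /\ (0 < q)%Z /\ rel_prime p q /\ r = IZR p / IZR q.
Proof.
  intros [p [q [p0 [q0 ->]]]].
  assert (g0 : (0 < Z.gcd p q)%Z) by (pose proof (Z.gcd_nonneg p q); pose proof (Z.gcd_eq_0_l p q); lia).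
  destruct (Z.gcd_divide_l p q) as [p' Hp]; destruct (Z.gcd_divide_r p q) as [q' Hq].
  set (g := Z.gcd p q) in *.
  exists p', q'; split; [nia | split; [nia | split]].
  - apply Zgcd_1_rel_prime, (Z.mul_reg_l _ _ g); [lia|].
    rewrite <- Z.gcd_mul_mono_l_nonneg, !(Z.mul_comm g), <- Hp, <- Hq by lia; lia.
  - assert (q0' : (0 < q')%Z) by nia.
    rewrite Hp, Hq, !mult_IZR; apply IZR_lt in g0, q0'; field; lra.
Qed.

Lemma Rpower_eq_ln a b c d : 0 < a -> 0 < c -> Rpower a b = Rpower c d -> b * ln a = d * ln c.
Proof. unfold Rpower; intros _ _ h; apply exp_inv in h; exact h. Qed.

Lemma ln_eq_0 a : 0 < a -> ln a = 0 -> a = 1.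
Proof. intros a0 h; apply ln_inv; [exact a0 | lra | rewrite ln_1; exact h]. Qed.

Lemma powerRZ_lnE a (z : Z) : 0 < a -> ln (powerRZ a z) = IZR z * ln a.
Proof. intros a0; rewrite powerRZ_Rpower by exact a0; unfold Rpower; apply ln_exp. Qed.

(* With [T = y / (2x)] the equation reads [(T - 1) ln x = ln (2T)]. *)
Lemma exponent_form (X Y : R) : posrat X -> posrat Y -> X <> 1 -> Y * ln X = 2 * X * ln Y ->
  exists A B : Z, (0 < B)%Z /\ (0 < A + B)%Z /\ A <> 0%Z /\ rel_prime A B /\
    Y = 2 * (IZR (A + B) / IZR B) * X /\ IZR A * ln X = IZR B * ln (2 * (IZR (A + B) / IZR B)).
Proof.
  intros QX QY X1 E; pose proof (posrat_pos X QX) as X0; pose proof (posrat_pos Y QY) as Y0.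
  destruct (posrat_lowest (Y * / (2 * X))) as [a [b [a0 [b0 [ab Ht]]]]].
  { apply posrat_mul; [exact QY|]; apply posrat_inv, posrat_mul; [|exact QX].
    exists 2%Z, 1%Z; repeat split; field. }
  pose proof (IZR_lt _ _ a0) as ra; pose proof (IZR_lt _ _ b0) as rb.
  assert (EY : Y = 2 * (IZR a / IZR b) * X) by (rewrite <- Ht; field; lra).
  set (T := IZR a / IZR b) in *.
  assert (T0 : 0 < T) by (apply Rdiv_lt_0_compat; assumption).
  assert (ET : (T - 1) * ln X = ln (2 * T)).
  { rewrite EY in E at 2; rewrite ln_mult in E by lra.
    apply (Rmult_eq_reg_l (2 * X)); [|lra]; rewrite EY in E; lra. }
  exists (a - b)%Z, b; replace (a - b + b)%Z with a by ring; fold T.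
  assert (EA : IZR (a - b) = IZR b * (T - 1)) by (rewrite minus_IZR; unfold T; field; lra).
  split; [exact b0 | split; [exact a0 | split; [|split; [|split]]]].
  - intros h; assert (T1 : T = 1).
    { rewrite h in EA; apply eq_sym, Rmult_integral in EA; destruct EA; lra. }
    rewrite T1 in ET; pose proof (ln_increasing 1 (2 * 1)) as h2; rewrite ln_1 in h2; lra.
  - destruct ab as [_ _ h]; constructor; try apply Z.divide_1_l.
    intros x h1 h2; apply h; [|exact h2]; replace a with (a - b + b)%Z by ring.
    apply Z.divide_add_r; assumption.
  - exact EY.
  - rewrite EA, <- ET; ring.
Qed.

(** If u A + v B = 1, then S = U^u X^v satisfies U = S^A; for negative A its inverse is taken. *)
Lemma base_is_power (A B : Z) (X U : R) : posrat X -> posrat U -> rel_prime A B ->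
  IZR A * ln X = IZR B * ln U -> exists S, posrat S /\ ln U = IZR (Z.abs A) * ln S.
Proof.
  intros QX QU AB E; pose proof (posrat_pos X QX) as X0; pose proof (posrat_pos U QU) as U0.
  destruct (rel_prime_bezout _ _ AB) as [u v Huv].
  set (S := powerRZ U u * powerRZ X v).
  assert (QS : posrat S) by (apply posrat_mul; apply posrat_powerRZ; assumption).
  assert (ES : ln U = IZR A * ln S).
  { unfold S; rewrite ln_mult, !powerRZ_lnE by (try apply powerRZ_lt; assumption).
    transitivity (IZR (u * A + v * B) * ln U); [rewrite Huv; ring|].
    rewrite plus_IZR, !mult_IZR.
    transitivity (IZR u * IZR A * ln U + IZR v * (IZR B * ln U)); [ring|]; rewrite <- E; ring. }
  destruct (Z_le_gt_dec 0 A) as [ge|lt].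
  - exists S; split; [exact QS|]; rewrite Z.abs_eq by exact ge; exact ES.
  - exists (/ S); split; [apply posrat_inv; exact QS|].
    rewrite ln_Rinv by (apply posrat_pos; exact QS); rewrite Z.abs_neq, opp_IZR, ES by lia; ring.
Qed.

Lemma exponent_cases (A B : Z) (X : R) : posrat X -> (0 < B)%Z -> (0 < A + B)%Z -> rel_prime A B ->
  (2 <= Z.abs A)%Z -> IZR A * ln X = IZR B * ln (2 * (IZR (A + B) / IZR B)) ->
  (A = -3 /\ B = 128)%Z \/ (A = 3 /\ B = 1)%Z.
Proof.
  intros QX B0 AB0 AB A2 E; pose proof (IZR_lt _ _ B0) as rB; pose proof (IZR_lt _ _ AB0) as rAB.
  destruct (base_is_power A B X (2 * (IZR (A + B) / IZR B)) QX) as [S [QS ES]]; [|exact AB|exact E|].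
  { exists (2 * (A + B))%Z, B; split; [lia | split; [lia|]]; rewrite mult_IZR; field; lra. }
  destruct (posrat_lowest S QS) as [p [q [p0 [q0 [pq ->]]]]].
  apply (power_equation A B p q); try assumption.
  pose proof (IZR_lt _ _ p0) as rp; pose proof (IZR_lt _ _ q0) as rq.
  assert (Epow : 2 * (IZR (A + B) / IZR B) = (IZR p / IZR q) ^ Z.abs_nat A).
  { apply ln_inv; [apply Rmult_lt_0_compat; [lra | apply Rdiv_lt_0_compat; assumption]
      | apply pow_lt, Rdiv_lt_0_compat; assumption |].
    rewrite ES, ln_pow by (apply Rdiv_lt_0_compat; assumption).
    rewrite INR_IZR_INZ, Zabs2Nat.id_abs; reflexivity. }
  unfold Rdiv in Epow at 2; rewrite Rpow_mult_distr, pow_inv in Epow.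
  assert (qn : IZR q ^ Z.abs_nat A <> 0) by (apply pow_nonzero; lra).
  apply eq_IZR; rewrite !mult_IZR, <- !Zabs2Nat.id_abs, <- !pow_IZR.
  apply (Rmult_eq_reg_r (/ IZR B * / IZR q ^ Z.abs_nat A)).
  - transitivity (2 * (IZR (A + B) / IZR B)); [field; split; (exact qn || lra)|].
    rewrite Epow; field; split; (exact qn || lra).
  - apply Rmult_integral_contrapositive_currified; apply Rinv_neq_0_compat; [lra | exact qn].
Qed.

Theorem theorem2 (x y : Q) (hx : (0 < x)%Q) (hy : (0 < y)%Q)
  (h : Rpower (Q2R x) (Q2R y) = Rpower (Q2R y) (2 * Q2R x)) :
  (exists n : Z, n <> 0%Z /\ n <> (-1)%Z /\
     Q2R x = powerRZ (2 + 2 / IZR n) n /\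
     Q2R y = powerRZ (2 + 2 / IZR n) (1 + n)) \/
  (Q2R x = 1 /\ Q2R y = 1) \/
  (Q2R x = 2 /\ Q2R y = 16) \/
  (Q2R x = (4/5) ^ 128 /\ Q2R y = (4/5) ^ 125).
Proof.
  apply posrat_Q2R in hx, hy; set (X := Q2R x) in *; set (Y := Q2R y) in *; clearbody X Y.
  pose proof (posrat_pos X hx) as X0; pose proof (posrat_pos Y hy) as Y0.
  apply Rpower_eq_ln in h; try assumption.
  destruct (Req_dec X 1) as [X1|X1].
  { right; left; split; [exact X1|]; rewrite X1, ln_1 in h.
    apply ln_eq_0; [exact Y0 | lra]. }
  destruct (exponent_form X Y hx hy X1 h) as [A [B [B0 [AB0 [A0 [AB [EY E]]]]]]].
  pose proof (IZR_lt _ _ B0) as rB; pose proof (IZR_lt _ _ AB0) as rAB.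
  set (U := 2 * (IZR (A + B) / IZR B)) in *.
  assert (U0 : 0 < U) by (apply Rmult_lt_0_compat; [lra | apply Rdiv_lt_0_compat; assumption]).
  assert (power : forall n : Z, ln X = IZR n * ln U -> X = powerRZ U n /\ Y = powerRZ U (1 + n)).
  { intros n hn; assert (EX : X = powerRZ U n).
    { apply ln_inv; [exact X0 | apply powerRZ_lt; exact U0 | rewrite powerRZ_lnE; assumption]. }
    split; [exact EX|]; rewrite powerRZ_add by lra; rewrite <- EX, powerRZ_1; exact EY. }
  destruct (Z_lt_le_dec (Z.abs A) 2) as [A2|A2].
  (* A = 1 gives n = B and A = -1 gives n = -B; in the second case A + B > 0 means B >= 2, so n is
     not -1. *)
  - left; assert (A1 : (A = 1 \/ A = -1)%Z) by lia; destruct A1; subst A.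
    + exists B; split; [lia | split; [lia|]].
      replace (2 + 2 / IZR B) with U by (unfold U; rewrite plus_IZR; field; lra).
      apply power; lra.
    + exists (- B)%Z; split; [lia | split; [lia|]].
      replace (2 + 2 / IZR (- B)) with U by (unfold U; rewrite plus_IZR, opp_IZR; field; lra).
      apply power; rewrite opp_IZR; lra.
  - destruct (exponent_cases A B X hx B0 AB0 AB A2 E) as [[HA HB]|[HA HB]]; subst A B.
    (* Here U = 2 * 125 / 128 = (5/4)^3 and -3 ln X = 128 ln U. *)
    + right; right; right.
      assert (EX : X = (4 / 5) ^ 128).
      { apply ln_inv; [exact X0 | apply pow_lt; lra |]; rewrite ln_pow by lra.
        replace U with (((/ (4 / 5)) ^ 3)) in E by (unfold U; simpl; field).
        rewrite ln_pow, ln_Rinv in E by lra; simpl INR in *; lra. }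
      split; [exact EX|]; rewrite EY, EX.
      replace ((4 / 5) ^ 128) with ((4 / 5) ^ 3 * (4 / 5) ^ 125) by (rewrite <- pow_add; reflexivity).
      unfold U; simpl (-3 + 128)%Z; field.
    + right; right; left; assert (EX : X = 2).
      { apply ln_inv; [exact X0 | lra |].
        replace U with (2 ^ 3) in E by (unfold U; simpl; field).
        rewrite ln_pow in E by lra; simpl INR in *; lra. }
      split; [exact EX|]; rewrite EY, EX; unfold U; simpl; field.
Qed.
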